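(* Consider the Filippov system $\dot{\mathbf x}\in\mathbf V(\mathbf x)$ on $\mathcal B=\{(w,\eta,\xi): w\in\mathbb R,\ \eta\in[0,1],\ \xi\in[0,1]\}$ defined in the context, with the parameter values $$Q=343,\quad A=202,\quad B=1.9,\quad C=3.04,\quad \alpha_1=0.32,\quad \alpha_2=0.62,\quad s_2=-0.482,$$ $$T_c^+=-10,\quad T_c^-=-5.5,\quad b_0=1.5,\quad b=1.75,\quad b_1=5,\quad a=1.05,\quad \tau=1,\quad \rho=0.1,$$ and with $\epsilon>0$ left free. Then there exists $\hat\epsilon>0$ such that for all $\epsilon$ with $0<\epsilon\le\hat\epsilon$, the system $\dot{\mathbf x}\in\mathbf V(\mathbf x)$ admits an attracting periodic orbit.
   Context: Auxiliary functions. Put $\alpha_0=\tfrac12(\alpha_1+\alpha_2)$, $L=Q/(B+C)$, $p_2(\eta)=\tfrac12(3\eta^2-1)$, $P_2(\eta)=\int_0^\eta p_2(y)\,dy=\tfrac12(\eta^3-\eta)$, and $$F(\eta)=\frac1B\Big(Q(1-\alpha_0)-A+CL(\alpha_2-\alpha_1)\big(\eta-\tfrac12+s_2P_2(\eta)\big)\Big),$$ $$G_\pm(\eta)=-Ls_2(1-\alpha_0)p_2(\eta)+T_c^\pm .$$ Vector fields. For $\mathbf x=(w,\eta,\xi)$ let $$\mathbf V_-(\mathbf x)=\big(-\tau(w-F(\eta)),\ \rho(w-G_-(\eta)),\ \epsilon(b_0(\eta-\xi)-a(1-\eta))\big),$$ $$\mathbf V_+(\mathbf x)=\big(-\tau(w-F(\eta)),\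 \rho(w-G_+(\eta)),\ \epsilon(b_1(\eta-\xi)-a(1-\eta))\big).$$ Discontinuity boundary. Let $\gamma(\eta)=(1+\tfrac ab)\eta-\tfrac ab$, and within $\mathcal B$ let $\Sigma=\{\xi=\gamma(\eta)\}$ (equivalently $b(\eta-\xi)-a(1-\eta)=0$), $S_+=\{\xi<\gamma(\eta)\}$, $S_-=\{\xi>\gamma(\eta)\}$. Filippov system. The set-valued map $\mathbf V$ is $$\mathbf V(\mathbf x)=\begin{cases}\{\mathbf V_-(\mathbf x)\}, & \mathbf x\in S_-,\\ \{(1-q)\mathbf V_-(\mathbf x)+q\mathbf V_+(\mathbf x): q\in[0,1]\}, & \mathbf x\in\Sigma,\\ \{\mathbf V_+(\mathbf x)\}, & \mathbf x\in S_+.\end{cases}$$ A solution (in the sense of Filippov) of $\dot{\mathbf x}\in\mathbf V(\mathbf x)$ is an absolutely continuous function $\mathbf x(t)$ with values in $\mathcal B$ satisfying $\dot{\mathbf x}(t)\in\mathbf V(\mathbf x(t))$ for almost all $t$. A periodic orbit is the image $\Gamma$ of a nonconstant periodic solution in this sense. It is attracting if there is an open neighborhood $U$ of $\Gamma$ in $\mathcal B$ such that every maximal forward solution $\mathbf x(t)$ with $\mathbf x(0)\in U$ is defined for all $t\ge0$ and satisfies $\operatorname{dist}(\mathbf x(t),\Gamma)\to0$ as $t\to\infty$. *)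

(* Defs.v *)
From mathcomp Require Import all_boot all_order all_algebra.
From mathcomp Require Import all_classical all_reals all_analysis.
From mathcomp Require Import ring.
Set Implicit Arguments.
Unset Strict Implicit.
Unset Printing Implicit Defensive.
Import Order.TTheory GRing.Theory Num.Theory.
Import numFieldNormedType.Exports.
Local Open Scope classical_set_scope.
Local Open Scope ring_scope.

Record params (R : realType) := Params {
  par_Q : R; par_A : R; par_B : R; par_C : R;
  par_alpha1 : R; par_alpha2 : R; par_s2 : R;
  par_Tcp : R; par_Tcm : R;
  par_b0 : R; par_b : R; par_b1 : R; par_a : R;
  par_tau : R; par_rho : R; par_eps : R }.

Definition param_values (R : realType) (eps : R) : params R := {|
  par_Q := 343; par_A := 202; par_B := 19 / 10; par_C := 304 / 100;
  par_alpha1 := 32 / 100; par_alpha2 := 62 / 100; par_s2 := - (482 / 1000);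
  par_Tcp := - 10; par_Tcm := - (55 / 10);
  par_b0 := 15 / 10; par_b := 175 / 100; par_b1 := 5; par_a := 105 / 100;
  par_tau := 1; par_rho := 1 / 10; par_eps := eps |}.

(* A state is the row vector (w, eta, xi); the topology and the derivative on
   'rV[R]_3 are those of the sup norm, which is equivalent to the Euclidean
   one. *)
Definition mkstate (R : realType) (w eta xi : R) : 'rV[R]_3 :=
  \row_(i < 3) nth 0 [:: w; eta; xi] i.

Definition st_w (R : realType) (x : 'rV[R]_3) : R := x ord0 (inord 0).
Definition st_eta (R : realType) (x : 'rV[R]_3) : R := x ord0 (inord 1).
Definition st_xi (R : realType) (x : 'rV[R]_3) : R := x ord0 (inord 2).

Definition domain (R : realType) : set 'rV[R]_3 :=
  [set x | 0 <= st_eta x <= 1 /\ 0 <= st_xi x <= 1].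

Section VectorFields.
Context {R : realType} (P : params R).
Local Notation Q := (par_Q P).
Local Notation A := (par_A P).
Local Notation B := (par_B P).
Local Notation C := (par_C P).
Local Notation alpha1 := (par_alpha1 P).
Local Notation alpha2 := (par_alpha2 P).
Local Notation s2 := (par_s2 P).
Local Notation a := (par_a P).
Local Notation b := (par_b P).

Definition alpha0 : R := (alpha1 + alpha2) / 2.
Definition L : R := Q / (B + C).
Definition p2 (eta : R) : R := (3 * eta ^+ 2 - 1) / 2.

(* The primitive of p2 that vanishes at 0, see P2_integral. *)
Definition P2 (eta : R) : R := (eta ^+ 3 - eta) / 2.

Definition F (eta : R) : R :=
  1 / B * (Q * (1 - alpha0) - A
           + C * L * (alpha2 - alpha1) * (eta - 1 / 2 + s2 * P2 eta)).

Definition G (Tc eta : R) : R := - L * s2 * (1 - alpha0) * p2 eta + Tc.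

Definition vfield (Tc beta : R) (x : 'rV[R]_3) : 'rV[R]_3 :=
  let w := st_w x in let eta := st_eta x in let xi := st_xi x in
  mkstate (- par_tau P * (w - F eta))
          (par_rho P * (w - G Tc eta))
          (par_eps P * (beta * (eta - xi) - a * (1 - eta))).

Definition Vminus : 'rV[R]_3 -> 'rV[R]_3 := vfield (par_Tcm P) (par_b0 P).
Definition Vplus : 'rV[R]_3 -> 'rV[R]_3 := vfield (par_Tcp P) (par_b1 P).

Definition gamma (eta : R) : R := (1 + a / b) * eta - a / b.

Definition Sigma : set 'rV[R]_3 :=
  [set x | domain x /\ st_xi x = gamma (st_eta x)].
Definition Splus : set 'rV[R]_3 :=
  [set x | domain x /\ st_xi x < gamma (st_eta x)].
Definition Sminus : set 'rV[R]_3 :=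
  [set x | domain x /\ st_xi x > gamma (st_eta x)].

Definition filippov (x : 'rV[R]_3) : set 'rV[R]_3 :=
  [set v | [\/ Sminus x /\ v = Vminus x,
               Sigma x /\ (exists2 q : R, 0 <= q <= 1 &
                             v = (1 - q) *: Vminus x + q *: Vplus x)
             | Splus x /\ v = Vplus x]].

End VectorFields.

Lemma P2_integral (R : realType) (eta : R) : 0 <= eta ->
  P2 eta = \int[lebesgue_measure]_(y in `[0, eta]) p2 y.
Proof.
rewrite le_eqVlt => /predU1P[<-|eta0].
  by rewrite set_itv1 Rintegral_set1 /P2 expr0n subrr mul0r.
have dP2 (x : R) : is_derive x 1 (@P2 R) (p2 x).
  rewrite /P2; apply: is_derive_eq.
  by rewrite /p2 /GRing.scale /=; field.
have cP2 : continuous (@P2 R).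
  by move=> x; apply/differentiable_continuous/derivable1_diffP.
have cp2 : continuous (@p2 R).
  move=> x; apply/differentiable_continuous/derivable1_diffP.
  by rewrite /p2.
rewrite /Rintegral (@continuous_FTC2 _ _ (@P2 R)) //.
- by rewrite /= /P2 expr0n subrr mul0r subr0.
- exact: continuous_subspaceT.
- split.
  + by move=> x _.
  + exact/cvg_at_right_filter/cP2.
  + exact/cvg_at_left_filter/cP2.
- by move=> x _; rewrite derive1E derive_val.
Qed.

Definition abs_continuous (R : realType) (V : normedModType R)
    (a b : R) (f : R -> V) : Prop :=
  forall e : R, 0 < e -> exists2 d : R, 0 < d &
    forall (n : nat) (u v : 'I_n -> R),
      (forall i, [/\ a <= u i, u i <= v i & v i <= b]) ->
      trivIset setT (fun i => `]u i, v i[%classic) ->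
      \sum_(i < n) (v i - u i) < d ->
      \sum_(i < n) `|f (v i) - f (u i)| < e.

(* On a non-compact interval, absolute continuity is required on every compact
   subinterval.  The endpoints of I are negligible, so it is harmless to use
   the two-sided derivative of the total function x. *)
Definition solution (R : realType) (P : params R) (I : set R)
    (x : R -> 'rV[R]_3) : Prop :=
  [/\ forall t, I t -> domain (x t),
      forall a b, a <= b -> `[a, b] `<=` I -> abs_continuous a b x &
      {ae lebesgue_measure, forall t, I t ->
         derivable x t 1 /\ filippov P (x t) ('D_1 x t)}].

Definition forward_interval (R : realType) (I : set R) : Prop :=
  [/\ is_interval I, I 0 & I `<=` `[0, +oo[].

(* The degenerate interval [set 0] is allowed: a state from which no motion is
   possible has a maximal forward solution, which is not defined for all
   t >= 0. *)
Definition maximal_forward_solution (R : realType) (P : params R)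
    (I : set R) (x : R -> 'rV[R]_3) : Prop :=
  [/\ forward_interval I, solution P I x &
      forall (J : set R) (y : R -> 'rV[R]_3),
        forward_interval J -> solution P J y -> I `<=` J ->
        (forall t, I t -> y t = x t) -> J = I].

Definition periodic_orbit (R : realType) (P : params R)
    (Gam : set 'rV[R]_3) : Prop :=
  exists x : R -> 'rV[R]_3,
    [/\ solution P setT x,
        exists2 T : R, 0 < T & forall t, x (t + T) = x t,
        exists t1 t2, x t1 <> x t2 &
        Gam = range x].

Definition dist (R : realType) (p : 'rV[R]_3) (Gam : set 'rV[R]_3) : R :=
  inf [set `|p - q| | q in Gam].

Definition attracting (R : realType) (P : params R)
    (Gam : set 'rV[R]_3) : Prop :=
  exists U : set 'rV[R]_3,
    [/\ exists2 O : set 'rV[R]_3, open O & U = O `&` @domain R,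
        Gam `<=` U &
        forall (I : set R) (x : R -> 'rV[R]_3),
          maximal_forward_solution P I x -> U (x 0) ->
          I = `[0, +oo[%classic /\ dist (x t) Gam @[t --> +oo] --> (0 : R)].

(* Main.v *)
Require Import Defs.
From mathcomp Require Import all_boot all_order all_algebra.
From mathcomp Require Import all_classical all_reals all_analysis.
From mathcomp Require Import ring lra.
Import Order.TTheory GRing.Theory Num.Theory.
Import numFieldNormedType.Exports.
Set Implicit Arguments.
Unset Strict Implicit.
Unset Printing Implicit Defensive.
Local Open Scope classical_set_scope.
Local Open Scope ring_scope.

(** Why the theorem is true.  In each mode the pair (w, eta) obeys a planar
    system in which neither xi nor eps occurs; the two modes, written as a
    boolean s (true for [Vplus], false for [Vminus]), differ there only by the
    constant [Tc_of s].  On the box -6/5 <= w <= 29/5, 7/10 <= eta <= 97/100,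
    which both modes preserve, F and G are increasing, and the slopes of F stay
    below those of G; hence u^2 + 250 v^2 decays at rate 1/5 along the
    difference (u, v) of any two solutions of the same mode
    ([fast_traj_contract]).  Each mode thus has one equilibrium
    (w_eq s, eta_eq s) in the box, and every solution settles near it after a
    time of order log (1/eps), while xi moves with speed of order eps.

    Let the depth of a state in the region of mode s be the signed quantity
    sgm s * (gamma eta - xi).  When mode s takes over near the equilibrium of
    the other mode, eta moves towards eta_eq s at a speed bounded below, so the
    depth becomes positive ([depth_rate_fast]) and stays so while xi has hardly
    moved.  Once (w, eta) is within eps/500 of the equilibrium of mode s, the
    motion of xi dominates and pushes the depth down at rate at least eps/1000
    ([depth_rate_slow]), so Sigma is hit again, now near the equilibrium of
    mode s.  This is a leg ([leg_of_traj]).  At both of these gates all the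
    Filippov velocities cross Sigma in the same direction.

    A leg lasts at least settle eps = 3/(1000 eps), so its fast part contracts
    by a factor exponentially small in 1/eps, whereas its hitting time depends
    on the starting point with a Lipschitz constant of order 1/eps only
    ([leg_time]).  The map from gate to gate is therefore a contraction
    ([leg_end]), and two legs close up into a cycle ([cycle_exists]).

    For Filippov solutions, absolute continuity and the differential inclusion
    are used through one inequality: an absolutely continuous function whose
    derivative is almost everywhere at least c grows at least at rate c
    ([ac_increment_ge]).  It gives uniqueness inside a region ([follow_side])
    and the passage through a gate without sliding ([crossing]); hence a
    maximal solution follows the solution of a single mode up to the next gate
    ([reach]).  A solution started in the neighbourhood [basin] of the cycle
    reaches a gate ([gate_from_basin]), and from there on each leg divides its
    deviation from the cycle by at least 20 ([gate_step]). *)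

(** * Mean value inequalities and barriers *)

Section MeanValue.
Context {R : realType}.
Implicit Types (f g df dg : R -> R) (a b c t : R).

Lemma is_derive_continuous f t d : is_derive t 1 f d -> {for t, continuous f}.
Proof. by move=> df; apply/differentiable_continuous/derivable1_diffP. Qed.

Lemma is_derive_subr f c t d :
  is_derive (t - c) 1 f d -> is_derive t 1 (fun t => f (t - c)) d.
Proof.
move=> hg; have hs : is_derive t 1 (fun t : R => t - c) 1.
  by apply: is_derive_eq; rewrite oppr0 addr0.
by rewrite -[d]mulr1; exact: (@is_derive1_comp _ f (fun t => t - c) t d 1 hg hs).
Qed.

(** The mean value theorem applied to g - f; all comparison arguments for
    classical solutions go through this form. *)
Lemma le_increment f df g dg a b : a <= b ->
  (forall t, a <= t <= b -> is_derive t 1 f (df t)) ->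
  (forall t, a <= t <= b -> is_derive t 1 g (dg t)) ->
  (forall t, a <= t <= b -> df t <= dg t) ->
  f b - f a <= g b - g a.
Proof.
move=> ab hf hg hd.
have hgf t : a <= t <= b -> is_derive t 1 (g \- f) (dg t - df t).
  by move=> tab; have := hf t tab; have := hg t tab => ? ?; apply: is_deriveB.
have [||c cab e] := @MVT_segment _ (g \- f) (fun t => dg t - df t) a b ab.
- by move=> x; rewrite in_itv /= => /andP[/ltW ax /ltW xb]; apply: hgf; rewrite ax.
- apply: continuous_in_subspaceT => x; rewrite inE /= in_itv /= => xab.
  exact: is_derive_continuous (hgf _ xab).
rewrite -subr_ge0.
have -> : g b - g a - (f b - f a) = (g \- f) b - (g \- f) a by rewrite /=; ring.
rewrite e mulr_ge0 ?subr_ge0 // hd //.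
Qed.

Lemma abs_increment f df g dg a b : a <= b ->
  (forall t, a <= t <= b -> is_derive t 1 f (df t)) ->
  (forall t, a <= t <= b -> is_derive t 1 g (dg t)) ->
  (forall t, a <= t <= b -> `|df t| <= dg t) ->
  `|f b - f a| <= g b - g a.
Proof.
move=> ab hf hg hd; rewrite ler_norml; apply/andP; split.
  have : - f b - - f a <= g b - g a.
    apply: (@le_increment (fun t => - f t) (fun t => - df t) g dg a b ab) => // t tab.
      by have := hf t tab => ?; apply: is_deriveN.
    by have := hd _ tab; rewrite ler_norml lerNl => /andP[].
  lra.
apply: (le_increment ab hf hg) => t /hd.
by apply: le_trans; apply: ler_norm.
Qed.

Lemma lip_increment f df a b K : a <= b ->
  (forall t, a <= t <= b -> is_derive t 1 f (df t)) ->
  (forall t, a <= t <= b -> `|df t| <= K) ->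
  `|f b - f a| <= K * (b - a).
Proof.
move=> ab hf hd.
have -> : K * (b - a) = (fun t => K * t) b - (fun t => K * t) a by ring.
apply: (abs_increment ab hf (dg := fun=> K)) => // t _.
by apply: is_derive_eq; rewrite /GRing.scale /= mulr1.
Qed.

(** The function exp (M (t - a)) f t is nondecreasing. *)
Lemma gronwall_lb f df a b M : a <= b ->
  (forall t, a <= t <= b -> is_derive t 1 f (df t)) ->
  (forall t, a <= t <= b -> - M * f t <= df t) ->
  expR (- M * (b - a)) * f a <= f b.
Proof.
move=> ab hf hd.
have hE t : is_derive t 1 (fun t => expR (M * (t - a))) (M * expR (M * (t - a))).
  apply: is_derive_eq; rewrite /GRing.scale /= ; ring.
have h1 : 0 - 0 <= expR (M * (b - a)) * f b - expR (M * (a - a)) * f a.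
  apply: (@le_increment (fun=> 0) (fun=> 0) (fun t => expR (M * (t - a)) * f t)
    (fun t => expR (M * (t - a)) * (M * f t + df t)) a b ab) => t tab.
  - have h1 := hf t tab; have h2 := hE t.
    apply: is_derive_eq; rewrite /GRing.scale /=; ring.
  - by rewrite mulr_ge0 ?expR_ge0 //; have := hd t tab; lra.
move: h1; rewrite subrr subr_ge0 subrr mulr0 expR0 mul1r mulNr expRN.
by rewrite ler_pdivrMl ?expR_gt0.
Qed.

Lemma gronwall_ge0 f df a b M : a <= b ->
  (forall t, a <= t <= b -> is_derive t 1 f (df t)) ->
  (forall t, a <= t <= b -> - M * f t <= df t) ->
  0 <= f a -> 0 <= f b.
Proof.
move=> ab hf hd fa; apply: le_trans (gronwall_lb ab hf hd).
by rewrite mulr_ge0 ?expR_ge0.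
Qed.

Lemma gronwall_gt0 f df a b M : a <= b ->
  (forall t, a <= t <= b -> is_derive t 1 f (df t)) ->
  (forall t, a <= t <= b -> - M * f t <= df t) ->
  0 < f a -> 0 < f b.
Proof.
move=> ab hf hd fa; apply: lt_le_trans (gronwall_lb ab hf hd).
by rewrite mulr_gt0 ?expR_gt0.
Qed.

Lemma derive_gt0_left f t d e : is_derive t 1 f d -> 0 < d -> 0 < e ->
  exists2 s, t - e < s < t & f s < f t.
Proof.
move=> [df de] d0 e0.
have : h^-1 *: (f (h *: 1 + t) - f t) @[h --> 0^'] --> d.
  by rewrite -de; exact: df.
move=> /cvgrPdist_lt/(_ _ d0)[r /= r0 hr].
pose h : R := - (Num.min r e / 2).
have m0 : 0 < Num.min r e by rewrite lt_min r0 e0.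
have mr : Num.min r e <= r by rewrite ge_min lexx.
have me : Num.min r e <= e by rewrite ge_min lexx orbT.
have h0 : h < 0 by rewrite /h; lra.
exists (h + t); first by rewrite /h; lra.
have := hr h; rewrite /ball_ /= sub0r normrN (ltr0_norm h0).
have -> : - h < r by rewrite /h; lra.
move=> /(_ isT); rewrite lt_eqF // => /(_ isT).
rewrite /GRing.scale /= mulr1 => /(le_lt_trans (ler_norm _)).
rewrite ltrBlDl -ltrBlDr subrr => hh.
rewrite -subr_lt0.
have := hh; rewrite -(@ltr_nM2l _ h) // mulr0 mulrA divff ?lt_eqF // mul1r.
by [].
Qed.

(** At a minimum of g over [0, t1] outside 0 the derivative cannot be
    positive.  If g t1 <= 0, such a minimum exists and is nonpositive, also when
    the minimal value is attained at 0, because then t1 attains it as well. *)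
Lemma barrier_gt0 g dg T : 0 <= g 0 ->
  (forall t, 0 <= t <= T -> is_derive t 1 g (dg t)) ->
  (forall t, 0 <= t <= T -> g t <= 0 -> 0 < dg t) ->
  forall t, 0 < t <= T -> 0 < g t.
Proof.
move=> g0 hg hd t1 /andP[t10 t1T]; rewrite ltNge; apply/negP => gt1.
have cg : {within `[0, t1], continuous g}.
  apply: continuous_in_subspaceT => x; rewrite inE /= in_itv /= => /andP[x0 x1].
  by apply: is_derive_continuous (hg _ _); rewrite x0 (le_trans x1).
have [c] := EVT_min (ltW t10) cg.
rewrite in_itv /= => /andP[c0 c1] hc.
have [m m0 [m1 hm]] : exists2 m, 0 < m & m <= t1 /\ forall t, t \in `[0, t1] -> g m <= g t.
  have [c0'|c0'] := ltP 0 c; first by exists c.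
  have cE : c = 0 by apply/eqP; rewrite eq_le c0 c0'.
  exists t1 => //; split => // t /hc; apply: le_trans; rewrite cE.
  exact: le_trans gt1 g0.
have gm : g m <= 0.
  by apply: le_trans (hm t1 _) gt1; rewrite in_itv /= lexx ltW.
have mT : 0 <= m <= T by rewrite (ltW m0) (le_trans m1).
have [s /andP[s1 s2]] := derive_gt0_left (hg m mT) (hd _ mT gm) m0.
apply/negP; rewrite -leNgt; apply: hm; rewrite in_itv /=.
by apply/andP; split; lra.
Qed.

Lemma first_zero g a b : a <= b ->
  (forall t, a <= t <= b -> {for t, continuous g}) ->
  0 < g a -> g b <= 0 ->
  exists2 T, a < T <= b & g T = 0 /\ forall t, a <= t < T -> 0 < g t.
Proof.
move=> ab cg ga gb.
pose S := [set t | a <= t <= b /\ forall s, a <= s <= t -> 0 < g s].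
have Sa : S a.
  split; first by rewrite lexx.
  by move=> s; rewrite -eq_le => /eqP <-.
have bS : ubound S b by move=> t [/andP[]].
have hS : has_sup S by split; [exists a | exists b].
pose T := sup S.
have aT : a <= T by apply: ub_le_sup => //; exists b.
have Tb : T <= b by apply: ge_sup => //; exists a.
have hT t : a <= t < T -> 0 < g t.
  move=> /andP[at_ tT].
  have [e [_ he] te] := sup_gt (ex_intro _ a Sa) tT.
  by apply: he; rewrite at_ ltW.
have cT : {for T, continuous g} by apply: cg; rewrite aT.
have gT0 : 0 <= g T.
  rewrite leNgt; apply/negP => gT.
  move: cT => /cvgrPdist_lt/(_ (- g T)); rewrite oppr_gt0 => /(_ gT)[r /= r0 hr].
  have aT' : a < T by rewrite lt_neqAle aT andbT; apply/eqP => e; move: ga gT; rewrite e; lra.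
  pose s := Num.max a (T - r / 2).
  have [s1 s2 s3] : [/\ a <= s, T - r/2 <= s & s < T].
    split; rewrite /s ?le_max ?lexx ?orbT // gt_max aT' /=; lra.
  have := hr s; rewrite /ball_ /= ger0_norm ?subr_ge0 ?ltW // => /(_ _).
  have := hT s; rewrite s1 s3 => /(_ isT) gs.
  move=> h; have := h ltac:(lra); rewrite ltr0_norm; lra.
have gT1 : g T <= 0.
  rewrite leNgt; apply/negP => gT.
  have Tb' : T < b by rewrite lt_neqAle Tb andbT; apply/eqP => e; move: gb gT; rewrite e; lra.
  move: cT => /cvgrPdist_lt/(_ _ gT)[r /= r0 hr].
  pose s := Num.min b (T + r / 2).
  have [s1 s2 s3] : [/\ s <= b, s <= T + r/2 & T < s].
    split; rewrite /s ?ge_min ?lexx ?orbT // lt_min Tb' /=; lra.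
  suff : S s by move=> /(ub_le_sup (ex_intro _ b bS)); rewrite leNgt s3.
  split; first by rewrite s1 (le_trans aT) ?ltW.
  move=> u /andP[au us]; have [uT|Tu] := ltP u T; first by apply: hT; rewrite au uT.
  have := hr u; rewrite /ball_ /= distrC ger0_norm ?subr_ge0 // => /(_ _).
  move=> h; have := h ltac:(lra); rewrite ltr_norml; lra.
have gT : g T = 0 by apply/eqP; rewrite eq_le gT0 gT1.
exists T => //; rewrite Tb andbT lt_neqAle aT andbT.
by apply/eqP => e; move: ga; rewrite e gT ltxx.
Qed.

End MeanValue.


Section GeometricCauchy.
Context {R : realType}.

Lemma geom_small (C e : R) : 0 < e -> exists k, C / 2 ^+ k <= e.
Proof.
move=> e0; have [C0|C0] := leP C 0.
  by exists 0%N; rewrite expr0 divr1 (le_trans C0) ?ltW.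
exists (Num.truncn (C / e)).+1.
rewrite ler_pdivrMr ?exprn_gt0 // -ler_pdivrMl // mulrC.
have h := ltW (truncnS_gt (C / e)); apply: (le_trans h).
by rewrite -natrX ler_nat ltnW // ltn_expl.
Qed.

Lemma geom_small0 (C x : R) : (forall k, `|x| <= C / 2 ^+ k) -> x = 0.
Proof.
move=> h; apply/eqP; rewrite -normr_le0 leNgt; apply/negP => x0.
have [k hk] := geom_small C (divr_gt0 x0 (ltr0n _ 2)).
by have := h k; lra.
Qed.

(** The sequences u k -+ 2 C / 2^k are monotone and enclose the limit, which
    is obtained as a supremum. *)
Lemma geom_cauchy (u : nat -> R) (C : R) :
  (forall k, `|u k.+1 - u k| <= C / 2 ^+ k) ->
  exists l, forall k, `|l - u k| <= 2 * C / 2 ^+ k.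
Proof.
move=> hu.
pose a k := u k - 2 * C / 2 ^+ k; pose b k := u k + 2 * C / 2 ^+ k.
have p2 k : 2 * C / 2 ^+ k.+1 = C / 2 ^+ k :> R by rewrite exprS; field; rewrite expf_neq0.
have hab k : a k <= a k.+1 /\ b k.+1 <= b k.
  have := hu k; rewrite /a /b p2 ler_norml => /andP[h1 h2].
  have e : 2 * C / 2 ^+ k = C / 2 ^+ k + C / 2 ^+ k :> R by ring.
  by rewrite e; split; lra.
have ha : {homo a : i j / (i <= j)%N >-> i <= j}.
  by apply/nondecreasing_seqP => k; case: (hab k).
have hb : {homo b : i j / (i <= j)%N >-> j <= i}.
  by apply/nonincreasing_seqP => k; case: (hab k).
have C0 : 0 <= C by have := hu 0%N; rewrite expr0 divr1; apply: le_trans.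
have ab k m : a k <= b m.
  apply: le_trans (ha _ _ (leq_maxl k m)) _; apply: le_trans _ (hb _ _ (leq_maxr k m)).
  rewrite /a /b; have : 0 <= 2 * C / 2 ^+ maxn k m by rewrite divr_ge0 ?exprn_ge0 ?mulr_ge0.
  lra.
exists (sup (range a)) => k; rewrite ler_norml; apply/andP; split.
  have : a k <= sup (range a).
    by apply: ub_le_sup; [exists (b 0%N) => _ [j _ <-] | exists k].
  rewrite {1}/a; lra.
have : sup (range a) <= b k.
  by apply: ge_sup; [exists (a 0%N); exists 0%N | move=> _ [j _ <-]].
by rewrite /b; lra.
Qed.
End GeometricCauchy.

Section Picard.
Context {R : realType}.
Notation mu := (@lebesgue_measure R).
Implicit Types (t s d e c : R) (g : R -> R).

(** Integrating from -1 rather than from 0 makes the primitive two-sidedly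
    differentiable at 0, where the initial value problem starts. *)
Lemma primitive_exists (g : R -> R) : continuous g ->
  exists G : R -> R, G 0 = 0 /\ forall t : R, -1 < t -> is_derive t 1 G (g t).
Proof.
move=> cg.
pose G0 x := (\int[mu]_(t in [set` `[-1, x]]) (g t))%R.
exists (fun x => G0 x - G0 0); split; first by rewrite subrr.
move=> t t1.
have [||||d1 d2] := @continuous_FTC1_closed R g (-1) t (t + 1).
- by rewrite ltrDl.
- apply: continuous_compact_integrable; first exact: segment_compact.
  exact: continuous_subspaceT.
- by [].
- exact: cg.
have h : is_derive t 1 G0 (g t).
  by apply: DeriveDef; [exact: d1 | rewrite -derive1E; exact: d2].
have -> : g t = g t - 0 by rewrite subr0.
exact: is_deriveB.
Qed.

Variables (I : finType) (f : I -> (I -> R) -> R) (K : R).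
Hypothesis K0 : 0 < K.
Hypothesis fK : forall (u v : I -> R) d i, (forall j, `|u j - v j| <= d) -> `|f i u - f i v| <= K * d.
Variable u0 : I -> R.

Let prim (g : R -> R) : R -> R :=
  if pselect (continuous g) is left cg then sval (cid (primitive_exists cg)) else fun=> 0.
Let prim0 g : prim g 0 = 0.
Proof. by rewrite /prim; case: pselect => // cg; case: cid => G []. Qed.
Let primD (g : R -> R) (t : R) : continuous g -> -1 < t -> is_derive t 1 (prim g) (g t).
Proof.
move=> cg t1; rewrite /prim; case: pselect => [cg'|/(_ cg)[]].
by case: cid => G [G0 hG]; exact: hG.
Qed.

(* Only t >= 0 matters: functions are frozen to the left of 0 so that the
   integrands are continuous on the whole line. *)
Let cl (t : R) := Num.max t 0.
Let cl_cont : continuous cl.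
Proof.
move=> t; apply: (@continuous_max R R (fun x => x) (fun=> 0) t).
  exact: cvg_id.
exact: cst_continuous. Qed.
Let cl_ge0 t : 0 <= cl t. Proof. by rewrite /cl le_max lexx orbT. Qed.
Let cl_id t : 0 <= t -> cl t = t. Proof. by move=> t0; apply/max_idPl. Qed.
Let cl_gtN1 t : -1 < cl t. Proof. by apply: lt_le_trans (cl_ge0 t); rewrite oppr_lt0. Qed.

Let comp_cont (y : I -> R -> R) : (forall j, continuous (y j)) ->
  forall i, continuous (fun s => f i (fun j => y j s)).
Proof.
move=> cy i t; apply/cvgrPdist_le => e e0; near=> s.
apply: le_trans (fK (d := e / K) _ _) _; last by rewrite mulrC divfK ?gt_eqF.
near: s; apply: filter_forall => j.
by have /cvgrPdist_le/(_ (e / K) (divr_gt0 e0 K0)) := cy j t.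
Unshelve. all: by end_near. Qed.

Let step (y : I -> R -> R) : I -> R -> R :=
  fun i t => u0 i + prim (fun s => f i (fun j => y j (cl s))) t.

Let step0 (y : I -> R -> R) i : step y i 0 = u0 i. Proof. by rewrite /step prim0 addr0. Qed.

Let stepD (y : I -> R -> R) i (t : R) : (forall j, continuous (y j \o cl)) -> -1 < t ->
  is_derive t 1 (step y i) (f i (fun j => y j (cl t))).
Proof.
move=> cy t1; have h := @primD _ t (@comp_cont (fun j => y j \o cl) cy i) t1.
rewrite /step -[f i _]add0r; exact: is_deriveD.
Qed.

Let stepC (y : I -> R -> R) i : (forall j, continuous (y j \o cl)) -> continuous (step y i \o cl).
Proof.
move=> cy t; apply: continuous_comp; first exact: cl_cont.
exact: is_derive_continuous (stepD i cy (cl_gtN1 _)).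
Qed.

Let y k : I -> R -> R := iter k step (fun i _ => u0 i).
Let yC k j : continuous (y k j \o cl).
Proof.
elim: k j => [|k IH] j; last exact: stepC.
by move=> t; exact: cvg_cst.
Qed.

Let M := (\sum_i `|f i u0|) / (2 * K).
Let M0 : 0 <= M.
Proof. by rewrite divr_ge0 ?sumr_ge0 ?mulr_ge0 // ltW. Qed.
Let M2_ge0 k : 0 <= 2 * M / 2 ^+ k.
Proof. by apply: divr_ge0; [exact: mulr_ge0 | exact: exprn_ge0]. Qed.
Let E (t : R) := expR (2 * K * t).
Let E_gt0 t : 0 < E t. Proof. exact: expR_gt0. Qed.

Let ED (c t : R) : is_derive t 1 (fun t => c * E t) (c * (2 * K) * E t).
Proof. by rewrite /E; apply: is_derive_eq; rewrite /GRing.scale /=; ring. Qed.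

(** In the norm weighted by exp (2 K t), integration of a K-Lipschitz field
    halves distances. *)
Let step_contract (y1 y2 : I -> R -> R) c i t : 0 <= c -> 0 <= t ->
  (forall j, continuous (y1 j \o cl)) -> (forall j, continuous (y2 j \o cl)) ->
  (forall j s, 0 <= s -> `|y1 j s - y2 j s| <= c * E s) ->
  `|step y1 i t - step y2 i t| <= c / 2 * E t.
Proof.
move=> c0 t0 c1 c2 h.
have := @abs_increment _ (step y1 i \- step y2 i)
  (fun s => f i (fun j => y1 j (cl s)) - f i (fun j => y2 j (cl s)))
  (fun s => c / 2 * E s) (fun s => c / 2 * (2 * K) * E s) 0 t t0.
rewrite /= !step0 subrr subr0 => h1; apply: le_trans (h1 _ _ _) _.
- move=> s /andP[s0 _]; have s1 : -1 < s by apply: lt_le_trans s0; rewrite oppr_lt0.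
  have := stepD i c1 s1; have := stepD i c2 s1 => ? ?; exact: is_deriveB.
- by [].
- move=> s /andP[s0 _]; rewrite cl_id //.
  apply: le_trans (fK (d := c * E s) _ _) _; first by move=> j; exact: h.
  by rewrite le_eqVlt; apply/orP; left; apply/eqP; field.
- by rewrite gerBl mulr_ge0 ?divr_ge0 // ltW.
Qed.

Let yB k i t : 0 <= t -> `|y k.+1 i t - y k i t| <= M / 2 ^+ k * E t.
Proof.
elim: k i t => [|k IH] i t t0.
  rewrite expr0 divr1 /y /=.
  have := @abs_increment _ (step (fun i _ => u0 i) i) (fun=> f i u0)
    (fun s => M * E s) (fun s => M * (2 * K) * E s) 0 t t0.
  rewrite step0 => h1; apply: le_trans (h1 _ _ _) _ => //.
  - move=> s /andP[s0 _]; have s1 : -1 < s by apply: lt_le_trans s0; rewrite oppr_lt0.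
    by apply: stepD s1 => j u; exact: cvg_cst.
  - move=> s /andP[s0 _]; rewrite /M divfK ?gt_eqF ?mulr_gt0 //.
    have h : `|f i u0| <= \sum_i0 `|f i0 u0| by rewrite (bigD1 i) //= lerDl sumr_ge0.
    apply: (le_trans h); rewrite ler_peMr ?sumr_ge0 //.
    by rewrite /E -expR0 ler_expR !mulr_ge0 // ltW.
  - by rewrite gerBl mulr_ge0 // ltW.
have -> : M / 2 ^+ k.+1 = M / 2 ^+ k / 2 by rewrite exprS; field; rewrite expf_neq0.
by apply: (@step_contract (y k.+1) (y k)) => //; rewrite divr_ge0 ?exprn_ge0.
Qed.

Let Y_ex i t : exists l, 0 <= t -> forall k, `|l - y k i t| <= 2 * M * E t / 2 ^+ k.
Proof.
have [t0|t0] := leP 0 t; last first.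
  by exists 0.
have [|l hl] := @geom_cauchy _ (fun k => y k i t) (M * E t).
  by move=> k; apply: le_trans (yB k i t0) _; rewrite mulrAC.
by exists l => _ k; rewrite (le_trans (hl k)) // mulrA.
Qed.

Let Y i t := sval (cid (Y_ex i t)).
Let hY i t k : 0 <= t -> `|Y i t - y k i t| <= 2 * M / 2 ^+ k * E t.
Proof.
by move=> t0; rewrite /Y; case: cid => l /= /(_ t0 k); rewrite mulrAC.
Qed.

Let YC j : continuous (Y j \o cl).
Proof.
move=> t; apply/cvgrPdist_le => e e0.
have [k hk] := @geom_small _ (2 * M * E (cl t + 1)) _ (divr_gt0 e0 (ltr0n _ 3)).
near=> s => /=.
have Es : E (cl s) <= E (cl t + 1).
  rewrite /E ler_expR ler_pM2l ?mulr_gt0 //.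
  have : `|cl t - cl s| <= 1.
    by near: s; have /cvgrPdist_le/(_ 1 ltr01) := @cl_cont t.
  by rewrite ler_norml => /andP[]; lra.
have Et : E (cl t) <= E (cl t + 1) by rewrite /E ler_expR ler_pM2l ?mulr_gt0 // lerDl.
have h1 := hY j k (cl_ge0 t); have h2 := hY j k (cl_ge0 s).
have h3 : `|y k j (cl t) - y k j (cl s)| <= e / 3.
  by near: s; have /cvgrPdist_le/(_ (e / 3) (divr_gt0 e0 (ltr0n _ 3))) := @yC k j t.
have M2 := M2_ge0 k.
have h4 := ler_wpM2l M2 Es; have h5 := ler_wpM2l M2 Et.
have hk' : 2 * M / 2 ^+ k * E (cl t + 1) <= e / 3 by rewrite mulrAC.
move: h1 h2 h3; rewrite !ler_norml => /andP[a1 a2] /andP[a3 a4] /andP[a5 a6].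
by apply/andP; split; lra.
Unshelve. all: by end_near. Qed.

Let YE i t : 0 <= t -> step Y i t = Y i t.
Proof.
move=> t0; apply/eqP; rewrite -subr_eq0; apply/eqP.
apply: (@geom_small0 _ (3 * M * E t)) => k.
have h1 : `|step Y i t - y k.+1 i t| <= 2 * M / 2 ^+ k / 2 * E t.
  apply: (@step_contract Y (y k)) => //; by move=> j s; exact: hY.
have h2 := hY i k.+1 t0.
have e1 : 2 * M / 2 ^+ k.+1 * E t = M * E t / 2 ^+ k by rewrite exprS; field; rewrite expf_neq0.
have e2 : 2 * M / 2 ^+ k / 2 * E t = M * E t / 2 ^+ k by field; rewrite expf_neq0.
have e3 : 3 * M * E t / 2 ^+ k = 3 * (M * E t / 2 ^+ k) by ring.
have ME : 0 <= M * E t / 2 ^+ k.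
  by apply: divr_ge0; [apply: mulr_ge0 => //; exact: ltW | exact: exprn_ge0].
move: h1 h2; rewrite e1 e2 e3 !ler_norml => /andP[a1 a2] /andP[a3 a4].
by apply/andP; split; lra.
Qed.

(** Global forward existence for a globally Lipschitz field: Picard iteration
    converges geometrically in the weighted norm. *)
Theorem picard : exists z : I -> R -> R, (forall i, z i 0 = u0 i) /\
  forall i t, 0 <= t -> is_derive t 1 (z i) (f i (fun j => z j t)).
Proof.
exists (step Y); split => [i|i t t0]; first exact: step0.
have -> : (fun j => step Y j t) = (fun j => Y j (cl t)).
  by apply: funext => j; rewrite cl_id // YE.
by apply: stepD; [exact: YC | apply: lt_le_trans t0; rewrite oppr_lt0].
Qed.

End Picard.

(** * Absolutely continuous functions *)

Section IntervalChain.
Context {R : realType}.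

(** Real induction: a transitive relation that holds from every point to its
    neighbours on either side holds between the endpoints.  The supremum of the
    points reached from a is reached, by the left half of the local hypothesis,
    and is not below b, by the right half. *)
Lemma interval_chain (P : R -> R -> Prop) (a b : R) : a <= b ->
  (forall x y z, a <= x -> x <= y -> y <= z -> z <= b -> P x y -> P y z -> P x z) ->
  (forall c, a <= c <= b -> exists2 r, 0 < r &
     (forall x, a <= x -> c - r < x -> x <= c -> P x c) /\
     (forall y, y <= b -> c <= y -> y < c + r -> P c y)) ->
  P a b.
Proof.
move=> ab Ptr Ploc.
pose S := [set x | a <= x <= b /\ P a x].
have Sa : S a.
  have [|r r0 [_ h]] := Ploc a; first by rewrite lexx.
  by split; [rewrite lexx | apply: h => //; rewrite ltrDl].
have bS : ubound S b by move=> t [/andP[]].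
have hS : has_sup S by split; [exists a | exists b].
pose T := sup S.
have aT : a <= T by apply: ub_le_sup => //; exists b.
have Tb : T <= b by apply: ge_sup => //; exists a.
have [|r r0 [hl hr]] := Ploc T; first by rewrite aT.
have PT : P a T.
  have [x [/andP[ax xb] Px]] := sup_adherent r0 hS => xT.
  have xleT : x <= T by apply: ub_le_sup; [exists b | split; rewrite ?ax].
  by apply: (Ptr a x T) => //; apply: hl.
have [Tb'|Tb'] := ltP T b; last by have <- : T = b by apply/eqP; rewrite eq_le Tb.
pose y := Num.min b (T + r / 2).
have [y1 y2 y3] : [/\ y <= b, y < T + r & T < y].
  split; first by rewrite /y ge_min lexx.
    by rewrite /y gt_min; apply/orP; right; lra.
  by rewrite lt_min Tb' /=; lra.
suff : S y by move=> /(ub_le_sup (ex_intro _ b bS)); rewrite leNgt y3.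
split; first by rewrite y1 (le_trans aT) ?ltW.
by apply: (Ptr a T y) => //; [exact: ltW | apply: hr => //; exact: ltW].
Qed.

End IntervalChain.

Section AbsoluteContinuity.
Context {R : realType}.
Notation mu := (@lebesgue_measure R).
Implicit Types (a b c d e : R) (f g : R -> R) (s : seq (R * R)).

(** Finite families of non-overlapping subintervals as ordered lists, which
    unlike indexed families can be concatenated. *)
Fixpoint ordered a s b : Prop :=
  if s is p :: s' then [/\ a <= p.1, p.1 <= p.2 & ordered p.2 s' b] else a <= b.

Lemma ordered_le a s b : ordered a s b -> a <= b.
Proof.
elim: s a => [//|p s IH] a [h1 h2 /IH]; apply: le_trans; exact: le_trans h2.
Qed.

Lemma ordered_cat a s b s' c : ordered a s b -> ordered b s' c -> ordered a (s ++ s') c.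
Proof.
elim: s a => [a ab h /=|p s IH a [h1 h2 h3] h /=]; last by split => //; exact: IH.
case: s' h => [|q s'] /=; first by apply: le_trans.
by move=> [h1 h2 h3]; split => //; exact: le_trans h1.
Qed.

Lemma ordered_nth a s b x0 i : ordered a s b -> (i < size s)%N ->
  [/\ a <= (nth x0 s i).1, (nth x0 s i).1 <= (nth x0 s i).2 & (nth x0 s i).2 <= b].
Proof.
elim: s a i => [//|p s IH] a [|i] /= [h1 h2 h3] hi.
  by split => //; exact: ordered_le h3.
have [//|k1 k2 k3] := IH p.2 i h3.
by split => //; apply: le_trans k1; exact: le_trans h2.
Qed.

Lemma ordered_sep a s b x0 i j : ordered a s b -> (i < j < size s)%N ->
  (nth x0 s i).2 <= (nth x0 s j).1.
Proof.
elim: s a i j => [|p s IH] a i j; first by rewrite ltn0 andbF.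
move=> [h1 h2 h3]; case: j => [|j]; first by rewrite ltn0.
case: i => [|i] /=; last by rewrite !ltnS => hij; exact: IH h3 hij.
by rewrite ltnS => hj; have [] := ordered_nth x0 h3 hj.
Qed.

Lemma ac_ordered (V : normedModType R) (f : R -> V) a b : abs_continuous a b f ->
  forall e, 0 < e -> exists2 d, 0 < d & forall s, ordered a s b ->
    \sum_(p <- s) (p.2 - p.1) < d -> \sum_(p <- s) `|f p.2 - f p.1| < e.
Proof.
move=> acf e e0; have [d d0 hd] := acf e e0; exists d => // s os.
rewrite !(big_nth (a, a)) !big_mkord => hs.
apply: (hd _ (fun i : 'I_(size s) => (nth (a, a) s i).1) (fun i : 'I_(size s) => (nth (a, a) s i).2)) => //.
  by move=> i; exact: ordered_nth os (ltn_ord i).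
apply/trivIsetP => i j _ _ ij.
wlog lt_ij : i j ij / (i < j)%N.
  move=> h; have [lt|lt] := ltnP i j; first exact: h.
  rewrite setIC; apply: h; first by rewrite eq_sym.
  by rewrite ltn_neqAle eq_sym ij.
have h := @ordered_sep a s b (a, a) i j os.
rewrite -subset0 => x /= []; rewrite !in_itv /= => /andP[_ x1] /andP[x2 _].
have := lt_le_trans x1 (h _); rewrite lt_ij ltn_ord => /(_ isT).
by move=> /(lt_trans x2); rewrite ltxx.
Qed.

(** Lebesgue measure is additive along the list; the half-line [a, +oo[ keeps
    track of the part of U not yet used. *)
Lemma ordered_length (U : set R) a s b : measurable U -> ordered a s b ->
  (forall p, p \in s -> `]p.1, p.2[ `<=` U) ->
  ((\sum_(p <- s) (p.2 - p.1))%:E <= mu (U `&` `[a, +oo[))%E.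
Proof.
move=> mU; elim: s a => [|p s IH] a /=; first by rewrite big_nil.
move=> [h1 h2 h3] hU; rewrite big_cons EFinD.
have mI x : measurable (U `&` `[x, +oo[) by exact: measurableI.
have -> : (p.2 - p.1)%:E = mu `]p.1, p.2[.
  rewrite lebesgue_measure_itv /= lte_fin; move: h2; rewrite le_eqVlt => /orP[/eqP->|->].
    by rewrite ltxx subrr.
  by rewrite EFinB.
apply: (@le_trans _ _ (mu (`]p.1, p.2[ `|` (U `&` `[p.2, +oo[)))).
  rewrite measureU //.
    by apply: leeD2l; apply: IH h3 _ => q qs; apply: hU; rewrite inE qs orbT.
    exact: mI.
  rewrite -subset0 => x /= []; rewrite !in_itv /= => /andP[_ x1] [_]; rewrite andbT.
  by move=> /(lt_le_trans x1); rewrite ltxx.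
apply: le_measure; rewrite ?inE; [by apply: measurableU => //; exact: mI | exact: mI |].
move=> x /= []; rewrite !in_itv /= !andbT.
  move=> hx; split; first by apply: (hU p (mem_head _ _)); rewrite /= in_itv.
  by move: hx => /andP[/ltW /(le_trans h1)].
by move=> [Ux hx]; split => //; apply: le_trans hx; exact: le_trans h2.
Qed.

Lemma eps_le (x y K : R) : (forall e, 0 < e -> x - K * e <= y) -> x <= y.
Proof.
move=> h; apply/ler_addgt0Pl => e e0.
have K1 : 0 < `|K| + 1 by rewrite ltr_wpDl.
have := h (e / (`|K| + 1)) (divr_gt0 e0 K1).
have : K * (e / (`|K| + 1)) <= e.
  rewrite mulrCA ler_piMr ?(ltW e0) // ler_pdivrMr // mul1r.
  by have := ler_norm K; lra.
lra.
Qed.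

(** Outside an open set U of small measure the derivative gives the increment
    near each point, on both sides.  Inside U nothing is known, but the total
    variation over non-overlapping intervals in U is small by absolute
    continuity.  Real induction chains the two kinds of intervals; the family
    met in U is carried along. *)
Lemma ac_increment_ge f a b c : a <= b -> abs_continuous a b f ->
  {ae mu, forall t, a <= t <= b -> exists2 d, is_derive t 1 f d & c <= d} ->
  c * (b - a) <= f b - f a.
Proof.
move=> ab acf [A [mA A0 hA]].
apply: (@eps_le _ _ ((b - a) + 2)) => e e0.
have [d d0 hd] := ac_ordered acf e0.
pose d' := Num.min d (e / (`|c| + 1)).
have c1 : 0 < `|c| + 1 by rewrite ltr_wpDl.
have d'0 : 0 < d' by rewrite lt_min d0 divr_gt0.
have A_fin : (mu A < +oo)%E by rewrite A0 ltry.
have [U [oU AU UA]] := lebesgue_regularity_outer mA A_fin d'0.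
have mU : measurable U by exact: measurable_realfun.open_measurable.
have Ud : (mu U < d'%:E)%E.
  by rewrite (measureDI mu mU mA) (setIidr AU) [X in (_ + X)%E]A0 adde0.
pose P x y := exists s, [/\ ordered x s y, (forall p, p \in s -> `]p.1, p.2[ `<=` U) &
   (c - e) * (y - x) - \sum_(p <- s) (`|f p.2 - f p.1| + `|c| * (p.2 - p.1)) <= f y - f x].
have [s [os sU hs]] : P a b.
  apply: interval_chain => //.
    move=> x y z ax xy yz zb [s [s1 s2 s3]] [s' [s1' s2' s3']].
    exists (s ++ s'); split; first exact: ordered_cat s1'.
      by move=> p; rewrite mem_cat => /orP[/s2|/s2'].
    rewrite big_cat /=.
    have -> : f z - f x = (f z - f y) + (f y - f x) by ring.
    apply: le_trans (lerD s3' s3); rewrite le_eqVlt; apply/orP; left; apply/eqP; ring.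
  move=> t tab; have [Ut|Ut] := pselect (U t).
    have [r /= r0 hr] := (open_nbhs_nbhs (conj oU Ut)).
    have hc x y : x <= y -> (c - e) * (y - x) <= `|c| * (y - x).
      by move=> xy; rewrite ler_wpM2r ?subr_ge0 //; have := ler_norm c; lra.
    exists r => //; split => [x ax tx xt|y yb ty yt].
      exists [:: (x, t)]; split => //= [p|].
        rewrite inE => /eqP -> z /=; rewrite in_itv /= => /andP[z1 z2].
        by apply: hr; rewrite /ball_ /= ger0_norm; lra.
      rewrite big_seq1 /=; have := hc _ _ xt; have := ler_norm (f x - f t).
      rewrite distrC; lra.
    exists [:: (t, y)]; split => //= [p|].
      rewrite inE => /eqP -> z /=; rewrite in_itv /= => /andP[z1 z2].
      by apply: hr; rewrite /ball_ /= ler0_norm; lra.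
    rewrite big_seq1 /=; have := hc _ _ ty; have := ler_norm (f t - f y).
    rewrite distrC; lra.
  have [D [df De] cD] : exists2 d, is_derive t 1 f d & c <= d.
    apply: contrapT => h; apply: Ut; apply: AU; apply: hA => /= /(_ tab); exact: h.
  have : h^-1 *: (f (h *: 1 + t) - f t) @[h --> 0^'] --> D.
    by rewrite -De; exact: df.
  move=> /cvgrPdist_lt/(_ _ e0)[r /= r0 hr].
  have key h : h != 0 -> `|h| < r -> `|D - h^-1 * (f (h + t) - f t)| < e.
    move=> h0 hr'; have := hr h; rewrite /ball_ /= sub0r normrN => /(_ hr' h0).
    by rewrite /GRing.scale /= mulr1.
  exists r => //; split => [x ax tx xt|y yb ty yt]; exists [::]; split => //; rewrite big_nil subr0.
    have [->|xt'] := eqVneq x t; first by rewrite !subrr mulr0.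
    have h0 : x - t < 0 by rewrite subr_lt0 lt_neqAle xt'.
    have := key (x - t); rewrite lt_eqF // ltr0_norm // subrK => /(_ isT) /(_ ltac:(lra)).
    rewrite ltr_norml => /andP[h1 h2].
    have : c - e < (x - t)^-1 * (f x - f t) by lra.
    rewrite -(ltr_nM2r h0) mulrAC mulVf ?lt_eqF // mul1r; lra.
  have [->|xt'] := eqVneq y t; first by rewrite !subrr mulr0.
  have h0 : 0 < y - t by rewrite subr_gt0 lt_neqAle eq_sym xt'.
  have := key (y - t); rewrite gt_eqF // gtr0_norm // subrK => /(_ isT) /(_ ltac:(lra)).
  rewrite ltr_norml => /andP[h1 h2].
  have : c - e < (y - t)^-1 * (f y - f t) by lra.
  rewrite -(ltr_pM2r h0) mulrAC mulVf ?gt_eqF // mul1r; lra.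
have ls : \sum_(p <- s) (p.2 - p.1) < d'.
  rewrite -lte_fin; apply: le_lt_trans Ud; apply: le_trans (ordered_length mU os sU) _.
  apply: le_measure; rewrite ?inE //; exact: measurableI.
have := hd s os (lt_le_trans ls _); rewrite ge_min lexx => /(_ isT) h1.
have h2 : `|c| * \sum_(p <- s) (p.2 - p.1) <= e.
  apply: (@le_trans _ _ (`|c| * d')); first by rewrite ler_wpM2l // ltW.
  apply: (@le_trans _ _ (`|c| * (e / (`|c| + 1)))).
    by rewrite ler_wpM2l // ge_min lexx orbT.
  rewrite mulrCA ler_piMr ?(ltW e0) // ler_pdivrMr // mul1r; lra.
move: hs; rewrite big_split /= -mulr_sumr; lra.
Qed.

Lemma ac_sub (V : normedModType R) (f : R -> V) a b a' b' :
  a <= a' -> b' <= b -> abs_continuous a b f -> abs_continuous a' b' f.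
Proof.
move=> aa bb acf e e0; have [d d0 hd] := acf e e0; exists d => // n u v huv.
apply: hd => i; have [h1 h2 h3] := huv i.
by split => //; [exact: le_trans h1 | exact: le_trans bb].
Qed.

Lemma lip_ac (V : normedModType R) (f : R -> V) a b (K : R) :
  (forall s t : R, a <= s -> s <= t -> t <= b -> `|f t - f s| <= K * (t - s)) ->
  abs_continuous a b f.
Proof.
move=> hf e e0; have K1 : 0 < `|K| + 1 by rewrite ltr_wpDl.
exists (e / (`|K| + 1)); first exact: divr_gt0.
move=> n u v huv _ hs.
apply: (@le_lt_trans _ _ (\sum_(i < n) (`|K| + 1) * (v i - u i))).
  apply: ler_sum => i _; have [h1 h2 h3] := huv i.
  apply: le_trans (hf _ _ h1 h2 h3) _.
  by rewrite ler_wpM2r ?subr_ge0 //; have := ler_norm K; lra.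
by rewrite -mulr_sumr mulrC -ltr_pdivlMr.
Qed.

Lemma ac_continuous (V : normedModType R) (f : R -> V) a b : abs_continuous a b f ->
  forall e, 0 < e -> exists2 d, 0 < d & forall s t : R, a <= s <= b -> a <= t <= b ->
    `|s - t| < d -> `|f s - f t| < e.
Proof.
move=> acf e e0; have [d d0 hd] := ac_ordered acf e0; exists d => // s t.
wlog st : s t / s <= t.
  move=> h hs ht; have [st|st] := leP s t; first exact: h.
  by rewrite distrC [X in _ -> X < _]distrC; apply: h => //; exact: ltW.
move=> /andP[as_ sb] /andP[at_ tb] h.
have := hd [:: (s, t)]; rewrite !big_seq1 /= [X in _ -> _ -> X < _]distrC; apply => //.
by move: h; rewrite distrC ger0_norm // subr_ge0.
Qed.

Lemma ac_bounded (V : normedModType R) (f : R -> V) a b : a <= b -> abs_continuous a b f ->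
  exists B, forall t, a <= t <= b -> `|f t| <= B.
Proof.
move=> ab /ac_continuous/(_ 1 ltr01)[d d0 hd].
apply: (interval_chain (P := fun x y => exists B, forall t, x <= t <= y -> `|f t| <= B)) => //.
  move=> x y z ax xy yz zb [B1 h1] [B2 h2]; exists (Num.max B1 B2) => t /andP[xt tz].
  by rewrite le_max; have [ty|yt] := leP t y; [rewrite h1 ?xt | rewrite h2 ?orbT // (ltW yt)].
move=> c cab; exists d => //.
have key t : a <= t <= b -> `|t - c| < d -> `|f t| <= `|f c| + 1.
  move=> tab tc; have := hd t c tab cab tc => h.
  by have := ler_normD (f t - f c) (f c); rewrite subrK; lra.
move: cab => /andP[ac cb].
split => [x ax cx xc|y yb cy yc]; exists (`|f c| + 1) => t /andP[t1 t2]; apply: key.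
- by rewrite (le_trans ax) ?(le_trans t2).
- by rewrite ler0_norm ?subr_le0 //; lra.
- by rewrite (le_trans ac) ?(le_trans t2).
- by rewrite ger0_norm ?subr_ge0 //; lra.
Qed.

Lemma ac_add f g a b : abs_continuous a b f -> abs_continuous a b g ->
  abs_continuous a b (fun t => f t + g t).
Proof.
move=> acf acg e e0.
have [d1 d10 h1] := acf _ (divr_gt0 e0 (ltr0n _ 2)).
have [d2 d20 h2] := acg _ (divr_gt0 e0 (ltr0n _ 2)).
exists (Num.min d1 d2); first by rewrite lt_min d10.
move=> n u v huv tr; rewrite lt_min => /andP[k1 k2].
have := h1 n u v huv tr k1; have := h2 n u v huv tr k2.
have : \sum_(i < n) `|f (v i) + g (v i) - (f (u i) + g (u i))| <=
    \sum_(i < n) `|f (v i) - f (u i)| + \sum_(i < n) `|g (v i) - g (u i)|.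
  rewrite -big_split /=; apply: ler_sum => i _.
  by rewrite opprD addrACA; exact: ler_normD.
lra.
Qed.

Lemma ac_opp (f : R -> R) a b : abs_continuous a b f -> abs_continuous a b (fun t => - f t).
Proof.
move=> acf e e_gt0; have [d d0 hd] := acf e e_gt0; exists d => // k u v huv tr hs.
apply: le_lt_trans (hd k u v huv tr hs); apply: ler_sum => i _.
by rewrite -opprD normrN.
Qed.

Lemma ac_mul f g a b : a <= b -> abs_continuous a b f -> abs_continuous a b g ->
  abs_continuous a b (fun t => f t * g t).
Proof.
move=> ab acf acg e e0.
have [Bf hBf] := ac_bounded ab acf; have [Bg hBg] := ac_bounded ab acg.
pose B := `|Bf| + `|Bg| + 1.
have B0 : 0 < B by rewrite ltr_wpDl ?addr_ge0.
have e'0 : 0 < e / 2 / B by rewrite !divr_gt0.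
have [d1 d10 h1] := acf _ e'0.
have [d2 d20 h2] := acg _ e'0.
exists (Num.min d1 d2); first by rewrite lt_min d10.
move=> n u v huv tr; rewrite lt_min => /andP[k1 k2].
have := h1 n u v huv tr k1; have := h2 n u v huv tr k2.
rewrite !ltr_pdivlMr // !(mulrC _ B) !mulr_sumr.
have : \sum_(i < n) `|f (v i) * g (v i) - (f (u i) * g (u i))| <=
    \sum_(i < n) B * `|f (v i) - f (u i)| + \sum_(i < n) B * `|g (v i) - g (u i)|.
  rewrite -big_split /=; apply: ler_sum => i _; have [a1 a2 a3] := huv i.
  have -> : f (v i) * g (v i) - f (u i) * g (u i) =
    g (v i) * (f (v i) - f (u i)) + f (u i) * (g (v i) - g (u i)) by ring.
  apply: le_trans (ler_normD _ _) _; rewrite !normrM; apply: lerD.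
    apply: ler_wpM2r => //; apply: le_trans (hBg _ _) _; first by rewrite (le_trans a1).
    by rewrite /B; have := ler_norm Bg; have := normr_ge0 Bf; lra.
  apply: ler_wpM2r => //; apply: le_trans (hBf _ _) _; first by rewrite a1 (le_trans a2).
  by rewrite /B; have := ler_norm Bf; have := normr_ge0 Bg; lra.
lra.
Qed.

(** An interval may straddle c.  Replacing its endpoints by their minimum and
    maximum with c splits every interval without a case distinction, since
    f t = f (min t c) + f (max t c) - f c. *)
Lemma ac_concat (V : normedModType R) (f : R -> V) a b c : a <= c -> c <= b ->
  abs_continuous a c f -> abs_continuous c b f -> abs_continuous a b f.
Proof.
move=> ac cb ac1 ac2 e e0.
have [d1 d10 h1] := ac1 _ (divr_gt0 e0 (ltr0n _ 2)).
have [d2 d20 h2] := ac2 _ (divr_gt0 e0 (ltr0n _ 2)).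
exists (Num.min d1 d2); first by rewrite lt_min d10.
move=> n u v huv tr; rewrite lt_min => /andP[k1 k2].
have sub (u' v' : 'I_n -> R) : (forall i, `]u' i, v' i[ `<=` `]u i, v i[) ->
    trivIset setT (fun i => `]u' i, v' i[%classic).
  move=> h; move/trivIsetP : tr => tr; apply/trivIsetP => i j _ _ ij.
  rewrite -subset0 => x [/h x1 /h x2].
  by rewrite -[set0](tr i j I I ij).
have len1 i : Num.min (v i) c - Num.min (u i) c <= v i - u i.
  by have [_ ? _] := huv i; rewrite /Num.min; case: ifP; case: ifP; lra.
have len2 i : Num.max (v i) c - Num.max (u i) c <= v i - u i.
  by have [_ ? _] := huv i; rewrite /Num.max; case: ifP; case: ifP; lra.
have := h1 n (fun i => Num.min (u i) c) (fun i => Num.min (v i) c).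
have := h2 n (fun i => Num.max (u i) c) (fun i => Num.max (v i) c).
move=> A1 A2.
have : \sum_(i < n) `|f (Num.max (v i) c) - f (Num.max (u i) c)| < e / 2.
  apply: A1 => [i||].
  - have [? ? ?] := huv i; split; first by rewrite le_max lexx orbT.
      by rewrite ge_max !le_max lexx orbT andbT; apply/orP; left.
    by rewrite ge_max cb andbT.
  - apply: sub => i x /=; rewrite !in_itv /= gt_max => /andP[/andP[x1 x2]].
    by rewrite lt_max x1 /= => /orP[//|/(lt_trans x2)]; rewrite ltxx.
  - by apply: le_lt_trans k2; apply: ler_sum => i _.
have : \sum_(i < n) `|f (Num.min (v i) c) - f (Num.min (u i) c)| < e / 2.
  apply: A2 => [i||].
  - have [? ? ?] := huv i; split; first by rewrite le_min ac andbT.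
      by rewrite le_min !ge_min lexx orbT andbT; apply/orP; left.
    by rewrite ge_min lexx orbT.
  - apply: sub => i x /=; rewrite !in_itv /= lt_min => /andP[+ /andP[x1 x2]].
    by rewrite gt_min x1 andbT => /orP[//|/(lt_trans x2)]; rewrite ltxx.
  - by apply: le_lt_trans k1; apply: ler_sum => i _.
have : \sum_(i < n) `|f (v i) - f (u i)| <=
   \sum_(i < n) `|f (Num.min (v i) c) - f (Num.min (u i) c)| +
   \sum_(i < n) `|f (Num.max (v i) c) - f (Num.max (u i) c)|.
  rewrite -big_split /=; apply: ler_sum => i _.
  have E t : f t = f (Num.min t c) + f (Num.max t c) - f c.
    by rewrite /Num.min /Num.max; case: ifP => _; rewrite ?addrK // [f c + _]addrC addrK.
  rewrite {1}(E (v i)) {1}(E (u i)).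
  have -> : forall x y z x' y' : V, x + y - z - (x' + y' - z) = (x - x') + (y - y').
    by move=> x y z x' y'; rewrite opprB addrA subrK opprD addrACA.
  exact: ler_normD.
lra.
Qed.

Lemma ac_coord (x : R -> 'rV[R]_3) i a b : abs_continuous a b x ->
  abs_continuous a b (fun t => x t ord0 i).
Proof.
move=> acx e e0; have [d d0 hd] := acx e e0; exists d => // n u v huv tr hs.
apply: le_lt_trans (hd n u v huv tr hs); apply: ler_sum => j _.
rewrite [leRHS]/Num.Def.normr/= mx_normrE.
by apply: le_trans; last exact: (le_bigmax _ _ (ord0, i)); rewrite !mxE.
Qed.

Lemma ae_mono (P Q : R -> Prop) : (forall t, P t -> Q t) ->
  {ae mu, forall t, P t} -> {ae mu, forall t, Q t}.
Proof.
move=> PQ [A [mA A0 hA]]; exists A; split => // t nQ; apply: hA => Pt.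
by apply: nQ; exact: PQ.
Qed.

Lemma ae_and (P Q : R -> Prop) :
  {ae mu, forall t, P t} -> {ae mu, forall t, Q t} -> {ae mu, forall t, P t /\ Q t}.
Proof.
move=> hP hQ; have := negligibleU hP hQ; apply: negligibleS => t /=.
by move=> nPQ; apply: contrapT => /not_orP[/contrapT Pt /contrapT Qt]; apply: nPQ.
Qed.

Lemma ae_neq (a : R) : {ae mu, forall t, t <> a}.
Proof.
exists [set a]; split => //; first exact: lebesgue_measure_set1.
by move=> t /contrapT.
Qed.

(** Same integrating factor as in [gronwall_lb]. *)
Lemma ac_gronwall f a b (M : R) : a <= b -> abs_continuous a b f ->
  {ae mu, forall t, a <= t <= b -> exists2 d, is_derive t 1 f d & - M * f t <= d} ->
  0 <= f a -> 0 <= f b.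
Proof.
move=> ab acf ae fa.
have acE : abs_continuous a b (fun t => expR (M * t)).
  apply: (@lip_ac _ _ _ _ (`|M| * expR (`|M| * (`|a| + `|b|)))) => s t as_ st tb.
  apply: (@lip_increment R (fun t => expR (M * t)) (fun t => M * expR (M * t)) s t) => // r /andP[sr rt].
    by apply: is_derive_eq; rewrite /GRing.scale /=; ring.
  rewrite normrM ler_wpM2l // ger0_norm ?expR_ge0 // ler_expR.
  apply: le_trans (ler_norm _) _; rewrite normrM ler_wpM2l // ler_norml.
  have := ler_norm a; have := ler_norm (- a); have := ler_norm b; have := ler_norm (- b).
  by rewrite !normrN => ? ? ? ?; apply/andP; split; lra.
have := @ac_increment_ge _ a b 0 ab (ac_mul ab acE acf); rewrite mul0r subr_ge0 => h.
have : expR (M * a) * f a <= expR (M * b) * f b.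
  apply: h; apply: ae_mono ae => t ht /ht[d fd Md].
  exists (expR (M * t) * (M * f t + d)).
    apply: is_derive_eq; rewrite /GRing.scale /=; ring.
  by rewrite mulr_ge0 ?expR_ge0 //; lra.
have := mulr_ge0 (expR_ge0 (M * a)) fa => h0 /(le_trans h0).
by rewrite pmulr_rge0 ?expR_gt0.
Qed.

End AbsoluteContinuity.

(** * The numerical vector field *)

Section Numerics.
Context {R : realType}.
Implicit Types (w n x u v f g t : R) (s : bool).

Definition Fnum n : R := 10 / 19 * (343 * (53 / 100) - 202
  + 4116 / 65 * (n - 1 / 2 - 241 / 1000 * (n ^+ 3 - n))).
Definition Tc_of s : R := if s then - 10 else - (55 / 10).
Definition Gnum s n : R := 1715 / 247 * (482 / 100) * (53 / 100) * ((3 * n ^+ 2 - 1) / 2) + Tc_of s.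
Definition beta s : R := if s then 5 else 15 / 10.
(** The sign of mode s: the region of mode s is where
    sgm s * (gamma eta - xi) is positive. *)
Definition sgm s : R := if s then 1 else - 1.
(** The slow velocity divided by eps. *)
Definition xidot s n x : R := beta s * (n - x) - 105 / 100 * (1 - n).

Definition in_box w n := [/\ - (12 / 10) <= w, w <= 58 / 10, 7 / 10 <= n & n <= 97 / 100].
(** The weight 250 makes the symmetric part of the linearized fast system
    negative definite for all slopes of F and G that occur in the box. *)
Definition nrm2 u v : R := u ^+ 2 + 250 * v ^+ 2.

Lemma FE eps n : F (param_values eps) n = Fnum n.
Proof.
rewrite /F /Fnum /alpha0 /L /P2 /=; field; rewrite -?mulrnDr; do ?[apply/andP; split];
  by rewrite ?pnatr_eq0 // gt_eqF //; lra.
Qed.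

Lemma GE eps s n : G (param_values eps) (Tc_of s) n = Gnum s n.
Proof.
rewrite /G /Gnum /alpha0 /L /p2 /=; field; rewrite -?mulrnDr; do ?[apply/andP; split];
  by rewrite ?pnatr_eq0 // gt_eqF //; lra.
Qed.

Lemma sgmN s : sgm (~~ s) = - sgm s. Proof. by case: s; rewrite /sgm /=; lra. Qed.

Definition Fslope n1 n2 : R :=
  10 / 19 * (4116 / 65) * (1 - 241 / 1000 * (n1 ^+ 2 + n1 * n2 + n2 ^+ 2 - 1)).
Definition Gslope n1 n2 : R := 1715 / 247 * (482 / 100) * (53 / 100) * (3 / 2) * (n1 + n2).

Lemma Fnum_sub n1 n2 : Fnum n1 - Fnum n2 = Fslope n1 n2 * (n1 - n2).
Proof. by rewrite /Fnum /Fslope; ring. Qed.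
Lemma Gnum_sub s n1 n2 : Gnum s n1 - Gnum s n2 = Gslope n1 n2 * (n1 - n2).
Proof. by rewrite /Gnum /Gslope; ring. Qed.

(** The bounds 29.6 for F and 37.2 for G, found at eta = 7/10, are separated:
    this is what makes the fast system contracting. *)
Lemma Fslope_bound n1 n2 : 7 / 10 <= n1 -> n1 <= 97 / 100 -> 7 / 10 <= n2 -> n2 <= 97 / 100 ->
  186 / 10 <= Fslope n1 n2 /\ Fslope n1 n2 <= 296 / 10.
Proof.
move=> a1 a2 b1 b2; rewrite /Fslope.
have h1 : (7/10)^+2 * 3 <= n1 ^+ 2 + n1 * n2 + n2 ^+ 2 by nra.
have h2 : n1 ^+ 2 + n1 * n2 + n2 ^+ 2 <= (97/100)^+2 * 3 by nra.
by split; lra.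
Qed.

Lemma Gslope_bound n1 n2 : 7 / 10 <= n1 -> n1 <= 97 / 100 -> 7 / 10 <= n2 -> n2 <= 97 / 100 ->
  372 / 10 <= Gslope n1 n2 /\ Gslope n1 n2 <= 517 / 10.
Proof. by move=> a1 a2 b1 b2; rewrite /Gslope; split; lra. Qed.

(** With f <= 29.6 and g >= 37.2 the discriminant (2 f + 50)^2 of the
    quadratic form is below 4 * (9/5) * (50 g - 50). *)
Lemma dissipative f g u v : 186 / 10 <= f -> f <= 296 / 10 -> 372 / 10 <= g ->
  2 * u * (f * v - u) + 500 * v * (1 / 10 * (u - g * v)) <= - (1 / 5) * nrm2 u v.
Proof.
move=> f1 f2 g1; rewrite /nrm2.
have h : (2 * f + 50) ^+ 2 <= (120 * 100) by nra.
have h2 : 0 <= (18/5 * u - (2 * f + 50) * v) ^+ 2 by exact: sqr_ge0.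
have h3 : (2 * f + 50) ^+ 2 * v ^+ 2 <= (120 * 100) * v ^+ 2 by rewrite ler_wpM2r ?sqr_ge0.
have h4 : 372 / 10 * v ^+ 2 <= g * v ^+ 2 by rewrite ler_wpM2r ?sqr_ge0.
have h5 := sqr_ge0 v.
nra.
Qed.

Definition eta_lo s : R := if s then 945 / 1000 else 72 / 100.
Definition eta_hi s : R := if s then 95 / 100 else 73 / 100.

Lemma equilibrium_exists s : exists n, (eta_lo s <= n <= eta_hi s) /\ Fnum n = Gnum s n.
Proof.
have hl : eta_lo s <= eta_hi s by case: s; rewrite /eta_lo /eta_hi; lra.
have cf : continuous (fun n => Fnum n - Gnum s n).
  move=> n; apply: is_derive_continuous; rewrite /Fnum /Gnum; exact: is_deriveE.
have [||n] := @IVT _ (fun n => Fnum n - Gnum s n) (eta_lo s) (eta_hi s) 0 hl.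
- exact: continuous_subspaceT.
- rewrite ge_min le_max; apply/andP; split; apply/orP; [right|left];
    case: s {hl cf}; rewrite /Fnum /Gnum /Tc_of /eta_lo /eta_hi; lra.
- by rewrite in_itv /= => hn /eqP; rewrite subr_eq0 => /eqP; exists n.
Qed.

Definition eta_eq s : R := sval (cid (equilibrium_exists s)).
Definition w_eq s : R := Fnum (eta_eq s).
Lemma eta_eq_range s : eta_lo s <= eta_eq s <= eta_hi s.
Proof. by rewrite /eta_eq; case: cid => n []. Qed.
Lemma w_eq_G s : w_eq s = Gnum s (eta_eq s).
Proof. by rewrite /w_eq /eta_eq; case: cid => n []. Qed.

Lemma eta_eq_box s : 71 / 100 <= eta_eq s /\ eta_eq s <= 96 / 100.
Proof. by have := eta_eq_range s; rewrite /eta_lo /eta_hi; case: s => /andP[]; lra. Qed.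

Lemma Fnum_lo : - (12 / 10) <= Fnum (7 / 10). Proof. by rewrite /Fnum; lra. Qed.
Lemma Fnum_hi : Fnum (97 / 100) <= 58 / 10. Proof. by rewrite /Fnum; lra. Qed.
Lemma Gnum_lo s : Gnum s (7 / 10) <= - (12 / 10). Proof. by rewrite /Gnum /Tc_of; case: s; lra. Qed.
Lemma Gnum_hi s : 58 / 10 <= Gnum s (97 / 100). Proof. by rewrite /Gnum /Tc_of; case: s; lra. Qed.

(** F maps the eta-range of the box into its w-range, and G satisfies the
    opposite inequalities at the ends: the vector field of each mode points into
    the box.  Slope 52 exceeds all slopes of G in the box. *)
Lemma Fnum_box n : 7 / 10 <= n -> n <= 97 / 100 -> - (12 / 10) <= Fnum n /\ Fnum n <= 58 / 10.
Proof.
move=> n1 n2; have [||||f1 _] := @Fslope_bound n (7 / 10); try lra.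
have [||||f2 _] := @Fslope_bound (97 / 100) n; try lra.
have p1 : 0 <= Fslope n (7 / 10) * (n - 7 / 10) by apply: mulr_ge0; lra.
have p2 : 0 <= Fslope (97 / 100) n * (97 / 100 - n) by apply: mulr_ge0; lra.
have := Fnum_sub n (7 / 10); have := Fnum_sub (97 / 100) n.
by have := Fnum_lo; have := Fnum_hi; split; lra.
Qed.

Lemma Gnum_box s n : 7 / 10 <= n -> n <= 97 / 100 ->
  Gnum s n - 52 * (n - 7 / 10) <= - (12 / 10) /\ 58 / 10 <= Gnum s n + 52 * (97 / 100 - n).
Proof.
move=> n1 n2; have [||||_ g1] := @Gslope_bound n (7 / 10); try lra.
have [||||_ g2] := @Gslope_bound (97 / 100) n; try lra.
have p1 : Gslope n (7 / 10) * (n - 7 / 10) <= 52 * (n - 7 / 10) by apply: ler_wpM2r; lra.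
have p2 : Gslope (97 / 100) n * (97 / 100 - n) <= 52 * (97 / 100 - n) by apply: ler_wpM2r; lra.
have := Gnum_sub s n (7 / 10); have := Gnum_sub s (97 / 100) n.
by have := Gnum_lo s; have := Gnum_hi s; split; lra.
Qed.

Lemma eq_in_box s : in_box (w_eq s) (eta_eq s).
Proof.
have [h1 h2] := eta_eq_box s; have n1 : 7 / 10 <= eta_eq s by lra.
have n2 : eta_eq s <= 97 / 100 by lra.
by have [] := Fnum_box n1 n2; split.
Qed.

Lemma w_eq_range s : - 1 <= w_eq s /\ w_eq s <= 56 / 10.
Proof.
have [h1 h2] := eta_eq_box s.
have h3 : 0 <= Fslope (eta_eq s) (71/100) * (eta_eq s - 71/100).
  have [||||h _] := @Fslope_bound (eta_eq s) (71/100); try lra.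
  by apply: mulr_ge0; lra.
have h4 : 0 <= Fslope (96/100) (eta_eq s) * (96/100 - eta_eq s).
  have [||||h _] := @Fslope_bound (96/100) (eta_eq s); try lra.
  by apply: mulr_ge0; lra.
have := Fnum_sub (eta_eq s) (71/100); have := Fnum_sub (96/100) (eta_eq s).
have : - 1 <= Fnum (71/100) by rewrite /Fnum; lra.
have : Fnum (96/100) <= 56/10 by rewrite /Fnum; lra.
by rewrite /w_eq; split; lra.
Qed.

(** Near the equilibrium of the other mode the two values of G differ by the
    gap 4.5 between the temperatures, which w cannot make up for in the box. *)
Lemma eta_drift s w n : in_box w n -> sgm s * (n - eta_eq (~~ s)) <= 3 / 100 ->
  2 <= sgm s * (w - Gnum s n).
Proof.
move=> [w1 w2 n1 n2]; have := eta_eq_range (~~ s); case: s => /=; rewrite /eta_lo /eta_hi /sgm => /andP[e1 e2] h.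
  have : Gnum true n <= Gnum true (76/100) by rewrite /Gnum; nra.
  rewrite {2}/Gnum /Tc_of; lra.
have : Gnum false (915/1000) <= Gnum false n by rewrite /Gnum; nra.
rewrite {1}/Gnum /Tc_of; lra.
Qed.

Lemma xidot_bound s n x : 7 / 10 <= n -> n <= 97 / 100 -> 0 <= x -> x <= 1 ->
  `|xidot s n x| <= 6.
Proof.
move=> n1 n2 x1 x2; rewrite /xidot /beta ler_norml; case: s; apply/andP; split; lra.
Qed.

(** In the region of mode s the slow velocity points back to Sigma: on Sigma
    it equals (beta s / b - 1) a (1 - eta), where b1 > b > b0 and eta stays
    below 97/100, and depth only adds to it. *)
Lemma xidot_drift s n x : n <= 97 / 100 -> 0 <= sgm s * (16 / 10 * n - 6 / 10 - x) ->
  9 / (20 * 100) <= sgm s * xidot s n x.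
Proof.
by move=> n2; rewrite /xidot /beta /sgm; case: s; lra.
Qed.

Lemma xidot_sub s n n' x x' : xidot s n x - xidot s n' x' =
  beta s * ((n - n') - (x - x')) + 105 / 100 * (n - n').
Proof. by rewrite /xidot; ring. Qed.

Lemma beta_cases s : beta s = 5 :> R \/ beta s = 15 / 10 :> R.
Proof. by case: s; [left | right]. Qed.

Lemma nrm2_ge0 u v : 0 <= nrm2 u v. Proof. by rewrite /nrm2; nra. Qed.

Lemma nrm2_bound u v (d : R) : 0 <= d -> nrm2 u v <= d ^+ 2 -> `|u| <= d /\ `|v| <= d / 15.
Proof.
move=> d0; rewrite /nrm2 => h.
have h1 : u ^+ 2 <= d ^+ 2 by nra.
have h2 : v ^+ 2 <= (d / 15) ^+ 2 by nra.
by split; rewrite -(@ler_pXn2r _ 2) ?nnegrE ?divr_ge0 ?real_normK ?num_real.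
Qed.

End Numerics.

(** * Trajectories of a single mode *)

Section Trajectories.
Context {R : realType}.
Implicit Types (t d e T : R) (s : bool) (w n x : R -> R).

(** Classical solutions of mode s inside the box, first without xi, whose
    equation is driven by the fast variables but does not act on them. *)
Definition fast_traj s w n : Prop := forall t, 0 <= t ->
  [/\ is_derive t 1 w (Fnum (n t) - w t),
      is_derive t 1 n (1 / 10 * (w t - Gnum s (n t))) &
      in_box (w t) (n t)].

Definition traj (eps : R) s w n x : Prop := fast_traj s w n /\ forall t, 0 <= t ->
  is_derive t 1 x (eps * xidot s (n t) (x t)) /\ 0 <= x t <= 1.

Lemma fast_traj_const s : fast_traj s (fun=> w_eq s) (fun=> eta_eq s).
Proof.
move=> t _; split; last exact: eq_in_box.
  by apply: is_derive_eq; rewrite /= /w_eq subrr.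
by apply: is_derive_eq; rewrite /= -w_eq_G subrr mulr0.
Qed.

(** The fast equations of both solutions carry the same constant, so it
    cancels, and [dissipative] applies to the difference. *)
Lemma fast_traj_contract s w1 n1 w2 n2 t0 t : fast_traj s w1 n1 -> fast_traj s w2 n2 ->
  0 <= t0 -> t0 <= t ->
  nrm2 (w1 t - w2 t) (n1 t - n2 t) <=
  expR (- (1 / 5) * (t - t0)) * nrm2 (w1 t0 - w2 t0) (n1 t0 - n2 t0).
Proof.
move=> h1 h2 t00 t0t.
pose f t := - nrm2 (w1 t - w2 t) (n1 t - n2 t).
pose df t := - (2 * (w1 t - w2 t) * (Fnum (n1 t) - w1 t - (Fnum (n2 t) - w2 t)) +
   500 * (n1 t - n2 t) * (1 / 10 * (w1 t - Gnum s (n1 t)) - 1 / 10 * (w2 t - Gnum s (n2 t)))).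
suff : expR (- (1 / 5) * (t - t0)) * f t0 <= f t by rewrite /f mulrN lerN2.
apply: (gronwall_lb t0t (df := df)) => r /andP[tr rt].
  have [a1 a2 _] := h1 r (le_trans t00 tr); have [b1 b2 _] := h2 r (le_trans t00 tr).
  rewrite /f /df /nrm2; apply: is_derive_eq; rewrite /GRing.scale /=; ring.
have [_ _ [_ _ p1 p2]] := h1 r (le_trans t00 tr).
have [_ _ [_ _ q1 q2]] := h2 r (le_trans t00 tr).
have [f1 f2] := Fslope_bound p1 p2 q1 q2; have [g1 _] := Gslope_bound p1 p2 q1 q2.
have := dissipative (w1 r - w2 r) (n1 r - n2 r) f1 f2 g1.
have := Fnum_sub (n1 r) (n2 r); have := Gnum_sub s (n1 r) (n2 r).
rewrite /f /df => eG eF.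
have -> : Fnum (n1 r) - w1 r - (Fnum (n2 r) - w2 r) = Fslope (n1 r) (n2 r) * (n1 r - n2 r) - (w1 r - w2 r) by lra.
have -> : 1 / 10 * (w1 r - Gnum s (n1 r)) - 1 / 10 * (w2 r - Gnum s (n2 r)) =
  1 / 10 * ((w1 r - w2 r) - Gslope (n1 r) (n2 r) * (n1 r - n2 r)) by lra.
lra.
Qed.

Lemma fast_traj_mono s w1 n1 w2 n2 t0 t : fast_traj s w1 n1 -> fast_traj s w2 n2 ->
  0 <= t0 -> t0 <= t ->
  nrm2 (w1 t - w2 t) (n1 t - n2 t) <= nrm2 (w1 t0 - w2 t0) (n1 t0 - n2 t0).
Proof.
move=> h1 h2 t00 t0t; apply: le_trans (fast_traj_contract h1 h2 t00 t0t) _.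
rewrite ler_piMl ?nrm2_ge0 // -[leRHS]expR0 ler_expR; lra.
Qed.

(* F and G are evaluated at eta clamped to the box, which makes them globally
   Lipschitz; G is continued with slope 52, so that the differential
   inequalities confining eta to the box hold outside it too. *)
Let cl (y : R) := Num.max (7 / 10) (Num.min (97 / 100) y).
Let cl_cases y : [\/ y <= 7 / 10 /\ cl y = 7 / 10, 97 / 100 <= y /\ cl y = 97 / 100 |
   [/\ 7 / 10 <= y, y <= 97 / 100 & cl y = y]].
Proof.
rewrite /cl; have [h1|h1] := leP y (97 / 100); last first.
  by constructor 2; split; [exact: ltW | apply/max_idPr; lra].
have [h2|h2] := leP y (7 / 10); first by constructor 1.
by constructor 3; split => //; exact: ltW.
Qed.
Let cl_range y : 7 / 10 <= cl y /\ cl y <= 97 / 100.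
Proof. by case: (cl_cases y) => [[? ->]|[? ->]|[? ? ->]]; split; lra. Qed.
Let cl_lip y z d : `|y - z| <= d -> `|cl y - cl z| <= d.
Proof.
rewrite !ler_norml => /andP[h1 h2]; apply/andP.
by case: (cl_cases y) => [[? ->]|[? ->]|[? ? ->]]; case: (cl_cases z) => [[? ->]|[? ->]|[? ? ->]]; split; lra.
Qed.

Let fld (eps : R) s (i : option bool) (u : option bool -> R) : R :=
  match i with
  | None => Fnum (cl (u (Some true))) - u None
  | Some true => 1 / 10 * (u None - (Gnum s (cl (u (Some true))) + 52 * (u (Some true) - cl (u (Some true)))))
  | Some false => eps * xidot s (u (Some true)) (u (Some false))
  end.

(** Picard iteration solves the clamped system; its solutions stay in the box,
    by [Fnum_box] and [Gnum_box], where clamping changes nothing.  The bounds on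
    xi hold since 0 <= xidot at xi = 0 and xidot <= 0 at xi = 1. *)
Lemma traj_exists (eps : R) s (w0 n0 x0 : R) : 0 < eps <= 1 -> in_box w0 n0 -> 0 <= x0 <= 1 ->
  exists w n x, [/\ traj eps s w n x, w 0 = w0, n 0 = n0 & x 0 = x0].
Proof.
move=> /andP[e0 e1] [bw1 bw2 bn1 bn2] /andP[bx1 bx2].
have [||z [z0 hz]] := @picard _ _ (fld eps s) 50 _ _ (fun i => match i with None => w0 | Some true => n0 | Some false => x0 end).
- by [].
- move=> u v d i huv.
  have hw := huv None; have hn := huv (Some true); have hx := huv (Some false).
  have d0 : 0 <= d by apply: le_trans hw.
  have hc := cl_lip hn; have [c1 c2] := cl_range (u (Some true)); have [c3 c4] := cl_range (v (Some true)).
  rewrite /fld; move: (u None) (u (Some true)) (u (Some false)) (v None) (v (Some true)) (v (Some false))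
    hw hn hx hc c1 c2 c3 c4 => u1 u2 u3 v1 v2 v3 {huv}.
  case: i => [[|]|] /=.
  + move=> hw hn _ hc c1 c2 c3 c4; have [g1 g2] := Gslope_bound c1 c2 c3 c4.
    have : `|Gnum s (cl u2) - Gnum s (cl v2)| <= 517 / 10 * d.
      by rewrite Gnum_sub normrM ler_pM // ger0_norm //; lra.
    move: (Gnum s (cl u2)) (Gnum s (cl v2)) (cl u2) (cl v2) hw hn hc {c1 c2 c3 c4 g1 g2} => G1 G2 k1 k2.
    by rewrite !ler_norml => /andP[? ?] /andP[? ?] /andP[? ?] /andP[? ?]; apply/andP; split; lra.
  + move=> _ hn hx _ _ _ _ _.
    have : `|xidot s u2 u3 - xidot s v2 v3| <= 12 * d.
      by move: hn hx; rewrite xidot_sub !ler_norml => /andP[? ?] /andP[? ?];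
        case: (@beta_cases R s) => ->; apply/andP; split; lra.
    rewrite -mulrBr normrM gtr0_norm // => h; apply: (@le_trans _ _ (1 * (12 * d))).
      by apply: ler_pM => //; exact: ltW.
    by lra.
  + move=> hw _ _ hc c1 c2 c3 c4; have [f1 f2] := Fslope_bound c1 c2 c3 c4.
    have : `|Fnum (cl u2) - Fnum (cl v2)| <= 296 / 10 * d.
      by rewrite Fnum_sub normrM ler_pM // ger0_norm //; lra.
    move: (Fnum (cl u2)) (Fnum (cl v2)) hw {c1 c2 c3 c4 f1 f2 hc} => F1 F2.
    by rewrite !ler_norml => /andP[? ?] /andP[? ?]; apply/andP; split; lra.
pose w := z None; pose n := z (Some true); pose x := z (Some false).
have hw t : 0 <= t -> is_derive t 1 w (Fnum (cl (n t)) - w t) by exact: (hz None).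
have hn t : 0 <= t -> is_derive t 1 n (1 / 10 * (w t - (Gnum s (cl (n t)) + 52 * (n t - cl (n t))))).
  exact: (hz (Some true)).
have hx t : 0 <= t -> is_derive t 1 x (eps * xidot s (n t) (x t)) by exact: (hz (Some false)).
have w1 t : 0 <= t -> - (12 / 10) <= w t.
  move=> t0; rewrite -subr_ge0.
  apply: (@gronwall_ge0 _ (fun t => w t - - (12 / 10)) (fun t => Fnum (cl (n t)) - w t) 0 t 1 t0).
  - by move=> r /andP[r0 _]; have := hw r r0 => ?; apply: is_derive_eq; rewrite /GRing.scale /=; ring.
  - move=> r _; have [c1 c2] := cl_range (n r); have [] := Fnum_box c1 c2; lra.
  - by rewrite /w z0; lra.
have w2 t : 0 <= t -> w t <= 58 / 10.
  move=> t0; rewrite -subr_ge0.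
  apply: (@gronwall_ge0 _ (fun t => 58 / 10 - w t) (fun t => - (Fnum (cl (n t)) - w t)) 0 t 1 t0).
  - by move=> r /andP[r0 _]; have := hw r r0 => ?; apply: is_derive_eq; rewrite /GRing.scale /=; ring.
  - move=> r _; have [c1 c2] := cl_range (n r); have [] := Fnum_box c1 c2; lra.
  - by rewrite /w z0; lra.
have n1 t : 0 <= t -> 7 / 10 <= n t.
  move=> t0; rewrite -subr_ge0.
  apply: (@gronwall_ge0 _ (fun t => n t - 7 / 10)
     (fun t => 1 / 10 * (w t - (Gnum s (cl (n t)) + 52 * (n t - cl (n t))))) 0 t (52 / 10) t0).
  - by move=> r /andP[r0 _]; have := hn r r0 => ?; apply: is_derive_eq; rewrite /GRing.scale /=; ring.
  - move=> r /andP[r0 _]; have [c1 c2] := cl_range (n r); have := w1 r r0.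
    have [] := Gnum_box s c1 c2; lra.
  - by rewrite /n z0; lra.
have n2 t : 0 <= t -> n t <= 97 / 100.
  move=> t0; rewrite -subr_ge0.
  apply: (@gronwall_ge0 _ (fun t => 97 / 100 - n t)
     (fun t => - (1 / 10 * (w t - (Gnum s (cl (n t)) + 52 * (n t - cl (n t)))))) 0 t (52 / 10) t0).
  - by move=> r /andP[r0 _]; have := hn r r0 => ?; apply: is_derive_eq; rewrite /GRing.scale /=; ring.
  - move=> r /andP[r0 _]; have [c1 c2] := cl_range (n r); have := w2 r r0.
    have [] := Gnum_box s c1 c2; lra.
  - by rewrite /n z0; lra.
have cln t : 0 <= t -> cl (n t) = n t.
  by move=> t0; have := n1 t t0; have := n2 t t0; case: (cl_cases (n t)) => [[? ->]|[? ->]|[]]; lra.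
have x1 t : 0 <= t -> 0 <= x t.
  move=> t0.
  apply: (@gronwall_ge0 _ x (fun t => eps * xidot s (n t) (x t)) 0 t (eps * beta s) t0).
  - by move=> r /andP[r0 _]; exact: hx.
  - move=> r /andP[r0 _]; rewrite mulNr -mulrA -mulrN ler_pM2l // /xidot /beta.
    by have := n1 r r0; have := n2 r r0; case: (s); lra.
  - by rewrite /x z0.
have x2 t : 0 <= t -> x t <= 1.
  move=> t0; rewrite -subr_ge0.
  apply: (@gronwall_ge0 _ (fun t => 1 - x t) (fun t => - (eps * xidot s (n t) (x t))) 0 t (eps * beta s) t0).
  - by move=> r /andP[r0 _]; have := hx r r0 => ?; apply: is_derive_eq; rewrite /GRing.scale /=; ring.
  - move=> r /andP[r0 _]; rewrite mulNr -mulrA lerN2 ler_pM2l // /xidot /beta.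
    by have := n1 r r0; have := n2 r r0; case: (s); lra.
  - by rewrite /x z0 subr_ge0.
exists w, n, x; split; rewrite /w /n /x ?z0 //; split.
  move=> t t0; have := hw t t0; have := hn t t0; rewrite cln // subrr mulr0 addr0 => ? ?.
  by split => //; split; [exact: w1 | exact: w2 | exact: n1 | exact: n2].
by move=> t t0; split; [exact: hx | rewrite x1 // x2].
Qed.

End Trajectories.

#[local] Opaque Fnum Gnum xidot w_eq eta_eq sgm.

(** * Settling and hitting the discontinuity boundary *)

Section Phases.
Context {R : realType}.
Variable eps : R.
Implicit Types (t d e T : R) (s : bool) (w n x : R -> R) (a b c : R).

(** The signed height of a state below or above Sigma, positive in the region
    of mode s, and its rate of change under mode s. *)
Definition depth s b c : R := sgm s * (16 / 10 * b - 6 / 10 - c).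
Definition depth_rate s a b c : R :=
  sgm s * (16 / 10 * (1 / 10 * (a - Gnum s b)) - eps * xidot s b c).
Definition near_eq s a b : Prop := nrm2 (a - w_eq s) (b - eta_eq s) <= (eps / 500) ^+ 2.
(** During the time [settle] the slow variable moves by at most 6 * 3/1000,
    less than the margin 2/100 in [launch], while the fast variables come within
    9 exp (- settle / 10) of equilibrium.  The factor 3 * 1000^2 in [small_eps]
    covers both nearness at scale eps/1000 and the contraction in [leg_end]. *)
Definition settle : R := 3 / 1000 / eps.
Definition small_eps : Prop :=
  [/\ 0 < eps, eps <= 1 / 100 & 3 * 1000 ^+ 2 * expR (- (settle / 10)) <= eps].

Hypothesis sm : small_eps.
Let e0 : 0 < eps. Proof. by case: sm. Qed.
Let e1 : eps <= 1 / 100. Proof. by case: sm. Qed.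

Lemma settle_gt0 : 0 < settle. Proof. by apply: divr_gt0; [lra | exact: e0]. Qed.
Lemma eps_settle : eps * settle = 3 / 1000. Proof. by rewrite /settle mulrC divfK ?gt_eqF. Qed.

Lemma sgm_cases s : sgm s = 1 :> R \/ sgm s = - 1 :> R.
Proof. by case: s; [left | right]; exact: erefl. Qed.

Lemma depthN s b c : depth (~~ s) b c = - depth s b c.
Proof. by rewrite /depth sgmN mulNr. Qed.

Lemma depth_derive s w n x t : traj eps s w n x -> 0 <= t ->
  is_derive t 1 (fun t => depth s (n t) (x t)) (depth_rate s (w t) (n t) (x t)).
Proof.
move=> [h1 h2] t0; have [_ hn _] := h1 t t0; have [hx _] := h2 t t0.
by rewrite /depth /depth_rate; apply: is_derive_eq; rewrite /GRing.scale /=; ring.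
Qed.

Lemma depth_rate_fast s a b c : in_box a b -> 0 <= c <= 1 ->
  sgm s * (b - eta_eq (~~ s)) <= 3 / 100 -> 1 / 5 <= depth_rate s a b c.
Proof.
move=> hb /andP[c0 c1] hs; have h1 := eta_drift hb hs.
have [_ _ n1 n2] := hb; have := xidot_bound s n1 n2 c0 c1; rewrite ler_norml => /andP[h2 h3].
have E0 := e0; have E1 := e1.
have h4 : - (6 / 100) <= eps * xidot s b c by nra.
have h5 : eps * xidot s b c <= 6 / 100 by nra.
by move: h1; rewrite /depth_rate; case: (sgm_cases s) => ->; lra.
Qed.

(** Near equilibrium eta is almost at rest, at scale eps/250, and the drift of
    xi given by [xidot_drift] prevails. *)
Lemma depth_rate_slow s a b c : in_box a b -> nrm2 (a - w_eq s) (b - eta_eq s) <= (eps / 250) ^+ 2 ->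
  0 <= depth s b c -> depth_rate s a b c <= - (eps / 1000).
Proof.
move=> [w1 w2 n1 n2] hN hg.
have d0 : 0 <= eps / 250 by have := e0; lra.
have [h1 h2] := nrm2_bound d0 hN.
have h3 := xidot_drift n2 hg.
have [m1 m2] := @eta_eq_box R s.
have [||||g1 g2] := @Gslope_bound _ b (eta_eq s); try lra.
have eG := Gnum_sub s b (eta_eq s).
have hG : `|Gnum s b - Gnum s (eta_eq s)| <= 517 / 10 * (eps / 250 / 15).
  by rewrite eG normrM ler_pM // ger0_norm //; lra.
have h4 : 9 / (20 * 100) * eps <= eps * (sgm s * xidot s b c) by rewrite mulrC ler_pM2l.
move: h1 hG; rewrite {1}w_eq_G !ler_norml => /andP[? ?] /andP[? ?].
by move: h4 e0; rewrite /depth_rate; case: (sgm_cases s) => ->; lra.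
Qed.

Lemma near_forward s w n t0 t c : fast_traj s w n -> 0 <= t0 -> t0 <= t ->
  nrm2 (w t0 - w_eq s) (n t0 - eta_eq s) <= c -> nrm2 (w t - w_eq s) (n t - eta_eq s) <= c.
Proof.
by move=> h a1 a2; apply: le_trans; exact: fast_traj_mono h (fast_traj_const s) a1 a2.
Qed.

Lemma nrm2_box a b s : in_box a b -> nrm2 (a - w_eq s) (b - eta_eq s) <= 81.
Proof.
move=> [w1 w2 n1 n2]; have [v1 v2 m1 m2] := @eq_in_box R s.
have h1 : (a - w_eq s) ^+ 2 <= 49 by nra.
have h2 : (b - eta_eq s) ^+ 2 <= 9 / 100 by nra.
by rewrite /nrm2; lra.
Qed.

Lemma nrm2_decay s w n t : fast_traj s w n -> 0 <= t ->
  nrm2 (w t - w_eq s) (n t - eta_eq s) <= (9 * expR (- (t / 10))) ^+ 2.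
Proof.
move=> h t0; apply: le_trans (fast_traj_contract h (fast_traj_const s) (lexx 0) t0) _.
have [_ _ hb] := h 0 (lexx 0).
rewrite exprMn -expRM_natl.
have -> : 2%:R * - (t / 10) = - (1 / 5) * (t - 0) by rewrite subr0; field.
rewrite mulrC ler_pM2r ?expR_gt0 //.
apply: le_trans (nrm2_box s hb) _; lra.
Qed.

Lemma sqr_mono a b : 0 <= a -> a <= b -> a ^+ 2 <= b ^+ 2.
Proof. by move=> a0 ab; rewrite ler_pXn2r // nnegrE // (le_trans a0). Qed.

(** The box has nrm2-radius below 9, and 9 exp (- settle / 10) <= eps / 1000
    by the choice of [small_eps]. *)
Lemma near_late s w n t : fast_traj s w n -> settle <= t ->
  nrm2 (w t - w_eq s) (n t - eta_eq s) <= (eps / 1000) ^+ 2.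
Proof.
move=> h Tt; have t0 : 0 <= t by apply: le_trans Tt; apply: ltW; exact: settle_gt0.
apply: le_trans (nrm2_decay h t0) _.
have E1 := expR_gt0 (- (t / 10)).
apply: sqr_mono; first lra.
have h1 : expR (- (t / 10)) <= expR (- (settle / 10)) by rewrite ler_expR; lra.
have [_ _ h2] := sm; have := expR_gt0 (- (settle / 10)); lra.
Qed.

Lemma near_late_eq s w n t : fast_traj s w n -> settle <= t -> near_eq s (w t) (n t).
Proof.
move=> h /(near_late h) /le_trans; apply.
by by apply: sqr_mono; have := e0; lra.
Qed.

Lemma near_slack s a b : near_eq s a b -> nrm2 (a - w_eq s) (b - eta_eq s) <= (eps / 250) ^+ 2.
Proof.
move=> /le_trans; apply.
by by apply: sqr_mono; have := e0; lra.
Qed.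

Lemma traj_cont s w n x t : traj eps s w n x -> 0 <= t ->
  {for t, continuous (fun t => depth s (n t) (x t))}.
Proof. by move=> h t0; apply: is_derive_continuous (depth_derive h t0). Qed.

(** As long as the depth is positive it decreases at rate eps/1000, and it
    starts below 3. *)
Lemma phase_hit s w n x t0 : traj eps s w n x -> 0 <= t0 ->
  near_eq s (w t0) (n t0) -> 0 < depth s (n t0) (x t0) ->
  exists T, [/\ t0 < T, depth s (n T) (x T) = 0 &
    forall t, t0 <= t < T -> 0 < depth s (n t) (x t)].
Proof.
move=> h t00 hN hg; have [hp hx] := h.
have near t : t0 <= t -> nrm2 (w t - w_eq s) (n t - eta_eq s) <= (eps / 250) ^+ 2.
  by move=> tt; apply: near_slack; exact: near_forward hp t00 tt hN.
(* by then the depth would have dropped by 3 *)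
pose t1 := t0 + 3 * 1000 / eps.
have t01 : t0 <= t1 by rewrite lerDl; apply: divr_ge0; [lra | exact: ltW].
have [t /andP[tt tt1] gt0] : exists2 t, t0 <= t <= t1 & depth s (n t) (x t) <= 0.
  apply: contrapT => hno.
  have hpos t : t0 <= t <= t1 -> 0 < depth s (n t) (x t).
    by move=> tt; rewrite ltNge; apply/negP => ?; apply: hno; exists t.
  have hh : depth s (n t1) (x t1) - depth s (n t0) (x t0) <= - (eps / 1000) * t1 - - (eps / 1000) * t0.
    apply: (@le_increment _ (fun t => depth s (n t) (x t)) (fun t => depth_rate s (w t) (n t) (x t))
      (fun t => - (eps / 1000) * t) (fun=> - (eps / 1000)) t0 t1 t01) => t.
    - by move=> /andP[tt _]; exact: depth_derive h (le_trans t00 tt).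
    - by move=> _; apply: is_derive_eq; rewrite /GRing.scale /= mulr1.
    - move=> /andP[tt tt1]; have [_ _ hb] := hp t (le_trans t00 tt).
      by apply: depth_rate_slow => //; [exact: near | apply/ltW/hpos; rewrite tt].
  have ee : - (eps / 1000) * t1 - - (eps / 1000) * t0 = - 3.
    by rewrite /t1; field; rewrite gt_eqF.
  rewrite ee in hh; clear ee.
  have [_ _ [_ _ ? ?]] := hp t0 t00; have [_ /andP[? ?]] := hx t0 t00.
  have : depth s (n t0) (x t0) < 3 by rewrite /depth; case: (sgm_cases s) => ->; lra.
  have := hpos t1; rewrite t01 lexx => /(_ isT); lra.
have [|||T /andP[T1 T2] [T3 T4]] := @first_zero _ (fun t => depth s (n t) (x t)) t0 t tt => //.
  by move=> r /andP[tr _]; apply: traj_cont h (le_trans t00 tr).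
by exists T.
Qed.

End Phases.

(** * Legs: half-periods from gate to gate *)

Section Legs.
Context {R : realType}.
Variable eps : R.
Implicit Types (t d e T : R) (s : bool) (w n x : R -> R) (a b c : R).
Hypothesis sm : small_eps eps.
Let e0 : 0 < eps. Proof. by case: sm. Qed.
Let e1 : eps <= 1 / 100. Proof. by case: sm. Qed.
Notation settle := (settle eps).
Notation near_eq := (near_eq eps).

(** The slow variable is on the starting side, up to a margin, of its value on
    Sigma at the equilibrium that is left behind.  The other state variables are
    not constrained, because they may be in the middle of the fast transition. *)
Definition launch s c : Prop := sgm s * (c - (16 / 10 * eta_eq (~~ s) - 6 / 10)) <= 2 / 100.

Lemma xi_drift s w n x t : traj eps s w n x -> 0 <= t -> `|x t - x 0| <= eps * 6 * t.
Proof.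
move=> [hp hx] t0; rewrite -[leRHS](_ : eps * 6 * (t - 0) = _); last by rewrite subr0.
apply: (lip_increment (df := fun t => eps * xidot s (n t) (x t)) t0) => r /andP[r0 _].
  by have [] := hx r r0.
have [_ /andP[x1 x2]] := hx r r0; have [_ _ [_ _ n1 n2]] := hp r r0.
by rewrite normrM gtr0_norm // ler_pM2l // xidot_bound.
Qed.

(** If the depth were nonpositive at a time up to [settle], then eta, being
    tied to the almost constant xi, would still be close to its starting
    equilibrium, where [depth_rate_fast] applies: a barrier. *)
Lemma early_pos s w n x : traj eps s w n x -> 0 <= depth s (n 0) (x 0) -> launch s (x 0) ->
  forall t, 0 < t <= settle -> 0 < depth s (n t) (x t).
Proof.
move=> h g0 hl; have [hp hx] := h.
apply: (@barrier_gt0 _ (fun t => depth s (n t) (x t)) (fun t => depth_rate eps s (w t) (n t) (x t)) settle g0).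
  by move=> t /andP[t0 _]; exact: depth_derive.
move=> t /andP[t0 tT] gt0; have [_ _ hb] := hp t t0; have [_ hx01] := hx t t0.
apply: lt_le_trans (depth_rate_fast sm hb hx01 _); first lra.
have h1 := xi_drift h t0.
have h2 : eps * t <= 3 / 1000 by rewrite -(eps_settle sm) ler_pM2l.
move: gt0 h1 hl; rewrite /depth /launch ler_norml => gt0 /andP[h3 h4].
by clear -gt0 h2 h3 h4; case: (@sgm_cases R s) gt0 => ->; lra.
Qed.

Lemma near_launch s a b c : near_eq (~~ s) a b -> - (1 / 100) <= depth s b c -> launch s c.
Proof.
move=> hN g2; have d0 : 0 <= eps / 500 by have := e0; lra.
have [_] := nrm2_bound d0 hN; rewrite ler_norml => /andP[h1 h2].
by move: g2 e1; rewrite /depth /launch; clear -h1 h2; case: (@sgm_cases R s) => ->; lra.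
Qed.

(** A half-period, from Sigma near the equilibrium of the other mode to Sigma
    near the equilibrium of mode s. *)
Definition leg s w n x T : Prop :=
  [/\ traj eps s w n x, near_eq (~~ s) (w 0) (n 0), depth s (n 0) (x 0) = 0,
      settle < T /\ depth s (n T) (x T) = 0 & forall t, 0 < t < T -> 0 < depth s (n t) (x t)].

Lemma leg_of_traj s w n x : traj eps s w n x -> near_eq (~~ s) (w 0) (n 0) ->
  depth s (n 0) (x 0) = 0 -> exists T, leg s w n x T.
Proof.
move=> h hN g0; have [hp hx] := h.
have T00 := settle_gt0 sm.
have pos := early_pos h.
have hl : launch s (x 0) by apply: near_launch hN _; rewrite g0; lra.
have {}pos := pos ltac:(rewrite g0; exact: lexx) hl.
have gT0 : 0 < depth s (n settle) (x settle) by apply: pos; rewrite T00 lexx.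
have [T [T1 T2 T3]] := phase_hit sm h (ltW T00) (near_late_eq sm hp (lexx _)) gT0.
exists T; split => // t /andP[t0 tT].
by have [tT0|tT0] := leP t settle; [apply: pos; rewrite t0 | apply: T3; rewrite ltW].
Qed.

Section Compare.
Variables (s : bool) (w1 n1 x1 w2 n2 x2 : R -> R) (T1 T2 d : R).
Hypotheses (l1 : leg s w1 n1 x1 T1) (l2 : leg s w2 n2 x2 T2) (d0 : 0 <= d).
Hypothesis hd : nrm2 (w1 0 - w2 0) (n1 0 - n2 0) <= d ^+ 2.

Lemma leg_close_fast t : 0 <= t -> `|w1 t - w2 t| <= d /\ `|n1 t - n2 t| <= d / 15.
Proof.
move=> t0; apply: nrm2_bound => //; apply: le_trans hd.
have [[h1 _] _ _ _ _] := l1; have [[h2 _] _ _ _ _] := l2.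
exact: fast_traj_mono h1 h2 (lexx 0) t0.
Qed.

(** The initial difference is at most 16/10 * d/15, from the equation of
    Sigma, and the equation for xi pulls the difference below
    (beta + a) / beta * d/15, which is less than 12/100 * d, uniformly in eps. *)
Lemma leg_close_xi t : 0 <= t -> `|x1 t - x2 t| <= 12 / 100 * d.
Proof.
move=> t0; have [h1 _ g1 _ _] := l1; have [h2 _ g2 _ _] := l2.
have init : `|x1 0 - x2 0| <= 12 / 100 * d.
  have [_] := leg_close_fast (lexx 0).
  have E1 : x1 0 = 16 / 10 * n1 0 - 6 / 10.
    by move: g1; rewrite /depth; case: (@sgm_cases R s) => ->; lra.
  have E2 : x2 0 = 16 / 10 * n2 0 - 6 / 10.
    by move: g2; rewrite /depth; case: (@sgm_cases R s) => ->; lra.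
  rewrite E1 E2 !ler_norml => /andP[? ?]; move: d0 => ?; apply/andP; split; lra.
have dx t' : 0 <= t' -> is_derive t' 1 (fun t => x1 t - x2 t)
    (eps * (xidot s (n1 t') (x1 t') - xidot s (n2 t') (x2 t'))).
  move=> t'0; have [_ /(_ t' t'0)[a1 _]] := h1; have [_ /(_ t' t'0)[a2 _]] := h2.
  by apply: is_derive_eq; rewrite /GRing.scale /=; ring.
have key t' : 0 <= t' ->
    eps * (beta s * (x1 t' - x2 t') - 12 / 100 * beta s * d)
      <= - (eps * (xidot s (n1 t') (x1 t') - xidot s (n2 t') (x2 t'))) /\
    - (eps * (xidot s (n1 t') (x1 t') - xidot s (n2 t') (x2 t')))
      <= eps * (beta s * (x1 t' - x2 t') + 12 / 100 * beta s * d).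
  move=> t'0; have [_] := leg_close_fast t'0; rewrite ler_norml => /andP[k1 k2].
  rewrite -!mulrN !ler_pM2l //.
  have D0 := d0.
  by rewrite xidot_sub; case: (@beta_cases R s) => ->; split; lra.
rewrite ler_norml; apply/andP; split; rewrite -subr_ge0.
  apply: (@gronwall_ge0 _ (fun t => x1 t - x2 t - - (12 / 100 * d))
    (fun t' => eps * (xidot s (n1 t') (x1 t') - xidot s (n2 t') (x2 t'))) 0 t (eps * beta s) t0).
  - move=> r /andP[r0 _]; have := dx r r0 => ?.
    by apply: is_derive_eq; rewrite /GRing.scale /=; ring.
  - by move=> r /andP[r0 _]; have [_ k] := key r r0; rewrite -lerN2; apply: le_trans k _;
      rewrite le_eqVlt; apply/orP; left; apply/eqP; ring.
  - by move: init; rewrite ler_norml => /andP[]; lra.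
apply: (@gronwall_ge0 _ (fun t => 12 / 100 * d - (x1 t - x2 t))
    (fun t' => - (eps * (xidot s (n1 t') (x1 t') - xidot s (n2 t') (x2 t')))) 0 t (eps * beta s) t0).
- move=> r /andP[r0 _]; have := dx r r0 => ?.
  by apply: is_derive_eq; rewrite /GRing.scale /=; ring.
- by move=> r /andP[r0 _]; have [k _] := key r r0; apply: le_trans k;
      rewrite le_eqVlt; apply/orP; left; apply/eqP; ring.
- by move: init; rewrite ler_norml => /andP[]; lra.
Qed.

(** When the first leg ends, the depth of the second is at most d/4, and it
    decreases at rate eps/1000. *)
Lemma leg_time : T1 <= T2 -> T2 - T1 <= 250 * d / eps.
Proof.
move=> T12; have [h1 _ g1 [T01 gT1] _] := l1; have [h2 _ g2 [T02 gT2] pos] := l2.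
have T00 := settle_gt0 sm; have T10 : 0 <= T1 by apply: ltW; exact: lt_trans T01.
have hg : depth s (n2 T1) (x2 T1) <= 25 / 100 * d.
  have [_] := leg_close_fast T10; have := leg_close_xi T10.
  rewrite !ler_norml => /andP[? ?] /andP[? ?].
  have : depth s (n2 T1) (x2 T1) - depth s (n1 T1) (x1 T1) <= 25 / 100 * d.
    by move: d0 => ?; rewrite /depth; case: (@sgm_cases R s) => ->; lra.
  by rewrite gT1 subr0.
have : depth s (n2 T2) (x2 T2) - depth s (n2 T1) (x2 T1) <= - (eps / 1000) * T2 - - (eps / 1000) * T1.
  apply: (@le_increment _ (fun t => depth s (n2 t) (x2 t)) (fun t => depth_rate eps s (w2 t) (n2 t) (x2 t))
      (fun t => - (eps / 1000) * t) (fun=> - (eps / 1000)) _ _ T12) => t /andP[tt tt2].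
  - exact: depth_derive h2 (le_trans T10 tt).
  - by apply: is_derive_eq; rewrite /GRing.scale /= mulr1.
  - have t0 := le_trans T10 tt; have [hp _] := h2; have [_ _ hb] := hp t t0.
    apply: depth_rate_slow => //.
      by apply: near_slack => //; apply: near_late_eq hp _ => //; apply: le_trans tt; exact: ltW.
    move: tt2; rewrite le_eqVlt => /orP[/eqP ->|tt2]; first by rewrite gT2.
    by apply/ltW/pos; rewrite tt2 (lt_le_trans _ tt) // (lt_trans T00).
rewrite gT2 sub0r => hh.
rewrite ler_pdivlMr //; lra.
Qed.

End Compare.

End Legs.

(** * Contraction of legs and the closed cycle *)

Section Cycle.
Context {R : realType}.
Variable eps : R.
Implicit Types (t d e T : R) (s : bool) (w n x : R -> R) (a b c : R) (p q : R * R).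
Hypothesis sm : small_eps eps.
Let e0 : 0 < eps. Proof. by case: sm. Qed.
Let e1 : eps <= 1 / 100. Proof. by case: sm. Qed.
Notation settle := (settle eps).
Notation near_eq := (near_eq eps).

Definition in_box_strict a b :=
  [/\ - (12 / 10) < a, a < 58 / 10, 7 / 10 < b & b < 97 / 100].

Lemma in_boxW a b : in_box_strict a b -> in_box a b.
Proof. by move=> [? ? ? ?]; split; exact: ltW. Qed.

Lemma near_box_strict s a b : nrm2 (a - w_eq s) (b - eta_eq s) <= (eps / 250) ^+ 2 -> in_box_strict a b.
Proof.
move=> hN; have d0 : 0 <= eps / 250 by have := e0; lra.
have [] := nrm2_bound d0 hN; rewrite !ler_norml => /andP[h1 h2] /andP[h3 h4].
have [w1 w2] := @w_eq_range R s; have [n1 n2] := @eta_eq_box R s.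
by have E0 := e0; have E1 := e1; clear -h1 h2 h3 h4 w1 w2 n1 n2 E0 E1; split; lra.
Qed.

Lemma near_box s a b : nrm2 (a - w_eq s) (b - eta_eq s) <= (eps / 250) ^+ 2 -> in_box a b.
Proof. by move=> h; apply: in_boxW; exact: near_box_strict h. Qed.

(** The field points into the box, so exponentially decaying lower bounds hold
    for the distances to its four sides. *)
Lemma fast_traj_strict s w n t : fast_traj s w n -> in_box_strict (w 0) (n 0) -> 0 <= t ->
  in_box_strict (w t) (n t).
Proof.
move=> h [w1 w2 n1 n2] t0.
have hw (r : R) : 0 <= r -> is_derive r 1 w (Fnum (n r) - w r) by move=> r0; have [] := h r r0.
have hn (r : R) : 0 <= r -> is_derive r 1 n (1 / 10 * (w r - Gnum s (n r))) by move=> r0; have [] := h r r0.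
have Fr (r : R) : 0 <= r -> - (12 / 10) <= Fnum (n r) /\ Fnum (n r) <= 58 / 10.
  by move=> r0; have [_ _ [_ _ a1 a2]] := h r r0; exact: Fnum_box.
have Gr (r : R) : 0 <= r -> Gnum s (n r) - 52 * (n r - 7 / 10) <= - (12 / 10) /\
    58 / 10 <= Gnum s (n r) + 52 * (97 / 100 - n r).
  by move=> r0; have [_ _ [_ _ a1 a2]] := h r r0; exact: Gnum_box.
split; rewrite -subr_gt0.
- apply: (@gronwall_gt0 _ (fun t => w t - - (12 / 10)) (fun r => Fnum (n r) - w r) 0 t 1 t0); last lra.
    by move=> r /andP[r0 _]; have := hw r r0 => ?; apply: is_derive_eq; rewrite /GRing.scale /=; ring.
  by move=> r /andP[r0 _]; have [] := Fr r r0; lra.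
- apply: (@gronwall_gt0 _ (fun t => 58 / 10 - w t) (fun r => - (Fnum (n r) - w r)) 0 t 1 t0); last lra.
    by move=> r /andP[r0 _]; have := hw r r0 => ?; apply: is_derive_eq; rewrite /GRing.scale /=; ring.
  by move=> r /andP[r0 _]; have [] := Fr r r0; lra.
- apply: (@gronwall_gt0 _ (fun t => n t - 7 / 10) (fun r => 1 / 10 * (w r - Gnum s (n r))) 0 t (52 / 10) t0); last lra.
    by move=> r /andP[r0 _]; have := hn r r0 => ?; apply: is_derive_eq; rewrite /GRing.scale /=; ring.
  by move=> r /andP[r0 _]; have [] := Gr r r0; have [_ _ [a1 a2 _ _]] := h r r0; lra.
- apply: (@gronwall_gt0 _ (fun t => 97 / 100 - n t) (fun r => - (1 / 10 * (w r - Gnum s (n r)))) 0 t (52 / 10) t0); last lra.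
    by move=> r /andP[r0 _]; have := hn r r0 => ?; apply: is_derive_eq; rewrite /GRing.scale /=; ring.
  by move=> r /andP[r0 _]; have [] := Gr r r0; have [_ _ [a1 a2 _ _]] := h r r0; lra.
Qed.

(** Speeds are bounded by the distance to equilibrium, which has decayed. *)
Lemma late_speed s w n t t' : fast_traj s w n -> settle <= t -> t <= t' ->
  `|w t' - w t| <= 27 * expR (- (settle / 10)) * (t' - t) /\
  `|n t' - n t| <= 5 * expR (- (settle / 10)) * (t' - t).
Proof.
move=> h Tt tt'; have t0 : 0 <= t by apply: le_trans Tt; apply: ltW; exact: settle_gt0.
set E := expR _; have E_gt0 : 0 < E by exact: expR_gt0.
have key r : t <= r -> `|Fnum (n r) - w r| <= 27 * E /\ `|1 / 10 * (w r - Gnum s (n r))| <= 5 * E.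
  move=> tr; have r0 := le_trans t0 tr; have [_ _ [w1 w2 n1 n2]] := h r r0.
  have E9 : 0 <= 9 * expR (- (r / 10)) by rewrite mulr_ge0 ?expR_ge0.
  have [h1 h2] := nrm2_bound E9 (nrm2_decay h r0).
  have rE : expR (- (r / 10)) <= E by rewrite /E ler_expR; have := le_trans Tt tr; lra.
  have [m1 m2] := @eta_eq_box R s.
  have m1' : 7 / 10 <= eta_eq s :> R by lra.
  have m2' : eta_eq s <= 97 / 100 :> R by lra.
  have [f1 f2] := Fslope_bound n1 n2 m1' m2'; have [g1 g2] := Gslope_bound n1 n2 m1' m2'.
  have hF : `|Fnum (n r) - Fnum (eta_eq s)| <= 296 / 10 * (9 * E / 15).
    rewrite Fnum_sub normrM; apply: ler_pM => //; first by rewrite ger0_norm //; lra.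
    by apply: le_trans h2 _; lra.
  have hG : `|Gnum s (n r) - Gnum s (eta_eq s)| <= 517 / 10 * (9 * E / 15).
    rewrite Gnum_sub normrM; apply: ler_pM => //; first by rewrite ger0_norm //; lra.
    by apply: le_trans h2 _; lra.
  have eF : Fnum (eta_eq s) = w_eq s :> R by [].
  have eG := @w_eq_G R s.
  move: h1 hF hG; rewrite eF -eG !ler_norml => /andP[? ?] /andP[? ?] /andP[? ?].
  by clear h2 g1 g2 f1 f2 w1 w2 n1 n2 m1 m2 m1' m2' eF eG h; split; apply/andP; split; lra.
split.
  apply: (@lip_increment _ w (fun r => Fnum (n r) - w r)) => // r /andP[tr _].
    by have [] := h r (le_trans t0 tr).
  by have [] := key r tr.
apply: (@lip_increment _ n (fun r => 1 / 10 * (w r - Gnum s (n r)))) => // r /andP[tr _].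
  by have [] := h r (le_trans t0 tr).
by have [] := key r tr.
Qed.

Lemma nrm2_le a b a' b' : `|a| <= a' -> `|b| <= b' -> nrm2 a b <= a' ^+ 2 + 250 * b' ^+ 2.
Proof.
move=> ha hb; rewrite /nrm2; apply: lerD.
  by rewrite -[leLHS]real_normK ?num_real //; apply: sqr_mono.
by rewrite ler_wpM2l ?ler0n // -[leLHS]real_normK ?num_real //; apply: sqr_mono.
Qed.

(** Up to the common time the distance contracts by exp (- settle / 10); in
    the remaining time, of length at most 250 d / eps, the fast variables move
    at a speed of that same exponentially small order. *)
Lemma leg_end s w1 n1 x1 T1 w2 n2 x2 T2 d : leg eps s w1 n1 x1 T1 -> leg eps s w2 n2 x2 T2 ->
  0 <= d -> nrm2 (w1 0 - w2 0) (n1 0 - n2 0) <= d ^+ 2 ->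
  nrm2 (w1 T1 - w2 T2) (n1 T1 - n2 T2) <= (d / 20) ^+ 2.
Proof.
wlog T12 : w1 n1 x1 T1 w2 n2 x2 T2 / T1 <= T2.
  move=> hw l1 l2 d0 hd; have [T12|T12] := leP T1 T2; first exact: hw l1 l2 d0 hd.
  have sym a b a' b' : nrm2 (a - a') (b - b') = nrm2 (a' - a) (b' - b) by rewrite /nrm2; ring.
  by rewrite sym; apply: hw (ltW T12) l2 l1 d0 _; rewrite sym.
move=> l1 l2 d0 hd; have ht := leg_time sm l1 l2 d0 hd T12.
have [h1 _ _ [T01 _] _] := l1; have [h2 _ _ [T02 _] _] := l2.
have T00 := settle_gt0 sm; have T20 : 0 <= T2 by apply: ltW; exact: lt_trans T02.
set E := expR (- (settle / 10)); have E0 : 0 < E by exact: expR_gt0.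
have [_ _ hE] := sm; rewrite -/E in hE.
have [hw hn] := late_speed (proj1 h1) (ltW T01) T12; rewrite -/E in hw hn.
have Ed0 : 0 <= E * d by rewrite mulr_ge0 // ltW.
have hc : nrm2 (w1 T2 - w2 T2) (n1 T2 - n2 T2) <= (E * d) ^+ 2.
  apply: le_trans (fast_traj_contract (proj1 h1) (proj1 h2) (lexx 0) T20) _.
  rewrite exprMn; apply: ler_pM => //; rewrite ?expR_ge0 ?nrm2_ge0 //.
  rewrite /E -expRM_natl ler_expR subr0; lra.
have [hw2 hn2] := nrm2_bound Ed0 hc.
have Et : E * (T2 - T1) <= d / (12 * 1000).
  have : E * (T2 - T1) <= E * (250 * d / eps) by rewrite ler_pM2l.
  move/le_trans; apply.
  have -> : E * (250 * d / eps) = E / eps * (250 * d) by ring.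
  have qE : E / eps <= 1 / (3 * 1000 ^+ 2).
    by rewrite ler_pdivrMr // ; lra.
  have : E / eps * (250 * d) <= 1 / (3 * 1000 ^+ 2) * (250 * d).
    by apply: ler_wpM2r qE; apply: mulr_ge0 d0; exact: ler0n.
  move/le_trans; apply; lra.
have Ed : E * d <= d / 1000.
  have E1 := e1; have : E <= 1 / 1000 by lra.
  by move=> /(ler_wpM2r d0); lra.
have aw : `|w1 T1 - w2 T2| <= d / 200.
  by move: hw hw2; rewrite -!mulrA !ler_norml => /andP[? ?] /andP[? ?]; apply/andP; split; lra.
have an : `|n1 T1 - n2 T2| <= d / 1000.
  by move: hn hn2; rewrite -!mulrA !ler_norml => /andP[? ?] /andP[? ?]; apply/andP; split; lra.
apply: le_trans (nrm2_le aw an) _.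
rewrite !exprMn; have := sqr_ge0 d; lra.
Qed.

Lemma leg_exists s a b : near_eq (~~ s) a b ->
  exists w n x T, [/\ leg eps s w n x T, w 0 = a & n 0 = b].
Proof.
move=> hN; have hb := near_box (near_slack sm hN); have [_ _ b1 b2] := hb.
have e01 : 0 < eps <= 1 by apply/andP; split => //; have := e1; lra.
have [|w [n [x [h hw hn hx]]]] := @traj_exists _ eps s a b (16 / 10 * b - 6 / 10) e01 hb.
  by apply/andP; split; lra.
have [||T lT] := @leg_of_traj _ _ sm s w n x h.
- by rewrite hw hn.
- by rewrite /depth hn hx subrr mulr0.
- by exists w, n, x, T.
Qed.

(** Makes the passage along a leg a function, to be iterated in
    [cycle_exists]. *)
Lemma half_exists s : exists f : R * R -> R * R, forall p, near_eq (~~ s) p.1 p.2 ->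
  exists w n x T, [/\ leg eps s w n x T, w 0 = p.1, n 0 = p.2 & f p = (w T, n T)].
Proof.
have ex p : exists q, near_eq (~~ s) p.1 p.2 ->
    exists w n x T, [/\ leg eps s w n x T, w 0 = p.1, n 0 = p.2 & q = (w T, n T)].
  have [hN|hN] := pselect (near_eq (~~ s) p.1 p.2); last by exists p.
  have [w [n [x [T [h1 h2 h3]]]]] := leg_exists hN.
  by exists (w T, n T) => _; exists w, n, x, T.
exists (fun p => sval (cid (ex p))) => p; by case: cid => q /=.
Qed.

Lemma leg_end_near s w n x T : leg eps s w n x T -> near_eq s (w T) (n T).
Proof. by move=> [[hp _] _ _ [hT _] _]; apply: near_late_eq => //; exact: ltW. Qed.

Lemma sqr_perturb a z e : e <= 1 -> `|a| <= 1 / 20 -> `|z| <= e ->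
  (a + z) ^+ 2 <= a ^+ 2 + 11 / 10 * e.
Proof.
move=> ee; rewrite !ler_norml => /andP[a1 a2] /andP[z1 z2].
have h1 : 0 <= (1 / 20 - a) * (e + z) by apply: mulr_ge0; lra.
have h2 : 0 <= (1 / 20 + a) * (e - z) by apply: mulr_ge0; lra.
have h3 : 0 <= (e - z) * (e + z) by apply: mulr_ge0; lra.
have h4 : 0 <= e * (1 - e) by apply: mulr_ge0; lra.
by clear -h1 h2 h3 h4; nra.
Qed.

Let D p q := nrm2 (p.1 - q.1) (p.2 - q.2).

(** Banach's fixed point argument for the return map on the gate of mode
    false, in the norm [nrm2]; a leg of each sign through the fixed point gives
    the cycle. *)
Lemma cycle_exists : exists wa na xa Ta wb nb xb Tb,
  [/\ leg eps true wa na xa Ta, leg eps false wb nb xb Tb,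
     [/\ wa Ta = wb 0, na Ta = nb 0 & xa Ta = xb 0] &
     [/\ wb Tb = wa 0, nb Tb = na 0 & xb Tb = xa 0]].
Proof.
have [ft hft] := half_exists true; have [ff hff] := half_exists false.
pose nr s p := near_eq s p.1 p.2.
have nft p : nr false p -> nr true (ft p).
  by move=> /hft[w [n [x [T [h _ _ ->]]]]]; exact: leg_end_near h.
have nff p : nr true p -> nr false (ff p).
  by move=> /hff[w [n [x [T [h _ _ ->]]]]]; exact: leg_end_near h.
have cft p q d : nr false p -> nr false q -> 0 <= d -> D p q <= d ^+ 2 -> D (ft p) (ft q) <= (d / 20) ^+ 2.
  move=> /hft[w [n [x [T [h1 h2 h3 ->]]]]] /hft[w' [n' [x' [T' [h1' h2' h3' ->]]]]] d0.
  by rewrite /D -h2 -h3 -h2' -h3'; exact: leg_end h1 h1' d0.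
have cff p q d : nr true p -> nr true q -> 0 <= d -> D p q <= d ^+ 2 -> D (ff p) (ff q) <= (d / 20) ^+ 2.
  move=> /hff[w [n [x [T [h1 h2 h3 ->]]]]] /hff[w' [n' [x' [T' [h1' h2' h3' ->]]]]] d0.
  by rewrite /D -h2 -h3 -h2' -h3'; exact: leg_end h1 h1' d0.
pose P p := ff (ft p).
have nP p : nr false p -> nr false (P p) by move=> /nft /nff.
have cP p q d : nr false p -> nr false q -> 0 <= d -> D p q <= d ^+ 2 -> D (P p) (P q) <= (d / 2) ^+ 2.
  move=> hp hq d0 hd; have d20 : 0 <= d / 20 by lra.
  apply: le_trans (cff _ _ _ (nft _ hp) (nft _ hq) d20 (cft _ _ _ hp hq d0 hd)) _.
  by apply: sqr_mono; lra.
pose u k := iter k P (w_eq false, eta_eq false).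
have nu k : nr false (u k).
  elim: k => [|k IH]; last exact: nP.
  by rewrite /nr /near_eq /nrm2 /= !subrr expr0n /= mulr0 addr0 sqr_ge0.
have du k : D (u k.+1) (u k) <= (10 / 2 ^+ k) ^+ 2.
  elim: k => [|k IH].
    rewrite expr0 divr1; have := nrm2_box false (near_box (near_slack sm (nu 1))); rewrite /D /=; lra.
  have -> : 10 / 2 ^+ k.+1 = 10 / 2 ^+ k / 2 :> R by rewrite exprS; field; rewrite expf_neq0.
  by apply: (cP _ _ _ (nu k.+1) (nu k) _ IH); rewrite divr_ge0 ?exprn_ge0 ?ler0n.
have bu k : `|(u k.+1).1 - (u k).1| <= 10 / 2 ^+ k /\ `|(u k.+1).2 - (u k).2| <= 10 / 2 ^+ k.
  have h0 : 0 <= 10 / 2 ^+ k :> R by rewrite divr_ge0 ?exprn_ge0 ?ler0n.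
  by have [h1 h2] := nrm2_bound h0 (du k); split => //; apply: le_trans h2 _; lra.
have [l1 hl1] := geom_cauchy (fun k => proj1 (bu k)).
have [l2 hl2] := geom_cauchy (fun k => proj2 (bu k)).
pose l := (l1, l2).
have nl : nr false l.
  rewrite /nr /near_eq /=.
  (* nearness is a closed condition: a perturbation by e changes nrm2 by at
     most (1 + 250) * 11/10 * e *)
  apply: (@eps_le _ _ _ 300) => e e_gt0.
  pose e' := Num.min e 1; have e'0 : 0 < e' by rewrite lt_min e_gt0 ltr01.
  have e'1 : e' <= 1 by rewrite ge_min lexx orbT.
  have e'e : e' <= e by rewrite ge_min lexx.
  have [k hk] := geom_small (2 * 10) e'0.
  have a1 := le_trans (hl1 k) hk; have a2 := le_trans (hl2 k) hk.
  have d0 : 0 <= eps / 500 by have := e0; lra.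
  have [h1 h2] := nrm2_bound d0 (nu k); have := nu k; rewrite /nr /near_eq => h3.
  set x1 := (u k).1 - _ in h3 h1; set x2 := (u k).2 - _ in h3 h2.
  have d20 : eps / 500 <= 1 / 20 by have := e1; lra.
  have d15 : eps / 500 / 15 <= 1 / 20 by have := e1; lra.
  have p1 := sqr_perturb e'1 (le_trans h1 d20) a1.
  have p2 := sqr_perturb e'1 (le_trans h2 d15) a2.
  have -> : l1 - w_eq false = x1 + (l1 - (u k).1) by rewrite /x1; ring.
  have -> : l2 - eta_eq false = x2 + (l2 - (u k).2) by rewrite /x2; ring.
  by move: h3; rewrite /nrm2 => h3; clear -h3 p1 p2 e'e e'0; lra.
have Pl : P l = l.
  have dk k : D (P l) (u k.+1) <= (170 / 2 ^+ k) ^+ 2.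
    have h0 : 0 <= 340 / 2 ^+ k :> R by rewrite divr_ge0 ?exprn_ge0 ?ler0n.
    have -> : 170 / 2 ^+ k = 340 / 2 ^+ k / 2 :> R by field; rewrite expf_neq0.
    apply: (cP _ _ _ nl (nu k) h0); apply: le_trans (nrm2_le (hl1 k) (hl2 k)) _.
    set z : R := (2 ^+ k)^-1; have := sqr_ge0 z; rewrite !exprMn; lra.
  have bk k : `|(P l).1 - (u k.+1).1| <= 170 / 2 ^+ k /\ `|(P l).2 - (u k.+1).2| <= 170 / 2 ^+ k.
    have h0 : 0 <= 170 / 2 ^+ k :> R by rewrite divr_ge0 ?exprn_ge0 ?ler0n.
    by have [h1 h2] := nrm2_bound h0 (dk k); split => //; apply: le_trans h2 _; lra.
  have half k : 2 * 10 / 2 ^+ k.+1 = 10 / 2 ^+ k :> R by rewrite exprS; field; rewrite expf_neq0.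
  have z0 k : 0 <= (2 ^+ k)^-1 :> R by rewrite invr_ge0 exprn_ge0.
  apply: injective_projections; apply/eqP; rewrite -subr_eq0; apply/eqP;
    apply: (@geom_small0 _ 180) => k; have [k1 k2] := bk k.
    have := hl1 k.+1; rewrite half -[l.1]/l1.
    by move: k1 (z0 k); rewrite !ler_norml => /andP[? ?] ? /andP[? ?]; apply/andP; split; lra.
  have := hl2 k.+1; rewrite half -[l.2]/l2.
  by move: k2 (z0 k); rewrite !ler_norml => /andP[? ?] ? /andP[? ?]; apply/andP; split; lra.
have [wa [na [xa [Ta [la a1 a2 a3]]]]] := hft l nl.
have [wb [nb [xb [Tb [lb b1 b2 b3]]]]] := hff _ (nft _ nl).
have wab : wa Ta = wb 0 by rewrite b1 a3.
have nab : na Ta = nb 0 by rewrite b2 a3.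
have wba : wb Tb = wa 0 by rewrite a1 -[in RHS]Pl /P b3.
have nba : nb Tb = na 0 by rewrite a2 -[in RHS]Pl /P b3.
have xE s a c c' : depth s a c = 0 -> depth (~~ s) a c' = 0 -> c = c'.
  by rewrite depthN /depth; case: (@sgm_cases R s) => -> ? ?; lra.
have [_ _ ga0 [_ gaT] _] := la; have [_ _ gb0 [_ gbT] _] := lb.
exists wa, na, xa, Ta, wb, nb, xb, Tb; split=> //.
  by split => //; apply: xE gaT _; rewrite nab; exact: gb0.
by split => //; apply: xE gbT _; rewrite nba; exact: ga0.
Qed.

End Cycle.

(** * States and the Filippov set *)

Section States.
Context {R : realType}.
Implicit Types (X Y v : 'rV[R]_3) (x y : R -> 'rV[R]_3) (t a b c : R).

Lemma mkstate_w a b c : st_w (mkstate a b c) = a.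
Proof. by rewrite /st_w /mkstate mxE inordK. Qed.
Lemma mkstate_eta a b c : st_eta (mkstate a b c) = b.
Proof. by rewrite /st_eta /mkstate mxE inordK. Qed.
Lemma mkstate_xi a b c : st_xi (mkstate a b c) = c.
Proof. by rewrite /st_xi /mkstate mxE inordK. Qed.
Definition mkstateE := (mkstate_w, mkstate_eta, mkstate_xi).

Lemma ord3_cases (i : 'I_3) : [\/ i = inord 0, i = inord 1 | i = inord 2].
Proof.
case: i => [[|[|[|//]]] hi]; [constructor 1 | constructor 2 | constructor 3];
  by apply: val_inj; rewrite /= inordK.
Qed.

Lemma state_ext X Y : st_w X = st_w Y -> st_eta X = st_eta Y -> st_xi X = st_xi Y -> X = Y.
Proof.
move=> h1 h2 h3; apply/rowP => i.
by case: (ord3_cases i) => ->; [exact: h1 | exact: h2 | exact: h3].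
Qed.

Lemma mkstate_eq X : mkstate (st_w X) (st_eta X) (st_xi X) = X.
Proof. by apply: state_ext; rewrite mkstateE. Qed.

Lemma state_norm X (M : R) : 0 <= M -> `|st_w X| <= M -> `|st_eta X| <= M -> `|st_xi X| <= M ->
  `|X| <= M.
Proof.
move=> M0 h1 h2 h3; rewrite [leLHS]/Num.Def.normr/= mx_normrE bigmax_le // => -[i j] _ /=.
by rewrite (ord1 i); case: (ord3_cases j) => ->; [exact: h1 | exact: h2 | exact: h3].
Qed.

Lemma norm_coord X (e : R) : `|X| < e -> [/\ `|st_w X| < e, `|st_eta X| < e & `|st_xi X| < e].
Proof.
have h i : `|X ord0 i| <= `|X|.
  rewrite [leRHS]/Num.Def.normr/= mx_normrE.
  by apply: le_trans; last exact: (le_bigmax _ _ (ord0, i)).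
by move=> he; split; apply: le_lt_trans he; exact: h.
Qed.

Lemma st_subw X Y : st_w (X - Y) = st_w X - st_w Y. Proof. by rewrite /st_w !mxE. Qed.
Lemma st_subeta X Y : st_eta (X - Y) = st_eta X - st_eta Y. Proof. by rewrite /st_eta !mxE. Qed.
Lemma st_subxi X Y : st_xi (X - Y) = st_xi X - st_xi Y. Proof. by rewrite /st_xi !mxE. Qed.
Definition st_subE := (st_subw, st_subeta, st_subxi).

Lemma st_w_cont : continuous (@st_w R). Proof. by move=> X; exact: coord_continuous. Qed.
Lemma st_eta_cont : continuous (@st_eta R). Proof. by move=> X; exact: coord_continuous. Qed.
Lemma st_xi_cont : continuous (@st_xi R). Proof. by move=> X; exact: coord_continuous. Qed.

Lemma mkstate_derive (w n z : R -> R) t dw dn dz :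
  is_derive t 1 w dw -> is_derive t 1 n dn -> is_derive t 1 z dz ->
  is_derive t 1 (fun t => mkstate (w t) (n t) (z t)) (mkstate dw dn dz).
Proof.
move=> hw hn hz.
have comp i j : is_derive t 1 (fun t => mkstate (w t) (n t) (z t) i j) (mkstate dw dn dz i j).
  rewrite (ord1 i) -[mkstate dw dn dz ord0 j]/(_ ord0 j).
  case: (ord3_cases j) => ->.
  - have -> : (fun t => mkstate (w t) (n t) (z t) ord0 (inord 0)) = w.
      by apply: funext => r; exact: mkstate_w.
    by have -> : mkstate dw dn dz ord0 (inord 0) = dw by exact: mkstate_w.
  - have -> : (fun t => mkstate (w t) (n t) (z t) ord0 (inord 1)) = n.
      by apply: funext => r; exact: mkstate_eta.
    by have -> : mkstate dw dn dz ord0 (inord 1) = dn by exact: mkstate_eta.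
  - have -> : (fun t => mkstate (w t) (n t) (z t) ord0 (inord 2)) = z.
      by apply: funext => r; exact: mkstate_xi.
    by have -> : mkstate dw dn dz ord0 (inord 2) = dz by exact: mkstate_xi.
have dM : derivable (fun t => mkstate (w t) (n t) (z t)) t 1.
  by apply/derivable_mxP => i j; have [] := comp i j.
split => //; rewrite derive_mx //; apply/matrixP => i j; rewrite mxE.
by have [_ ->] := comp i j.
Qed.

Lemma derive_coord x t i : derivable x t 1 ->
  is_derive t 1 (fun t => x t ord0 i) (('D_1 x t) ord0 i).
Proof.
move=> dx; split; first by have /derivable_mxP := dx; apply.
by rewrite derive_mx // mxE.
Qed.

Lemma derive_near x y t : (\forall s \near t, x s = y s) ->
  forall v, is_derive t 1 x v -> is_derive t 1 y v.
Proof.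
move=> h v [dx <-]; split.
  exact: near_eq_derivable dx.
by apply/esym/near_eq_derive.
Qed.

Variable eps : R.
Notation P := (param_values eps).

Definition side s X : R := depth s (st_eta X) (st_xi X).
Definition mode_field s X : 'rV[R]_3 := vfield P (Tc_of s) (beta s) X.

Lemma mode_field_w s X : st_w (mode_field s X) = Fnum (st_eta X) - st_w X.
Proof. by rewrite /mode_field /vfield mkstateE FE /=; ring. Qed.
Lemma mode_field_eta s X : st_eta (mode_field s X) = 1 / 10 * (st_w X - Gnum s (st_eta X)).
Proof. by rewrite /mode_field /vfield mkstateE GE /=; ring. Qed.
Lemma mode_field_xi s X : st_xi (mode_field s X) = eps * xidot s (st_eta X) (st_xi X).
Proof. by rewrite /mode_field /vfield mkstateE /=. Qed.
Definition mode_fieldE := (mode_field_w, mode_field_eta, mode_field_xi).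

Lemma gamma_val b : gamma P b = 16 / 10 * b - 6 / 10.
Proof. by rewrite /gamma /=; field. Qed.

Lemma sideN s X : side (~~ s) X = - side s X.
Proof. exact: depthN. Qed.

Lemma filippovP X v : filippov P X v -> domain X /\
  ((exists2 s, 0 < side s X & v = mode_field s X) \/
   (side true X = 0 /\ exists2 q, 0 <= q <= 1 & v = (1 - q) *: mode_field false X + q *: mode_field true X)).
Proof.
have sg1 : sgm true = 1 :> R by []. 
have sg2 : sgm false = -1 :> R by [].
case => [[[dX hX] ->]|[[dX hX] hq]|[[dX hX] ->]]; split => //; rewrite gamma_val in hX.
- by left; exists false => //; rewrite /side /depth sg2; lra.
- by right; split => //; rewrite /side /depth hX subrr mulr0.
- by left; exists true => //; rewrite /side /depth sg1; lra.
Qed.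

Lemma filippov_side s X v : filippov P X v -> 0 < side s X -> v = mode_field s X.
Proof.
move=> /filippovP[_ [[s' h' ->]|[h _]]] hs; last first.
  by case: s hs => hs; [rewrite h ltxx in hs | rewrite -[false]/(~~ true) sideN h oppr0 ltxx in hs].
have [-> //|ss] := eqVneq s' s.
have ss' : s' = ~~ s by case: s s' ss {h' hs} => [] [].
by exfalso; move: h'; rewrite ss' sideN; lra.
Qed.

Lemma filippov_intro s X : domain X -> 0 < side s X -> filippov P X (mode_field s X).
Proof.
move=> dX; rewrite /side /depth => h.
case: s h => h.
  apply: Or33; split => //; split => //; rewrite gamma_val.
  by move: h; have -> : sgm true = 1 :> R by []; lra.
apply: Or31; split => //; split => //; rewrite gamma_val.
by move: h; have -> : sgm false = -1 :> R by []; lra.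
Qed.

(** Symmetric in the two modes, so that [crossing] can treat both gates at
    once. *)
Lemma filippov_Sigma s X v : filippov P X v -> side s X = 0 ->
  exists2 q, 0 <= q <= 1 & v = (1 - q) *: mode_field (~~ s) X + q *: mode_field s X.
Proof.
move=> /filippovP[_ [[s' h' _]|[_ [q q01 ->]]]] h0.
  exfalso; have : side s' X = 0; last by lra.
  by case: (eqVneq s' s) => [->//|ss]; have -> : s' = ~~ s by [case: s s' ss {h' h0} => [] []]; rewrite sideN h0 oppr0.
case: s h0 => _; first by exists q.
exists (1 - q); first by move: q01 => /andP[? ?]; apply/andP; split; lra.
by rewrite subKr addrC.
Qed.

End States.

(** * Lipschitz estimates *)

Section Follow.
Context {R : realType}.
Variable eps : R.
Hypothesis sm : small_eps eps.
Implicit Types (X Y v : 'rV[R]_3) (x y : R -> 'rV[R]_3) (a b c : R) (s : bool).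
Implicit Types (I J : set R) (w n z : R -> R).
Let e0 : 0 < eps. Proof. by case: sm. Qed.
Let e1 : eps <= 1 / 100. Proof. by case: sm. Qed.
Notation P := (param_values eps).
Notation mu := (@lebesgue_measure R).

Lemma traj_lip s w n z r t : traj eps s w n z -> 0 <= r -> r <= t ->
  [/\ `|w t - w r| <= 20 * (t - r), `|n t - n r| <= 20 * (t - r) & `|z t - z r| <= 20 * (t - r)].
Proof.
move=> [hp hx] r0 rt.
have key q : r <= q -> [/\ `|Fnum (n q) - w q| <= 20, `|1 / 10 * (w q - Gnum s (n q))| <= 20 &
    `|eps * xidot s (n q) (z q)| <= 20].
  move=> rq; have q0 := le_trans r0 rq.
  have [_ _ [w1 w2 n1 n2]] := hp q q0; have [_ /andP[z1 z2]] := hx q q0.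
  have [m1 m2] := @eta_eq_box R s; have [v1 v2] := @w_eq_range R s.
  have m1' : 7 / 10 <= eta_eq s :> R by lra.
  have m2' : eta_eq s <= 97 / 100 :> R by lra.
  have [f1 f2] := Fslope_bound n1 n2 m1' m2'; have [g1 g2] := Gslope_bound n1 n2 m1' m2'.
  have dn : `|n q - eta_eq s| <= 27 / 100 by rewrite ler_norml; apply/andP; split; lra.
  have hF : `|Fnum (n q) - Fnum (eta_eq s)| <= 296 / 10 * (27 / 100).
    by rewrite Fnum_sub normrM; apply: ler_pM => //; rewrite ger0_norm //; lra.
  have hG : `|Gnum s (n q) - Gnum s (eta_eq s)| <= 517 / 10 * (27 / 100).
    by rewrite Gnum_sub normrM; apply: ler_pM => //; rewrite ger0_norm //; lra.
  have eF : Fnum (eta_eq s) = w_eq s :> R by [].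
  have eG := @w_eq_G R s.
  move: hF hG; rewrite eF -eG !ler_norml => /andP[F1 F2] /andP[G1 G2].
  have hx' := xidot_bound s n1 n2 z1 z2.
  have E1 := e1; have E0 := e0.
  clear -F1 F2 G1 G2 w1 w2 v1 v2 hx' E1 E0.
  split; try by apply/andP; split; lra.
  by move: hx'; rewrite ler_norml => /andP[? ?]; apply/andP; split; nra.
split.
- apply: (@lip_increment _ w (fun r => Fnum (n r) - w r)) => // q /andP[rq _].
    by have [] := hp q (le_trans r0 rq).
  by have [] := key q rq.
- apply: (@lip_increment _ n (fun r => 1 / 10 * (w r - Gnum s (n r)))) => // q /andP[rq _].
    by have [] := hp q (le_trans r0 rq).
  by have [] := key q rq.
- apply: (@lip_increment _ z (fun r => eps * xidot s (n r) (z r))) => // q /andP[rq _].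
    by have [] := hx q (le_trans r0 rq).
  by have [] := key q rq.
Qed.

(** The one-sided Lipschitz bound behind uniqueness.  It is stated for eta in
    [0, 1] since an arbitrary solution is not known to stay in the box. *)
Lemma mode_lipschitz s a1 b1 c1 a2 b2 c2 :
  0 <= b1 <= 1 -> 0 <= b2 <= 1 ->
  2 * (a1 - a2) * (Fnum b1 - a1 - (Fnum b2 - a2)) +
  2 * (b1 - b2) * (1 / 10 * (a1 - Gnum s b1) - 1 / 10 * (a2 - Gnum s b2)) +
  2 * (c1 - c2) * (eps * xidot s b1 c1 - eps * xidot s b2 c2)
  <= 100 * ((a1 - a2) ^+ 2 + (b1 - b2) ^+ 2 + (c1 - c2) ^+ 2).
Proof.
move=> /andP[p1 p2] /andP[q1 q2].
have f1 : 0 <= Fslope b1 b2.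
  rewrite /Fslope; apply: mulr_ge0; first by lra.
  have : b1 ^+ 2 + b1 * b2 + b2 ^+ 2 <= 3 by nra.
  lra.
have f2 : Fslope b1 b2 <= 42.
  rewrite /Fslope; have : 0 <= b1 ^+ 2 + b1 * b2 + b2 ^+ 2 by nra.
  lra.
have g1 : 0 <= Gslope b1 b2 by rewrite /Gslope; lra.
have eF := Fnum_sub b1 b2; have eG := Gnum_sub s b1 b2.
have -> : Fnum b1 - a1 - (Fnum b2 - a2) = Fslope b1 b2 * (b1 - b2) - (a1 - a2) by lra.
have -> : 1 / 10 * (a1 - Gnum s b1) - 1 / 10 * (a2 - Gnum s b2) =
  1 / 10 * ((a1 - a2) - Gslope b1 b2 * (b1 - b2)) by lra.
rewrite -mulrBr xidot_sub.
set u := a1 - a2; set v := b1 - b2; set y := c1 - c2; set f := Fslope b1 b2 in f1 f2 *; set g := Gslope b1 b2 in g1 *.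
have E0 := e0; have E1 := e1.
have k0 : 0 <= beta s + 105 / 100 :> R /\ beta s + 105 / 100 <= 7 :> R /\ 0 <= beta s :> R.
  by case: (@beta_cases R s) => ->; do ?split; lra.
clear -f1 f2 g1 E0 E1 k0; move: k0 => [k1 [k2 k3]].
have h1 : 0 <= (42 - f) * (u ^+ 2 + v ^+ 2) by apply: mulr_ge0; [lra | nra].
have h2 : 0 <= f * (u - v) ^+ 2 by apply: mulr_ge0 => //; exact: sqr_ge0.
have h3 : 0 <= g * v ^+ 2 by apply: mulr_ge0 => //; exact: sqr_ge0.
have h4 : 0 <= (u - v) ^+ 2 by exact: sqr_ge0.
set k := beta s in k1 k2 k3 *.
have ek : 0 <= eps * (k + 105 / 100) by apply: mulr_ge0; lra.
have ek2 : eps * (k + 105 / 100) <= 7 by nra.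
have h5 : 0 <= eps * (k + 105 / 100) * (y - v) ^+ 2 by apply: mulr_ge0 => //; exact: sqr_ge0.
have h6 : 0 <= (7 - eps * (k + 105 / 100)) * (y ^+ 2 + v ^+ 2) by apply: mulr_ge0; [lra | nra].
have h7 : 0 <= eps * k * y ^+ 2 by apply: mulr_ge0; [apply: mulr_ge0; lra | exact: sqr_ge0].
have h8 := sqr_ge0 u; have h9 := sqr_ge0 v; have h10 := sqr_ge0 y.
lra.
Qed.

End Follow.

(** * Uniqueness and crossing for Filippov solutions *)

Section Reach.
Context {R : realType}.
Variable eps : R.
Hypothesis sm : small_eps eps.
Implicit Types (X Y v : 'rV[R]_3) (x y : R -> 'rV[R]_3) (a b c : R) (s : bool).
Implicit Types (I J : set R) (w n z : R -> R).
Let e0 : 0 < eps. Proof. by case: sm. Qed.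
Let e1 : eps <= 1 / 100. Proof. by case: sm. Qed.
Notation P := (param_values eps).
Notation mu := (@lebesgue_measure R).

(** Where the depth is positive the inclusion is the differential equation of
    mode s, and the squared distance between the two solutions satisfies a
    Gronwall inequality almost everywhere. *)
Lemma follow_side s I x w n z c t0 t1 : solution P I x -> traj eps s w n z ->
  t0 <= t1 -> `[t0, t1] `<=` I -> c <= t0 ->
  x t0 = mkstate (w (t0 - c)) (n (t0 - c)) (z (t0 - c)) ->
  (forall t, t0 < t < t1 -> 0 < side s (x t)) ->
  x t1 = mkstate (w (t1 - c)) (n (t1 - c)) (z (t1 - c)).
Proof.
move=> [xdom xac xae] htr t01 tI ct0 x0 hs.
pose u t := st_w (x t) + - w (t - c).
pose v t := st_eta (x t) + - n (t - c).
pose y t := st_xi (x t) + - z (t - c).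
have lip (f : R -> R) : (forall r t, 0 <= r -> r <= t -> `|f t - f r| <= 20 * (t - r)) ->
    abs_continuous t0 t1 (fun t => - f (t - c)).
  move=> hf; apply: ac_opp; apply: (@lip_ac _ _ _ _ _ 20) => r t r0 rt tt.
  have -> : t - r = (t - c) - (r - c) by ring.
  by apply: hf; lra.
have acx := xac t0 t1 t01 tI.
have acu : abs_continuous t0 t1 u.
  apply: ac_add; first exact: ac_coord.
  by apply: lip => r t r0 rt; have [] := traj_lip sm htr r0 rt.
have acv : abs_continuous t0 t1 v.
  apply: ac_add; first exact: ac_coord.
  by apply: lip => r t r0 rt; have [] := traj_lip sm htr r0 rt.
have acy : abs_continuous t0 t1 y.
  apply: ac_add; first exact: ac_coord.
  by apply: lip => r t r0 rt; have [] := traj_lip sm htr r0 rt.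
pose f t := - (u t * u t + v t * v t + y t * y t).
have acf : abs_continuous t0 t1 f.
  by apply: ac_opp; apply: ac_add; [apply: ac_add|]; apply: ac_mul.
have f0 : 0 <= f t0.
  by rewrite /f /u /v /y x0 !mkstateE !subrr !mulr0 !addr0 oppr0.
have ft1 : 0 <= f t1.
  apply: (ac_gronwall (M := - 100) t01 acf) f0.
  have := ae_and (ae_and xae (ae_neq t0)) (ae_neq t1).
  apply: ae_mono => t [[hx tt0] tt1] /andP[t0t tt].
  have t0t' : t0 < t by rewrite lt_neqAle t0t andbT; apply/eqP => h; apply: tt0.
  have tt' : t < t1 by rewrite lt_neqAle tt andbT; apply/eqP.
  have [dx fx] := hx (tI t ltac:(by rewrite /= in_itv /= t0t)).
  have hst : 0 < side s (x t) by apply: hs; rewrite t0t'.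
  have ev := filippov_side fx hst; have [dX _] := filippovP fx.
  have dw : is_derive t 1 (fun t => st_w (x t)) (Fnum (st_eta (x t)) - st_w (x t)).
    by rewrite -(mode_field_w eps s) -ev; exact: derive_coord.
  have dn : is_derive t 1 (fun t => st_eta (x t)) (1 / 10 * (st_w (x t) - Gnum s (st_eta (x t)))).
    by rewrite -(mode_field_eta eps s) -ev; exact: derive_coord.
  have dz : is_derive t 1 (fun t => st_xi (x t)) (eps * xidot s (st_eta (x t)) (st_xi (x t))).
    by rewrite -(mode_field_xi eps s) -ev; exact: derive_coord.
  have tc : 0 <= t - c by lra.
  have [hp hxz] := htr; have [dw' dn' [_ _ n1 n2]] := hp _ tc; have [dz' _] := hxz _ tc.
  have {}dw' := is_derive_subr dw'; have {}dn' := is_derive_subr dn'; have {}dz' := is_derive_subr dz'.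
  set W := st_w (x t) in dw dn dz *; set N := st_eta (x t) in dw dn dz *; set Z := st_xi (x t) in dw dn dz *.
  exists (- (2 * (W - w (t - c)) * (Fnum N - W - (Fnum (n (t - c)) - w (t - c))) +
    2 * (N - n (t - c)) * (1 / 10 * (W - Gnum s N) - 1 / 10 * (w (t - c) - Gnum s (n (t - c)))) +
    2 * (Z - z (t - c)) * (eps * xidot s N Z - eps * xidot s (n (t - c)) (z (t - c))))).
    rewrite /f /u /v /y; apply: is_derive_eq; rewrite /GRing.scale /= -/W -/N -/Z; ring.
  have := @mode_lipschitz _ eps sm s W N Z (w (t - c)) (n (t - c)) (z (t - c)).
  have [/andP[N0 N1] _] := dX.
  move=> /(_ _ _) h; have {}h := h ltac:(by rewrite N0 N1) ltac:(by apply/andP; split; lra).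
  rewrite opprK /f /u /v /y -/W -/N -/Z; rewrite -lerN2 opprK.
  apply: le_trans h _; rewrite le_eqVlt; apply/orP; left; apply/eqP; ring.
have u2 t := sqr_ge0 (u t); have v2 t := sqr_ge0 (v t); have y2 t := sqr_ge0 (y t).
have : u t1 ^+ 2 = 0 /\ v t1 ^+ 2 = 0 /\ y t1 ^+ 2 = 0.
  by have := u2 t1; have := v2 t1; have := y2 t1; move: ft1; rewrite /f; lra.
move=> [/eqP + [/eqP + /eqP]]; rewrite !sqrf_eq0 /u /v /y !subr_eq0 => /eqP a1 /eqP a2 /eqP a3.
by apply: state_ext; rewrite mkstateE.
Qed.

Lemma sol_cont I x t0 t1 : solution P I x -> t0 <= t1 -> `[t0, t1] `<=` I ->
  forall e, 0 < e -> exists2 d, 0 < d & forall s t : R, t0 <= s <= t1 -> t0 <= t <= t1 ->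
    `|s - t| < d -> `|x s - x t| < e.
Proof. by move=> [_ xac _] t01 tI; apply: ac_continuous; exact: xac. Qed.

(** Near such a point of Sigma all admissible velocities increase the depth:
    mode s by [depth_rate_fast], the other mode by [depth_rate_slow] where it is
    admissible, and so do their convex combinations.  Hence there is no sliding
    and no branching. *)
Lemma crossing s I x t0 t1 : solution P I x -> t0 < t1 -> `[t0, t1] `<=` I ->
  side s (x t0) = 0 -> near_eq eps (~~ s) (st_w (x t0)) (st_eta (x t0)) ->
  exists2 r, 0 < r & forall t, t0 < t <= t1 -> t < t0 + r -> 0 < side s (x t).
Proof.
move=> sol t01 tI s0 hN; have [xdom xac xae] := sol.
(* a perturbation of size d in both fast variables changes the bound
   (eps/500)^2 by a factor of at most 4 *)
pose d := eps / (8 * 1000).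
have d0 : 0 < d by apply: divr_gt0; [exact: e0 | lra].
have [r r0 hr] := sol_cont sol (ltW t01) tI d0.
exists r => // t /andP[t0t tt] tr.
have near r' : t0 <= r' <= t -> nrm2 (st_w (x r') - w_eq (~~ s)) (st_eta (x r') - eta_eq (~~ s)) <= (eps / 250) ^+ 2.
  move=> /andP[h1 h2].
  have : `|x r' - x t0| < d.
    apply: hr; rewrite ?h1 ?lexx ?(le_trans h2) ?(ltW t01) //.
    by rewrite ger0_norm ?subr_ge0 //; lra.
  move=> /norm_coord[]; rewrite !st_subE => k1 k2 _.
  have := hN; rewrite /near_eq.
  set a := st_w (x t0) - _; set b := st_eta (x t0) - _.
  set u := st_w (x r') - st_w (x t0) in k1; set v := st_eta (x r') - st_eta (x t0) in k2.
  have -> : st_w (x r') - w_eq (~~ s) = a + u by rewrite /a /u; ring.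
  have -> : st_eta (x r') - eta_eq (~~ s) = b + v by rewrite /b /v; ring.
  have : u ^+ 2 <= d ^+ 2 by rewrite -[leLHS]real_normK ?num_real //; apply: sqr_mono => //; exact: ltW.
  have : v ^+ 2 <= d ^+ 2 by rewrite -[leLHS]real_normK ?num_real //; apply: sqr_mono => //; exact: ltW.
  have := sqr_ge0 (a - u); have := sqr_ge0 (b - v); have := sqr_ge0 eps.
  by rewrite /nrm2 /d; clear; nra.
have slope : eps / 1000 * (t - t0) <= side s (x t) - side s (x t0).
  apply: (ac_increment_ge (f := fun t => side s (x t))); first exact: ltW.
    have acx : abs_continuous t0 t x.
      by apply: xac; [exact: ltW | move=> q /=; rewrite in_itv /= => /andP[q1 q2]; apply: tI; rewrite /= in_itv /= q1 (le_trans q2)].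
    have acc (k : R) : abs_continuous t0 t (fun=> k).
      by apply: (@lip_ac _ _ _ _ _ 0) => ? ? _ _ _; rewrite subrr normr0 mul0r.
    rewrite /side /depth; apply: ac_mul; [exact: ltW | exact: acc |].
    apply: ac_add; last by apply: ac_opp; exact: ac_coord.
    apply: ac_add; last exact: acc.
    apply: ac_mul; [exact: ltW | exact: acc | exact: ac_coord].
  apply: ae_mono xae => q hq /andP[q1 q2].
  have [|dq Fslope] := hq; first by apply: tI; rewrite /= in_itv /= q1 (le_trans q2).
  have nq := near q ltac:(by rewrite q1).
  have bq := near_box sm nq.
  have [dom _] := filippovP Fslope; have [_ xq] := dom.
  have fast : 1 / 5 <= depth_rate eps s (st_w (x q)) (st_eta (x q)) (st_xi (x q)).
    apply: depth_rate_fast => //.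
    have E0 := e0; have E1 := e1; have h0 : 0 <= eps / 250 by lra.
    have [_] := nrm2_bound h0 nq; rewrite ler_norml => /andP[k1 k2].
    by clear -k1 k2 E0 E1; case: (@sgm_cases R s) => ->; lra.
  have slow : side s (x q) <= 0 -> eps / 1000 <= - depth_rate eps (~~ s) (st_w (x q)) (st_eta (x q)) (st_xi (x q)).
    move=> hs; rewrite lerNr; apply: depth_rate_slow => //.
    by rewrite -/(side (~~ s) (x q)) sideN oppr_ge0.
  pose v := 'D_1 x q.
  have ds : is_derive q 1 (fun t => side s (x t)) (sgm s * (16 / 10 * st_eta v - st_xi v)).
    have d1 : is_derive q 1 (fun t => st_eta (x t)) (st_eta v) by exact: derive_coord.
    have d2 : is_derive q 1 (fun t => st_xi (x t)) (st_xi v) by exact: derive_coord.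
    by rewrite /side /depth; apply: is_derive_eq; rewrite /GRing.scale /=; ring.
  exists (sgm s * (16 / 10 * st_eta v - st_xi v)) => //.
  have gE s' X : sgm s' * (16 / 10 * st_eta (mode_field eps s' X) - st_xi (mode_field eps s' X)) = depth_rate eps s' (st_w X) (st_eta X) (st_xi X).
    by rewrite !mode_fieldE /depth_rate.
  have gE' X : sgm s * (16 / 10 * st_eta (mode_field eps (~~ s) X) - st_xi (mode_field eps (~~ s) X)) = - depth_rate eps (~~ s) (st_w X) (st_eta X) (st_xi X).
    by rewrite -gE sgmN mulNr opprK.
  have E1 := e1.
  have [hs|hs|hs] := ltgtP (side s (x q)) 0.
  - have -> : v = mode_field eps (~~ s) (x q) by apply: filippov_side => //; rewrite sideN oppr_gt0.
    by rewrite gE'; apply: slow; exact: ltW.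
  - by rewrite /v (filippov_side Fslope hs) gE; lra.
  have [k /andP[k0 k1] ev] := filippov_Sigma Fslope hs; rewrite /v ev.
  have lin (f : 'rV[R]_3 -> R) X Y : (forall a b X Y, f (a *: X + b *: Y) = a * f X + b * f Y) ->
    f ((1 - k) *: X + k *: Y) = (1 - k) * f X + k * f Y by move=> ->.
  have -> : sgm s * (16 / 10 * st_eta ((1 - k) *: mode_field eps (~~ s) (x q) + k *: mode_field eps s (x q)) -
      st_xi ((1 - k) *: mode_field eps (~~ s) (x q) + k *: mode_field eps s (x q))) =
    (1 - k) * - depth_rate eps (~~ s) (st_w (x q)) (st_eta (x q)) (st_xi (x q)) +
    k * depth_rate eps s (st_w (x q)) (st_eta (x q)) (st_xi (x q)).
    rewrite -gE' -gE (lin (@st_eta R)) ?(lin (@st_xi R)); first ring.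
      by move=> a b X Y; rewrite /st_xi !mxE.
    by move=> a b X Y; rewrite /st_eta !mxE.
  have {}slow := slow ltac:(by rewrite hs lexx).
  have h1 : (1 - k) * (eps / 1000) <= (1 - k) * - depth_rate eps (~~ s) (st_w (x q)) (st_eta (x q)) (st_xi (x q)).
    by apply: ler_wpM2l slow; lra.
  have h2 : k * (eps / 1000) <= k * depth_rate eps s (st_w (x q)) (st_eta (x q)) (st_xi (x q)).
    by apply: ler_wpM2l => //; lra.
  lra.
rewrite s0 subr0 in slope; apply: lt_le_trans slope.
by apply: mulr_gt0; [apply: divr_gt0; [exact: e0 | lra] | rewrite subr_gt0].
Qed.

End Reach.

(** * Maximal solutions follow runs *)

Section Runs.
Context {R : realType}.
Variable eps : R.
Hypothesis sm : small_eps eps.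
Implicit Types (X Y v : 'rV[R]_3) (x y : R -> 'rV[R]_3) (a b c : R) (s : bool).
Implicit Types (I J : set R) (w n z : R -> R) (t : R).
Let e0 : 0 < eps. Proof. by case: sm. Qed.
Let e1 : eps <= 1 / 100. Proof. by case: sm. Qed.
Notation P := (param_values eps).
Notation mu := (@lebesgue_measure R).

Definition curve w n z (t : R) : 'rV[R]_3 := mkstate (w t) (n t) (z t).

Lemma side_curve s w n z (t : R) : side s (curve w n z t) = depth s (n t) (z t).
Proof. by rewrite /side /curve !mkstateE. Qed.

Lemma curve_domain s w n z (t : R) : traj eps s w n z -> 0 <= t -> domain (curve w n z t).
Proof.
move=> [hp hx] t0; have [_ _ [_ _ n1 n2]] := hp t t0; have [_ hz] := hx t t0.
split; rewrite /curve !mkstateE //.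
by clear -n1 n2; apply/andP; split; lra.
Qed.

Lemma is_derive_curve_subr s w n z (t c : R) : traj eps s w n z -> 0 <= t - c ->
  is_derive t 1 (fun q => curve w n z (q - c)) (mode_field eps s (curve w n z (t - c))).
Proof.
move=> [hp hxz] tc; have [dw' dn' _] := hp _ tc; have [dz' _] := hxz _ tc.
have {}dw' := is_derive_subr dw'; have {}dn' := is_derive_subr dn'; have {}dz' := is_derive_subr dz'.
have := mkstate_derive dw' dn' dz'.
have -> : mkstate (Fnum (n (t - c)) - w (t - c)) (1 / 10 * (w (t - c) - Gnum s (n (t - c))))
  (eps * xidot s (n (t - c)) (z (t - c))) = mode_field eps s (curve w n z (t - c)).
  by apply: state_ext; rewrite mode_fieldE /curve !mkstateE.
by [].
Qed.

Lemma curve_lip s w n z (r t : R) : traj eps s w n z -> 0 <= r -> r <= t ->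
  `|curve w n z t - curve w n z r| <= 20 * (t - r).
Proof.
move=> h r0 rt; have [h1 h2 h3] := traj_lip sm h r0 rt.
apply: state_norm; rewrite ?st_subE /curve ?mkstateE //.
by apply: mulr_ge0; [exact: ler0n | rewrite subr_ge0].
Qed.

Lemma side_lip s X Y : `|side s X - side s Y| <= 3 * `|X - Y|.
Proof.
have [_ h2 h3] : [/\ `|st_w (X - Y)| <= `|X - Y|, `|st_eta (X - Y)| <= `|X - Y| & `|st_xi (X - Y)| <= `|X - Y|].
  have h i : `|(X - Y) ord0 i| <= `|X - Y|.
    rewrite [leRHS]/Num.Def.normr/= mx_normrE.
    by apply: le_trans; last exact: (le_bigmax _ _ (ord0, i)).
  by split; exact: h.
move: h2 h3; rewrite !st_subE /side /depth; move: `|X - Y| => D.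
rewrite !ler_norml => /andP[? ?] /andP[? ?].
by case: (@sgm_cases R s) => ->; apply/andP; split; lra.
Qed.

(** A stretch of mode s from inside its region, or from Sigma near the
    equilibrium of the other mode, up to a time not beyond the next hit. *)
Definition run s w n z (T : R) : Prop :=
  [/\ traj eps s w n z, 0 < T, (forall t, 0 < t < T -> 0 < depth s (n t) (z t)) &
     0 < depth s (n 0) (z 0) \/ depth s (n 0) (z 0) = 0 /\ near_eq eps (~~ s) (w 0) (n 0)].

Lemma itv_sub I (t0 t1 : R) : is_interval I -> I t0 -> I t1 -> `[t0, t1] `<=` I.
Proof. by move=> hI h0 h1 t; rewrite /= in_itv /=; exact: hI. Qed.

(** Real induction on the property that agreement of x and the run at one time
    implies agreement at the next.  Where the two differ, it holds vacuously by
    continuity; where they agree inside the region, by [follow_side]; at the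
    start on Sigma, by [crossing]. *)
Lemma follow_lt s I x w n z (T t0 t1 : R) : solution P I x -> is_interval I -> run s w n z T ->
  I t0 -> x t0 = curve w n z 0 -> I t1 -> t0 <= t1 -> t1 < t0 + T ->
  x t1 = curve w n z (t1 - t0).
Proof.
move=> sol hI [htr T_pos pos start] I0 x0 I1; rewrite le_eqVlt => /orP[/eqP <-|t01 t1T].
  by rewrite subrr.
have tI := itv_sub hI I0 I1.
have sub a b : t0 <= a -> b <= t1 -> `[a, b] `<=` I.
  move=> ta bt q; rewrite /= in_itv /= => /andP[q1 q2].
  by apply: tI; rewrite /= in_itv /= (le_trans ta) // (le_trans q2).
suff : x t0 = curve w n z (t0 - t0) -> x t1 = curve w n z (t1 - t0) by apply; rewrite subrr.
apply: (interval_chain (P := fun a b => x a = curve w n z (a - t0) -> x b = curve w n z (b - t0)) (ltW t01)).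
  by move=> a b c _ _ _ _ h1 h2 /h1 /h2.
move=> c /andP[c0 c1].
have [xc|xc] := pselect (x c = curve w n z (c - t0)); last first.
  pose d := `|x c - curve w n z (c - t0)|.
  have d0 : 0 < d by rewrite normr_gt0 subr_eq0; apply/eqP.
  have [r r0 hr] := sol_cont sol (ltW t01) tI (divr_gt0 d0 (ltr0n _ 2)).
  exists (Num.min r (d / 50)); first by rewrite lt_min r0 divr_gt0 // ltr0n.
  split => [a ta ca ac xa|b _ _ _ xc']; last by [].
  exfalso.
  have h1 : `|x a - x c| < d / 2.
    apply: hr; rewrite ?ta ?c0 ?c1 ?(le_trans ac) //.
    rewrite ler0_norm ?subr_le0 // opprB ltrBlDl -ltrBlDr; apply: le_lt_trans ca.
    by rewrite lerD2l lerN2 ge_min lexx.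
  have h2 : `|curve w n z (c - t0) - curve w n z (a - t0)| <= 20 * (c - a).
    have -> : c - a = (c - t0) - (a - t0) by ring.
    by apply: curve_lip htr _ _; lra.
  have h3 : c - a < d / 50.
    rewrite ltrBlDl -ltrBlDr; apply: le_lt_trans ca.
    by rewrite lerD2l lerN2 ge_min lexx orbT.
  have : d <= `|x a - x c| + `|curve w n z (c - t0) - curve w n z (a - t0)|.
    rewrite /d -xa; have -> : x c - curve w n z (c - t0) = - (x a - x c) - (curve w n z (c - t0) - x a).
      by rewrite opprB opprB addrA subrK.
    by apply: le_trans (ler_normB _ _) _; rewrite normrN.
  lra.
have [hs|hs] := ltP 0 (side s (x c)).
  have [r r0 hr] := sol_cont sol (ltW t01) tI (divr_gt0 hs (ltr0n _ 4)).
  have pos' q : t0 <= q <= t1 -> `|q - c| < r -> 0 < side s (x q).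
    move=> qt qc; have := hr q c qt; rewrite c0 c1 => /(_ isT qc) h.
    by have := side_lip s (x q) (x c); rewrite ler_norml => /andP[]; lra.
  exists r => //; split => [a ta ca ac xa|b tb cb bc _].
    apply: (follow_side sm sol htr ac (sub _ _ ta c1) ta xa) => q /andP[q1 q2].
    apply: pos'; first by apply/andP; split; lra.
    by rewrite ltr0_norm; lra.
  apply: (follow_side sm sol htr cb (sub _ _ c0 tb) c0 xc) => q /andP[q1 q2].
  apply: pos'; first by apply/andP; split; lra.
  by rewrite gtr0_norm; lra.
have ct0 : c = t0.
  apply/eqP; rewrite eq_le c0 andbT leNgt; apply/negP => tc.
  move: hs; rewrite xc side_curve leNgt; apply/negP; rewrite negbK.
  by apply: pos; apply/andP; split; lra.
case: start => [st|[st nst]].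
  by exfalso; move: hs; rewrite ct0 x0 side_curve leNgt st.
have [||r r0 hr] := @crossing _ eps sm s I x t0 t1 sol t01 tI.
- by rewrite x0 side_curve.
- by rewrite x0 /curve !mkstateE.
exists r => //; rewrite ct0; split => [a ta _ _ _|b bt tb br xt].
  by rewrite subrr.
apply: (follow_side sm sol htr tb (sub _ _ (lexx _) bt) (lexx _) xt) => q /andP[q1 q2].
by apply: hr; [rewrite q1 (le_trans (ltW q2)) | lra].
Qed.

Lemma follow s I x w n z (T t0 t1 : R) : solution P I x -> is_interval I -> run s w n z T ->
  I t0 -> x t0 = curve w n z 0 -> I t1 -> t0 <= t1 -> t1 <= t0 + T ->
  x t1 = curve w n z (t1 - t0).
Proof.
move=> sol hI hr I0 x0 I1 t01; rewrite le_eqVlt => /orP[/eqP e|]; last first.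
  exact: follow_lt sol hI hr I0 x0 I1 t01.
have [htr T_pos _ _] := hr; have tI := itv_sub hI I0 I1.
(* 1 for the variation of x and 20 for that of the run *)
apply/eqP; rewrite -subr_eq0 -normr_le0; apply: (@eps_le _ _ _ 21) => d d0.
have [r r0 hcont] := sol_cont sol t01 tI d0.
pose q := Num.max t0 (t1 - Num.min (r / 2) d).
have m0 : 0 < Num.min (r / 2) d by rewrite lt_min d0 divr_gt0 // ltr0n.
have m1 : Num.min (r / 2) d <= r / 2 by rewrite ge_min lexx.
have m2 : Num.min (r / 2) d <= d by rewrite ge_min lexx orbT.
have [q1 q2] : t0 <= q /\ t1 - Num.min (r / 2) d <= q by rewrite /q !le_max !lexx orbT.
have q3 : q < t1 by rewrite /q gt_max; apply/andP; split; lra.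
have Iq : I q by apply: tI; rewrite /= in_itv /= q1 ltW.
have xq : x q = curve w n z (q - t0) by apply: follow_lt sol hI hr I0 x0 Iq q1 _; rewrite -e.
have h1 : `|x t1 - x q| < d.
  by apply: hcont; rewrite ?t01 ?lexx ?q1 ?ltW // gtr0_norm; lra.
have h2 : `|curve w n z (t1 - t0) - curve w n z (q - t0)| <= 20 * (t1 - q).
  have -> : t1 - q = (t1 - t0) - (q - t0) by ring.
  by apply: curve_lip htr _ _; lra.
have : `|x t1 - curve w n z (t1 - t0)| <= `|x t1 - x q| + `|curve w n z (t1 - t0) - curve w n z (q - t0)|.
  have -> : x t1 - curve w n z (t1 - t0) = (x t1 - x q) - (curve w n z (t1 - t0) - x q).
    by rewrite opprB addrA subrK.
  by rewrite -xq; exact: ler_normB.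
lra.
Qed.

(** Otherwise the interval of definition would end before the run does, and
    continuing x by the run would be a proper extension. *)
Lemma reach s I x w n z (T t0 : R) : maximal_forward_solution P I x -> run s w n z T ->
  I t0 -> x t0 = curve w n z 0 ->
  I (t0 + T) /\ forall t, t0 <= t <= t0 + T -> I t /\ x t = curve w n z (t - t0).
Proof.
move=> [[hI I0 Ipos] sol hmax] hr It0 x0; have [htr T_pos pos _] := hr.
have t00 : 0 <= t0 by have := Ipos _ It0; rewrite /= in_itv /= andbT.
suff IT : I (t0 + T).
  split => // t /andP[h1 h2]; have It : I t by apply: (hI _ _ It0 IT); rewrite h1.
  by split => //; exact: follow sol hI hr It0 x0 It h1 h2.
apply: contrapT => nIT.
have Ilt t : I t -> t < t0 + T.
  move=> It; rewrite ltNge; apply/negP => h; apply: nIT.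
  by apply: (hI _ _ It0 It); rewrite lerDl ltW.
pose J : set R := `[0, t0 + T]%classic.
pose y t := if t < t0 then x t else curve w n z (t - t0).
have yx t : t <= t0 -> y t = x t.
  rewrite /y le_eqVlt => /orP[/eqP ->|->//]; by rewrite ltxx subrr.
have yp t : t0 <= t -> y t = curve w n z (t - t0) by rewrite /y ltNge => ->.
have [xdom xac xae] := sol.
have I0t : `[0, t0] `<=` I by exact: itv_sub.
have acy : abs_continuous 0 (t0 + T) y.
  apply: (@ac_concat _ _ _ _ _ t0) => //; first by rewrite lerDl ltW.
    have := xac 0 t0 t00 I0t => ac e e_gt0; have [d d0 hd] := ac e e_gt0; exists d => // k u v huv tr hsum.
    apply: le_lt_trans (hd k u v huv tr hsum); apply: ler_sum => i _; have [h1 h2 h3] := huv i.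
    by rewrite !yx // (le_trans h2).
  apply: (@lip_ac _ _ _ _ _ 20) => q t q0 qt _; rewrite !yp ?(le_trans q0) //.
  have -> : t - q = (t - t0) - (q - t0) by ring.
  by apply: curve_lip htr _ _; lra.
have soly : solution P J y.
  split.
  - move=> t; rewrite /J /= in_itv /= => /andP[h1 h2]; have [tt|tt] := leP t t0.
      by rewrite yx //; apply: xdom; apply: I0t; rewrite /= in_itv /= h1.
    by rewrite yp; [apply: curve_domain htr _; rewrite subr_ge0 ltW | exact: ltW].
  - move=> a b ab abJ.
    have [a0 _] : J a /\ J b by split; apply: abJ; rewrite /= in_itv /= ab lexx.
    have [_ b0] : J a /\ J b by split; apply: abJ; rewrite /= in_itv /= ab lexx.
    move: a0 b0; rewrite /J /= !in_itv /= => /andP[a0 _] /andP[_ b0].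
    exact: ac_sub a0 b0 acy.
  - have := ae_and (ae_and xae (ae_neq t0)) (ae_neq (t0 + T)).
    apply: ae_mono => t [[hx tt0] tt1]; rewrite /J /= in_itv /= => /andP[h1 h2].
    have [tt|tt] := ltP t t0.
      have It : I t by apply: I0t; rewrite /= in_itv /= h1 ltW.
      have [dx fx] := hx It.
      have nb : \forall q \near t, x q = y q.
        near=> q; rewrite yx //; apply: ltW; near: q; exact: lt_nbhsl.
      have [dy ey] := derive_near nb (DeriveDef dx erefl).
      by split => //; rewrite ey yx // ltW.
    have tt' : t0 < t by rewrite lt_neqAle tt andbT; apply/eqP => e; apply: tt0.
    have tT : t < t0 + T by rewrite lt_neqAle h2 andbT; apply/eqP.
    have nb : \forall q \near t, curve w n z (q - t0) = y q.
      near=> q; rewrite yp //; apply: ltW; near: q; exact: lt_nbhsr.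
    have tc : 0 <= t - t0 by rewrite subr_ge0.
    have dp := is_derive_curve_subr htr tc.
    have [dy ey] := derive_near nb dp.
    split => //; rewrite ey yp //; apply: filippov_intro; first exact: curve_domain htr tc.
    by rewrite side_curve; apply: pos; apply/andP; split; lra.
have hJ : J = I.
  apply: (hmax J y) => //.
  - split; first by move=> a b; rewrite /J /= !in_itv /= => /andP[a0 _] /andP[_ bT] q /andP[aq qb]; rewrite /= in_itv /= (le_trans a0 aq) (le_trans qb bT).
      by rewrite /J /= in_itv /= lexx addr_ge0 // ltW.
    by move=> t; rewrite /J /= !in_itv /= => /andP[-> _].
  - move=> t It; rewrite /J /= in_itv /= (ltW (Ilt _ It)) andbT.
    by have := Ipos _ It; rewrite /= in_itv /= andbT.
  - move=> t It; have [tt|tt] := leP t t0; first by rewrite yx.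
    rewrite yp; last exact: ltW.
    apply/esym; apply: follow sol hI hr It0 x0 It (ltW tt) (ltW (Ilt _ It)).
by apply: nIT; rewrite -hJ /J /= in_itv /= lexx andbT addr_ge0 // ltW.
Unshelve. all: by end_near. Qed.

End Runs.

(** * The periodic orbit *)

Section Periodic.
Context {R : realType}.
Variable eps : R.
Hypothesis sm : small_eps eps.
Implicit Types (X Y v : 'rV[R]_3) (s : bool) (t r : R) (m : int).
Let e0 : 0 < eps. Proof. by case: sm. Qed.
Notation P := (param_values eps).
Notation mu := (@lebesgue_measure R).

Definition closed_cycle (W N Z : bool -> R -> R) (dur : bool -> R) : Prop := forall s,
  leg eps s (W s) (N s) (Z s) (dur s) /\
  curve (W s) (N s) (Z s) (dur s) = curve (W (~~ s)) (N (~~ s)) (Z (~~ s)) 0.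

Lemma closed_cycle_exists : exists W N Z dur, closed_cycle W N Z dur.
Proof.
have [wa [na [xa [Ta [wb [nb [xb [Tb [la lb [a1 a2 a3] [b1 b2 b3]]]]]]]]]] := cycle_exists sm.
exists (fun s => if s then wa else wb), (fun s => if s then na else nb),
  (fun s => if s then xa else xb), (fun s => if s then Ta else Tb).
by case; split => //=; rewrite /curve ?a1 ?a2 ?a3 ?b1 ?b2 ?b3.
Qed.

Variables (W N Z : bool -> R -> R) (dur : bool -> R).
Hypothesis cyc : closed_cycle W N Z dur.

Notation Zp s := (curve (W s) (N s) (Z s)).
Let TT0 s : 0 < dur s.
Proof. by have [[_ _ _ [h _] _] _] := cyc s; apply: lt_trans h; exact: settle_gt0. Qed.

Let per : R := dur true + dur false.
Let per0 : 0 < per. Proof. exact: addr_gt0. Qed.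
Let base r : 'rV[R]_3 := if r < dur true then Zp true r else Zp false (r - dur true).
Definition orbit_fun t : 'rV[R]_3 := base (t - per * (Num.floor (t / per))%:~R).

(* Starting time of the piece of sign s in the m-th period. *)
Let st s m : R := per * m%:~R + (if s then 0 else dur true).
Let stE s m : st s m + dur s = st (~~ s) (if s then m else m + 1).
Proof. by rewrite /st /per; case: s => /=; rewrite ?intrD; ring. Qed.

Let glue s : Zp s (dur s) = Zp (~~ s) 0. Proof. by have [] := cyc s. Qed.
Let trj s : traj eps s (W s) (N s) (Z s). Proof. by have [[]] := cyc s. Qed.

Let orbit_base m t : per * m%:~R <= t -> t < per * (m + 1)%:~R -> orbit_fun t = base (t - per * m%:~R).
Proof.
move=> h1 h2; rewrite /orbit_fun; have -> // : Num.floor (t / per) = m.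
by apply: floor_def; rewrite ler_pdivlMr // ltr_pdivrMr // !(mulrC _ per) h1.
Qed.

(** Both end points are included: consecutive pieces agree where they meet. *)
Lemma orbit_piece s m t : st s m <= t -> t <= st s m + dur s -> orbit_fun t = Zp s (t - st s m).
Proof.
have pE : per * (m + 1)%:~R = per * m%:~R + dur true + dur false by rewrite intrD /per; ring.
have := TT0 true; have := TT0 false => Tf Tt.
case: s; rewrite /st => h1; rewrite le_eqVlt => /orP[/eqP e|h2].
- rewrite (@orbit_base m) /base; [|lra..].
  have -> : t - per * m%:~R = dur true by rewrite e; ring.
  rewrite ltxx subrr; have <- : Zp true (dur true) = Zp false 0 := glue true.
  by congr (Zp true _); rewrite e; ring.
- rewrite (@orbit_base m) /base; [|lra..].
  have -> : t - per * m%:~R < dur true by lra.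
  by rewrite addr0.
- have e' : t = per * (m + 1)%:~R by rewrite e pE.
  rewrite (@orbit_base (m + 1)) /base; first last.
  + by rewrite e' ltr_pM2l // ltr_int ltrDl.
  + by rewrite e'.
  have -> : t - per * (m + 1)%:~R = 0 by rewrite e' subrr.
  rewrite TT0; have <- : Zp false (dur false) = Zp true 0 := glue false.
  by rewrite e; congr (Zp false _); ring.
- rewrite (@orbit_base m) /base; [|lra..].
  have -> : t - per * m%:~R < dur true = false by apply/negbTE; rewrite -leNgt; lra.
  by congr (Zp false _); ring.
Qed.

Let right_piece t : exists s m, st s m <= t /\ t < st s m + dur s.
Proof.
pose m := Num.floor (t / per).
have h1 : per * m%:~R <= t by rewrite mulrC -ler_pdivlMr // /m floor_le.
have h2 : t < per * m%:~R + dur true + dur false.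
  rewrite -addrA -/per; have -> : per * m%:~R + per = (m + 1)%:~R * per by rewrite intrD; ring.
  by rewrite -ltr_pdivrMr // /m floorD1_gt.
have [h|h] := ltP t (per * m%:~R + dur true).
  by exists true, m; rewrite /st addr0.
by exists false, m; rewrite /st.
Qed.

Let left_piece t : exists s m, st s m < t /\ t <= st s m + dur s.
Proof.
have [s [m [h1 h2]]] := right_piece t.
move: h1; rewrite le_eqVlt => /orP[/eqP e|h1]; last by exists s, m; rewrite ltW.
have [m' hm'] : exists m', st (~~ s) m' + dur (~~ s) = st s m.
  case: s {h2 e} => /=.
    by exists (m - 1); rewrite (stE false) /= subrK.
  by exists m; rewrite (stE true).
by exists (~~ s), m'; rewrite hm' e lexx -e -hm' ltrDl.
Qed.

Lemma orbit_lip r t : r <= t -> `|orbit_fun t - orbit_fun r| <= 20 * (t - r).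
Proof.
move=> rt.
apply: (interval_chain (P := fun a b => `|orbit_fun b - orbit_fun a| <= 20 * (b - a)) rt).
  move=> a b c _ _ _ _ h1 h2.
  have -> : orbit_fun c - orbit_fun a = (orbit_fun c - orbit_fun b) + (orbit_fun b - orbit_fun a).
    by rewrite addrA subrK.
  apply: le_trans (ler_normD _ _) _; lra.
move=> c _.
have [s [m [h1 h2]]] := right_piece c; have [s' [m' [h1' h2']]] := left_piece c.
exists (Num.min (st s m + dur s - c) (c - st s' m')); first by rewrite lt_min !subr_gt0 h1' h2.
have k1 : Num.min (st s m + dur s - c) (c - st s' m') <= st s m + dur s - c by rewrite ge_min lexx.
have k2 : Num.min (st s m + dur s - c) (c - st s' m') <= c - st s' m' by rewrite ge_min lexx orbT.
split => [a _ ca ac|b _ cb bc].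
  rewrite !(@orbit_piece s' m'); [|lra..].
  have -> : c - a = (c - st s' m') - (a - st s' m') by ring.
  by apply: curve_lip (trj s') _ _ => //; lra.
rewrite !(@orbit_piece s m); [|lra..].
have -> : b - c = (b - st s m) - (c - st s m) by ring.
by apply: curve_lip (trj s) _ _ => //; lra.
Qed.

Let switches : set R := range (fun p : bool * int => st p.1 p.2).
Let ae_switch : {ae mu, forall t, ~ switches t}.
Proof.
have cs : countable switches.
  by apply: (card_le_trans (card_image_le _ _)); exact: countableP.
exists switches; split; first by apply: countable_measurable => //; exact: measurable_set1.
  exact: countable_lebesgue_measure0.
by move=> t /contrapT.
Qed.

Lemma orbit_solution : solution P setT orbit_fun.
Proof.
split => [t _|a b ab _|].
- have [s [m [h1 h2]]] := right_piece t.
  rewrite (@orbit_piece s m) ?(ltW h2) //; apply: curve_domain (trj s) _.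
  by rewrite subr_ge0.
- by apply: (@lip_ac _ _ _ _ _ 20) => r t _ rt _; exact: orbit_lip.
apply: ae_mono ae_switch => t nt _.
have [s [m [h1 h2]]] := right_piece t.
have h1' : st s m < t.
  by rewrite lt_neqAle h1 andbT; apply/eqP => e; apply: nt; exists (s, m).
have nb : \forall q \near t, Zp s (q - st s m) = orbit_fun q.
  near=> q; rewrite (@orbit_piece s m) //; apply: ltW.
    near: q; exact: lt_nbhsr.
  near: q; exact: lt_nbhsl.
have tc : 0 <= t - st s m by rewrite subr_ge0.
have dp := is_derive_curve_subr (trj s) tc.
have [dy ey] := derive_near nb dp.
split => //; rewrite ey (@orbit_piece s m) ?(ltW h2) //.
apply: filippov_intro; first exact: curve_domain (trj s) tc.
rewrite side_curve; have [[_ _ _ _ pos] _] := cyc s; apply: pos.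
by apply/andP; split; lra.
Unshelve. all: by end_near. Qed.

Lemma orbit_periodic t : orbit_fun (t + per) = orbit_fun t.
Proof.
have [s [m [h1 h2]]] := right_piece t.
have e : st s (m + 1) = st s m + per by rewrite /st intrD; ring.
rewrite (@orbit_piece s (m + 1)) ?e; [|lra..].
by rewrite (@orbit_piece s m) ?(ltW h2) //; congr (Zp s _); ring.
Qed.

Lemma orbit_range X : range orbit_fun X <-> exists s t, [/\ 0 <= t, t <= dur s & X = Zp s t].
Proof.
split => [[t _ <-]|[s [t [t0 tT ->]]]].
  have [s [m [h1 h2]]] := right_piece t.
  exists s, (t - st s m); rewrite (@orbit_piece s m) ?(ltW h2) //; split => //; lra.
by exists (st s 0 + t) => //; rewrite (@orbit_piece s 0); [congr (Zp s _); ring | lra..].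
Qed.

Lemma orbit_is_periodic_orbit : periodic_orbit P (range orbit_fun).
Proof.
exists orbit_fun; split => //; first exact: orbit_solution.
  by exists per => // t; exact: orbit_periodic.
exists (st true 0), (st true 0 + dur true / 2) => h.
have T_pos := TT0 true.
have := congr1 (side true) h; rewrite !(@orbit_piece true 0) ?side_curve; [|lra..].
have [[_ _ g0 _ pos] _] := cyc true.
rewrite subrr g0 => /esym e; have := pos (st true 0 + dur true / 2 - st true 0).
rewrite e ltxx => /(_ ltac:(apply/andP; split; lra)); by [].
Qed.

End Periodic.

(** * Attraction *)

Section Distance.
Context {R : realType}.
Implicit Types (X Y : 'rV[R]_3) (A : set 'rV[R]_3).

Lemma dist_le X Y A : A Y -> dist X A <= `|X - Y|.
Proof.
move=> AY; apply: ge_inf; last by exists Y.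
by exists 0 => _ [Z _ <-].
Qed.

Lemma dist_ge0 X A : A !=set0 -> 0 <= dist X A.
Proof.
move=> [Y AY]; apply: lb_le_inf; first by exists `|X - Y|, Y.
by move=> _ [Z _ <-].
Qed.

End Distance.

Section Attraction.
Context {R : realType}.
Variable eps : R.
Hypothesis sm : small_eps eps.
Implicit Types (X Y v : 'rV[R]_3) (s : bool) (t r d : R) (I : set R) (x : R -> 'rV[R]_3).
Let e0 : 0 < eps. Proof. by case: sm. Qed.
Let e1 : eps <= 1 / 100. Proof. by case: sm. Qed.
Notation P := (param_values eps).

Variables (W N Z : bool -> R -> R) (dur : bool -> R).
Hypothesis cyc : closed_cycle eps W N Z dur.
Notation Zp s := (curve (W s) (N s) (Z s)).
Notation Gam := (range (orbit_fun W N Z dur)).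

Let lg s : leg eps s (W s) (N s) (Z s) (dur s). Proof. by have [] := cyc s. Qed.
Let T0p : 0 < settle eps. Proof. exact: settle_gt0. Qed.

(** X lies on Sigma close enough to the equilibrium of the other mode for a leg
    of sign s to start. *)
Definition at_gate s X : Prop := side s X = 0 /\ near_eq eps (~~ s) (st_w X) (st_eta X).

Definition gate_dist s X : R := nrm2 (st_w X - W s 0) (st_eta X - N s 0).

(* Speed 20 during a delay of at most 250 d / eps, plus the distance d of
   simultaneous points. *)
Let C : R := 1 + 20 * (250 / eps).
Let C0 : 0 <= C.
Proof.
rewrite /C; apply: addr_ge0; first exact: ler01.
apply: mulr_ge0; first exact: ler0n.
by apply: divr_ge0; [exact: ler0n | exact: ltW].
Qed.

Lemma run_of_leg s w n z T : leg eps s w n z T -> run eps s w n z T.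
Proof.
by move=> [h hN g0 [hT _] pos]; split => //; [exact: lt_trans hT | right].
Qed.

(** The solution follows a leg; at equal times it is within d of the leg of the
    cycle, and in case it lasts longer, the excess time is bounded by
    [leg_time]. *)
Lemma gate_step s I x t0 d : maximal_forward_solution P I x -> I t0 -> at_gate s (x t0) ->
  0 <= d -> gate_dist s (x t0) <= d ^+ 2 ->
  exists2 T, settle eps < T & [/\ I (t0 + T), at_gate (~~ s) (x (t0 + T)),
    gate_dist (~~ s) (x (t0 + T)) <= (d / 20) ^+ 2 &
    forall t, t0 <= t <= t0 + T -> I t /\ dist (x t) Gam <= C * d].
Proof.
move=> hmax It0 [g0 hN] d0 hd; have [[_ _ _] [xdom _ _] _] := hmax.
have [_ hx01] := xdom _ It0.
have e01 : 0 < eps <= 1 by apply/andP; split => //; have := e1; lra.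
have hb := near_box sm (near_slack sm hN).
have [w [n [z [htr hw hn hz]]]] := traj_exists s e01 hb hx01.
have x0 : x t0 = curve w n z 0 by rewrite /curve hw hn hz mkstate_eq.
have [||T lT] := leg_of_traj sm htr.
- by rewrite hw hn.
- by move: g0; rewrite x0 side_curve.
have [hT gT] : settle eps < T /\ depth s (n T) (z T) = 0 by have [_ _ _ []] := lT.
have T_gt0 : 0 < T by exact: lt_trans hT.
have [IT xT] := reach sm hmax (run_of_leg lT) It0 x0.
have xend : x (t0 + T) = curve w n z T.
  have [|_ ->] := xT (t0 + T); first by rewrite lexx lerDl ltW.
  by congr (curve _ _ _ _); ring.
have hd' : nrm2 (w 0 - W s 0) (n 0 - N s 0) <= d ^+ 2 by rewrite hw hn.
exists T => //; split => //.
- split; first by rewrite xend side_curve depthN gT oppr0.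
  by rewrite xend /curve !mkstateE negbK; exact: (leg_end_near sm lT).
- rewrite /gate_dist xend /curve !mkstateE.
  have [_ glue] := cyc s; rewrite /curve in glue.
  have <- : W s (dur s) = W (~~ s) 0 by have := congr1 (@st_w R) glue; rewrite !mkstateE.
  have <- : N s (dur s) = N (~~ s) 0 by have := congr1 (@st_eta R) glue; rewrite !mkstateE.
  exact: (leg_end sm lT (lg s) d0 hd').
move=> t ht; have [It xt] := xT t ht; split => //.
move: ht => /andP[t0t tT].
have hcmp r : 0 <= r -> `|curve w n z r - Zp s r| <= d.
  move=> r0; have [a1 a2] := leg_close_fast lT (lg s) d0 hd' r0.
  have a3 := leg_close_xi sm lT (lg s) d0 hd' r0.
  apply: state_norm; rewrite ?st_subE /curve ?mkstateE //.
    by apply: le_trans a2 _; lra.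
  by apply: le_trans a3 _; lra.
have TTp : 0 <= dur s.
  by apply: ltW; have [_ _ _ [h _] _] := lg s; exact: lt_trans h.
rewrite xt; set q := t - t0; have q0 : 0 <= q by rewrite subr_ge0.
have dC : d <= C * d by rewrite ler_peMl // /C lerDl; apply: mulr_ge0; [exact: ler0n | apply: divr_ge0; [exact: ler0n | exact: ltW]].
have [qT|Tq] := leP q (dur s).
  apply: le_trans (dist_le _ _) _; last exact: le_trans (hcmp q q0) dC.
  by apply/(orbit_range sm cyc); exists s, q.
have qT : q <= T by rewrite /q; lra.
apply: (le_trans (@dist_le _ _ (Zp s (dur s)) _ _)).
  by apply/(orbit_range sm cyc); exists s, (dur s).
have hsym : nrm2 (W s 0 - w 0) (N s 0 - n 0) <= d ^+ 2.
  by have -> : nrm2 (W s 0 - w 0) (N s 0 - n 0) = nrm2 (w 0 - W s 0) (n 0 - N s 0) by rewrite /nrm2; ring.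
have htime := leg_time sm (lg s) lT d0 hsym (ltW (lt_le_trans Tq qT)).
have h1 : `|curve w n z q - curve w n z (dur s)| <= 20 * (q - dur s).
  by apply: curve_lip htr TTp (ltW Tq).
have h2 := hcmp _ TTp.
have -> : curve w n z q - Zp s (dur s) =
  (curve w n z q - curve w n z (dur s)) + (curve w n z (dur s) - Zp s (dur s)) by rewrite addrA subrK.
apply: le_trans (ler_normD _ _) _.
have -> : C * d = 20 * (250 * d / eps) + d by rewrite /C; ring.
apply: lerD => //; apply: le_trans h1 _.
by rewrite ler_pM2l ?ltr0n //; apply: le_trans htime; rewrite lerD2r.
Qed.

(** Each leg lasts at least settle eps, so k legs cover k * settle eps. *)
Lemma gate_stay k s I x t0 d : maximal_forward_solution P I x -> I t0 -> at_gate s (x t0) ->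
  0 <= d -> gate_dist s (x t0) <= d ^+ 2 ->
  forall t, t0 <= t -> t <= t0 + k%:R * settle eps -> I t /\ dist (x t) Gam <= C * d.
Proof.
move=> hmax; elim: k s t0 d => [|k IH] s t0 d It0 ga d0 hd t t0t.
  rewrite mul0r addr0 => tt0.
  have [T hT [_ _ _ h]] := gate_step hmax It0 ga d0 hd; apply: h.
  by rewrite t0t (le_trans tt0) // lerDl ltW // (lt_trans T0p).
move=> tk; have [T hT [IT gT dT h]] := gate_step hmax It0 ga d0 hd.
have [tT|tT] := leP t (t0 + T); first by apply: h; rewrite t0t.
have d20 : 0 <= d / 20 by lra.
have tk' : t <= t0 + T + k%:R * settle eps.
  by move: tk; rewrite -natr1 mulrDl mul1r; lra.
have [It hdist] := IH _ _ _ IT gT d20 dT t (ltW tT) tk'; split => //.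
by apply: le_trans hdist _; apply: ler_wpM2l => //; lra.
Qed.

Lemma gate_stay_forever s I x t0 d : maximal_forward_solution P I x -> I t0 -> at_gate s (x t0) ->
  0 <= d -> gate_dist s (x t0) <= d ^+ 2 ->
  forall t, t0 <= t -> I t /\ dist (x t) Gam <= C * d.
Proof.
move=> hmax It0 ga d0 hd t t0t.
apply: (@gate_stay (Num.truncn ((t - t0) / settle eps)).+1 s I x t0 d) => //.
have := truncnS_gt ((t - t0) / settle eps); rewrite ltr_pdivrMr // => h; lra.
Qed.

Lemma later_gate k s I x t0 d : maximal_forward_solution P I x -> I t0 -> at_gate s (x t0) ->
  0 <= d -> gate_dist s (x t0) <= d ^+ 2 ->
  exists s' t', [/\ t0 <= t', I t', at_gate s' (x t') & gate_dist s' (x t') <= (d / 2 ^+ k) ^+ 2].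
Proof.
move=> hmax; elim: k s t0 d => [|k IH] s t0 d It0 ga d0 hd.
  by exists s, t0; rewrite expr0 divr1.
have [T hT [IT gT dT _]] := gate_step hmax It0 ga d0 hd.
have d2 : 0 <= d / 2 by lra.
have dT2 : gate_dist (~~ s) (x (t0 + T)) <= (d / 2) ^+ 2.
  by apply: le_trans dT _; apply: sqr_mono; lra.
have [s' [t' [h1 h2 h3 h4]]] := IH _ _ _ IT gT d2 dT2.
exists s', t'; split => //.
  by apply: le_trans h1; rewrite lerDl ltW // (lt_trans T0p).
by have -> : d / 2 ^+ k.+1 = d / 2 / 2 ^+ k by rewrite exprS invfM mulrA.
Qed.

Lemma gate_attracted s I x t0 : maximal_forward_solution P I x -> I t0 -> at_gate s (x t0) ->
  I = `[0, +oo[%classic /\ dist (x t) Gam @[t --> +oo] --> (0 : R).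
Proof.
move=> hmax It0 ga.
pose d := 1 + gate_dist s (x t0).
have gd0 : 0 <= gate_dist s (x t0) by exact: nrm2_ge0.
have d0 : 0 <= d by rewrite addr_ge0.
have hd : gate_dist s (x t0) <= d ^+ 2 by rewrite /d; nra.
have [[hI I0 Ipos] _ _] := hmax.
split.
  apply/seteqP; split => // t; rewrite /= in_itv /= andbT => t_ge0.
  have [tt|tt] := leP t t0; first by apply: (hI 0 t0) => //; rewrite t_ge0.
  by have [] := gate_stay_forever hmax It0 ga d0 hd (ltW tt).
apply/cvgrPdist_le => e e_gt0.
have [k hk] := geom_small (C * d) e_gt0.
have [s' [t' [h1 h2 h3 h4]]] := later_gate k hmax It0 ga d0 hd.
near=> t.
have t't : t' <= t by near: t; apply: nbhs_pinfty_ge; exact: num_real.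
have dk : 0 <= d / 2 ^+ k by exact: (divr_ge0 d0 (exprn_ge0 k (ler0n R 2))).
have [It] := gate_stay_forever hmax h2 h3 dk h4 t't.
rewrite sub0r normrN ger0_norm; last by apply: dist_ge0; exists (orbit_fun W N Z dur 0), 0.
move/le_trans; apply; apply: le_trans hk; by rewrite mulrA.
Unshelve. all: by end_near. Qed.

(** Either the state lies in the region of mode s at a time of the transition
    when xi is still near its starting value, or (w, eta) has settled near the
    equilibrium of mode s and xi may have any value down to slightly beyond
    Sigma.  The inequalities are strict so that the conditions are open. *)
Definition basin_cond s X : Prop :=
  (0 < side s X /\ 0 < 2 / 100 - sgm s * (st_xi X - (16 / 10 * eta_eq (~~ s) - 6 / 10))) \/
  (0 < (eps / 500) ^+ 2 - nrm2 (st_w X - w_eq s) (st_eta X - eta_eq s) /\ 0 < side s X + 1 / 100).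
Definition basin : set 'rV[R]_3 :=
  [set X | in_box_strict (st_w X) (st_eta X) /\ (basin_cond true X \/ basin_cond false X)].

Lemma gate_from_side s I x : maximal_forward_solution P I x ->
  in_box (st_w (x 0)) (st_eta (x 0)) -> 0 < side s (x 0) ->
  launch s (st_xi (x 0)) \/ near_eq eps s (st_w (x 0)) (st_eta (x 0)) ->
  exists s' t, I t /\ at_gate s' (x t).
Proof.
move=> hmax hb hs hl; have [[_ I0 _] [xdom _ _] _] := hmax.
have [_ hx01] := xdom _ I0.
have e01 : 0 < eps <= 1 by apply/andP; split => //; have := e1; lra.
have [w [n [z [htr hw hn hz]]]] := traj_exists s e01 hb hx01.
have x0 : x 0 = curve w n z 0 by rewrite /curve hw hn hz mkstate_eq.
have g0 : 0 < depth s (n 0) (z 0) by rewrite hn hz.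
have [hp _] := htr.
have [T [T_gt0 gT pos nT]] : exists T, [/\ 0 < T, depth s (n T) (z T) = 0,
    forall t, 0 < t < T -> 0 < depth s (n t) (z t) & near_eq eps s (w T) (n T)].
  case: hl => [hl|hl].
    have early := early_pos sm htr (ltW g0); rewrite hz in early; have {}early := early hl.
    have gT0 : 0 < depth s (n (settle eps)) (z (settle eps)) by apply: early; rewrite T0p lexx.
    have [T [h1 h2 h3]] := phase_hit sm htr (ltW T0p) (near_late_eq sm hp (lexx _)) gT0.
    exists T; split => //; first exact: lt_trans h1.
      move=> t /andP[t0 tT]; have [tt|tt] := leP t (settle eps); first by apply: early; rewrite t0.
      by apply: h3; rewrite ltW.
    exact: (near_late_eq sm hp (ltW h1)).
  have nT0 : near_eq eps s (w 0) (n 0) by rewrite hw hn.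
  have [T [h1 h2 h3]] := phase_hit sm htr (lexx 0) nT0 g0.
  exists T; split => //.
    by move=> t /andP[t0 tT]; apply: h3; rewrite ltW.
  exact: near_forward hp (lexx 0) (ltW h1) nT0.
have hr : run eps s w n z T by split => //; left.
have [IT xT] := reach sm hmax hr I0 x0.
exists (~~ s), T; rewrite add0r in IT; split => //.
have [|_] := xT T; first by rewrite add0r lexx ltW.
rewrite subr0 => ->; split; first by rewrite side_curve depthN gT oppr0.
by rewrite /curve !mkstateE negbK.
Qed.

(** A settled state slightly beyond Sigma is launched in the other mode, since
    its xi is close to gamma at the equilibrium of mode s. *)
Lemma gate_from_basin I x : maximal_forward_solution P I x -> basin (x 0) ->
  exists s t, I t /\ at_gate s (x t).
Proof.
move=> hmax [hb hc]; have [[_ I0 _] _ _] := hmax.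
have {}hb := in_boxW hb.
have [s hs] : exists s, basin_cond s (x 0) by case: hc => h; [exists true | exists false].
case: hs => [[h1 h2]|[h1 h2]].
  by apply: (gate_from_side hmax hb h1); left; rewrite /launch; move: h2; rewrite subr_gt0 => /ltW.
have hN : near_eq eps s (st_w (x 0)) (st_eta (x 0)) by move: h1; rewrite subr_gt0 => /ltW.
have [hs|hs|hs] := ltgtP (side s (x 0)) 0.
- have hs' : 0 < side (~~ s) (x 0) by rewrite sideN oppr_gt0.
  apply: (gate_from_side hmax hb hs'); left.
  apply: (near_launch sm (a := st_w (x 0)) (b := st_eta (x 0))); first by rewrite negbK.
  by rewrite -/(side (~~ s) (x 0)); lra.
- by apply: (gate_from_side hmax hb hs); right.
by exists (~~ s), 0; split => //; split; [rewrite sideN hs oppr0 | rewrite negbK].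
Qed.

Lemma open_pos (f : 'rV[R]_3 -> R) : continuous f -> open [set X | 0 < f X].
Proof.
move=> cf; rewrite (_ : [set X | 0 < f X] = f @^-1` [set y | 0 < y]) //.
by apply: open_comp; [move=> X _; exact: cf | exact: open_gt].
Qed.

Let cst_cont (c : R) X : (fun _ : 'rV[R]_3 => c) Y @[Y --> X] --> c.
Proof. exact: (@cst_continuous _ _ c X). Qed.

Lemma side_continuous s : continuous (@side R s).
Proof.
move=> X; exact: (cvgM (@cst_cont (sgm s) X) (cvgB (cvgB
  (cvgM (@cst_cont (16 / 10) X) (@st_eta_cont R X)) (@cst_cont (6 / 10) X))
  (@st_xi_cont R X))).
Qed.

Lemma basin_open : open basin.
Proof.
have cw := @st_w_cont R; have cn := @st_eta_cont R; have cx := @st_xi_cont R.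
have cB (f : 'rV[R]_3 -> R) (c : R) : continuous f -> continuous (fun X => f X - c).
  by move=> cf X; exact: (cvgB (cf X) (@cst_cont c X)).
have cB' (f : 'rV[R]_3 -> R) (c : R) : continuous f -> continuous (fun X => c - f X).
  by move=> cf X; exact: (cvgB (@cst_cont c X) (cf X)).
have cM (f g : 'rV[R]_3 -> R) : continuous f -> continuous g -> continuous (fun X => f X * g X).
  by move=> cf cg X; exact: (cvgM (cf X) (cg X)).
have cD (f g : 'rV[R]_3 -> R) : continuous f -> continuous g -> continuous (fun X => f X + g X).
  by move=> cf cg X; exact: (cvgD (cf X) (cg X)).
have cc (c : R) : continuous (fun _ : 'rV[R]_3 => c) by move=> X; exact: cst_cont.
have obox : open [set X : 'rV[R]_3 | in_box_strict (st_w X) (st_eta X)].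
  rewrite (_ : [set X : 'rV[R]_3 | in_box_strict (st_w X) (st_eta X)] = [set X | 0 < st_w X - - (12 / 10)] `&` [set X | 0 < 58 / 10 - st_w X] `&`
    ([set X | 0 < st_eta X - 7 / 10] `&` [set X | 0 < 97 / 100 - st_eta X])).
    by apply: openI; apply: openI; apply: open_pos; [exact: cB | exact: cB' | exact: cB | exact: cB'].
  apply/seteqP; split => X /=; rewrite !subr_gt0 => h; first by case: h.
  by case: h => [[? ?] [? ?]]; split.
have ocond s : open [set X | basin_cond s X].
  rewrite (_ : [set X | basin_cond s X] = ([set X | 0 < side s X] `&` [set X | 0 < 2 / 100 - sgm s * (st_xi X - (16 / 10 * eta_eq (~~ s) - 6 / 10))]) `|`
   ([set X | 0 < (eps / 500) ^+ 2 - nrm2 (st_w X - w_eq s) (st_eta X - eta_eq s)] `&` [set X | 0 < side s X + 1 / 100])) //.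
  apply: openU; apply: openI; apply: open_pos.
  - exact: side_continuous.
  - by apply: cB'; apply: cM => //; exact: cB.
  - by apply: cB'; apply: cD; [apply: cM; exact: (@cB) | apply: (@cM) => //; apply: (@cM); exact: (@cB)].
  - by apply: cD => //; exact: side_continuous.
rewrite (_ : basin = [set X | in_box_strict (st_w X) (st_eta X)] `&` ([set X | basin_cond true X] `|` [set X | basin_cond false X])) //.
by apply: openI => //; exact: openU.
Qed.

Lemma cycle_in_basin X : Gam X -> basin X /\ domain X.
Proof.
move=> /(orbit_range sm cyc)[s [t [t0 tT ->]]].
have [htr hN g0 [hT gT] pos] := lg s; have [hp _] := htr.
split; last exact: curve_domain htr t0.
split; first by rewrite /curve !mkstateE; apply: (fast_traj_strict hp _ t0); exact: (near_box_strict sm (near_slack sm hN)).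
suff [s' h] : exists s', basin_cond s' (Zp s t) by case: s' h; [left | right].
have tiny : (eps / 1000) ^+ 2 < (eps / 500) ^+ 2.
  by have := e0; nra.
have [tT0|tT0] := ltP (settle eps) t.
  exists s; right; rewrite side_curve /curve !mkstateE; split.
    by rewrite subr_gt0; apply: le_lt_trans tiny; exact: (near_late sm hp (ltW tT0)).
  move: tT; rewrite le_eqVlt => /orP[/eqP ->|tT]; first by rewrite gT; lra.
  have := pos t; rewrite tT (lt_trans T0p tT0) => /(_ isT); lra.
move: t0; rewrite le_eqVlt => /orP[/eqP <-|t0].
  exists (~~ s); right; rewrite side_curve depthN g0 oppr0 add0r; split; last lra.
  have [_ glue] := cyc (~~ s); rewrite negbK in glue; rewrite -glue /curve !mkstateE.
  have [[hp' _] _ _ [hT' _] _] := lg (~~ s).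
  by rewrite subr_gt0; apply: le_lt_trans tiny; exact: (near_late sm hp' (ltW hT')).
exists s; left; rewrite side_curve /curve !mkstateE; split.
  by apply: pos; rewrite t0 (le_lt_trans tT0).
have h1 := xi_drift sm htr (ltW t0).
have h2 : eps * t <= 3 / 1000 by rewrite -(eps_settle sm) ler_pM2l.
have d0 : 0 <= eps / 500 by have := e0; lra.
have [_] := nrm2_bound d0 hN; rewrite ler_norml => /andP[h3 h4].
move: h1 g0 e1; rewrite /depth ler_norml => /andP[h5 h6].
by case: (@sgm_cases R s) => ->; lra.
Qed.

Lemma cycle_attracting : attracting P Gam.
Proof.
exists (basin `&` @domain R); split; first by exists basin => //; exact: basin_open.
  by move=> X /cycle_in_basin.
move=> I x hmax [xb _]; have [s [t [It gt]]] := gate_from_basin hmax xb.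
exact: gate_attracted hmax It gt.
Qed.

End Attraction.

(** From y <= exp y with y = settle eps / 20, exp (- settle / 10) is of order
    eps^2. *)
Lemma small_eps_le (R : realType) (eps : R) : 0 < eps -> eps <= (1 / 1000) ^+ 5 -> small_eps eps.
Proof.
move=> e0 e1.
have e2 : eps <= 1 / 1000 * (1 / 1000 ^+ 4) by move: e1; rewrite !exprS expr0; lra.
split => //; first by apply: le_trans e1 _; lra.
have [y yT yE] : exists2 y, settle eps / 10 = y + y & y * eps = 3 / (20 * 1000).
  exists (settle eps / 10 / 2); first by field.
  by rewrite /settle; field; rewrite gt_eqF.
have y0 : 0 < y by rewrite -(pmulr_lgt0 _ e0) yE; lra.
have hy : y <= expR y by have := expR_ge1Dx y; lra.
have yy : 0 < y * y by exact: mulr_gt0.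
have h : expR (- (settle eps / 10)) <= (y * y)^-1.
  rewrite yT expRN expRD lef_pV2 ?posrE //; last by apply: mulr_gt0; exact: expR_gt0.
  by apply: ler_pM => //; exact: ltW.
have c0 : 0 <= 3 * 1000 ^+ 2 :> R by rewrite mulr_ge0 ?exprn_ge0 ?ler0n.
apply: le_trans (ler_wpM2l c0 h) _.
have -> : (y * y)^-1 = eps * eps * (20 * 1000 / 3) ^+ 2.
  have -> : y = 3 / (20 * 1000) / eps by rewrite -yE mulfK // gt_eqF.
  by field; rewrite gt_eqF.
have := ler_wpM2l (ltW e0) e2; lra.
Qed.

Theorem theorem5p6 (R : realType) :
  exists2 epshat : R, 0 < epshat &
    forall eps : R, 0 < eps -> eps <= epshat ->
      exists Gam : set 'rV[R]_3,
        periodic_orbit (param_values eps) Gam /\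
        attracting (param_values eps) Gam.
Proof.
exists ((1 / 1000) ^+ 5); first by apply: exprn_gt0; lra.
move=> eps e0 e1; have sm := small_eps_le e0 e1.
have [W [N [Z [dur cyc]]]] := closed_cycle_exists sm.
exists (range (orbit_fun W N Z dur)); split; first exact: (orbit_is_periodic_orbit sm cyc).
exact: (cycle_attracting sm cyc).
Qed.
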